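(* Let $\mu_0\in\mathbf{T}$ be such that $e^{-i\mu_0}\in\sigma_p(U_{np})$. Fix $s\in(0,1/2]$ and $\theta\in\mathcal{O}^-_0$. There exists $\epsilon_0>0$ such that for any $\epsilon\in(0,\epsilon_0]$ the number of eigenvalues of $U_\epsilon(\theta)$ inside the loop $$\exp(-i\mathcal{L}_{\epsilon,s}(\mu_0))=\{e^{-i\kappa} : \kappa\in\mathcal{L}_{\epsilon,s}(\mu_0)\},$$ counted with algebraic multiplicity, coincides with the multiplicity of the eigenvalue $e^{-i\mu_0}$ of $U_{np}$.
   Context: Notation. $\mathcal{H}=\ell^2(\mathbf{Z}^2;\mathbf{C}^4)$, $u(x)=[u_\leftarrow(x),u_\rightarrow(x),u_\downarrow(x),u_\uparrow(x)]^{\mathsf T}$. $e_1=[1,0]^{\mathsf T}$, $e_2=[0,1]^{\mathsf T}$. $\mathbf{T}=\mathbf{R}/2\pi\mathbf{Z}$, $\mathbf{T}_{\mathbf{C}}=\mathbf{C}/2\pi\mathbf{Z}$, $\mathcal{O}^-_0=\{\kappa\in\mathbf{T}_{\mathbf{C}} : \mathrm{Im}\,\kappa<0\}$. $\sigma_p(A)$ is the set of eigenvalues of $A$. The algebraic multiplicity of an isolated eigenvalue $\lambda$ of $A$ is the rank of $-\frac{1}{2\pi i}\oint(A-z)^{-1}dz$ over a sufficiently small counterclockwise loop around $\lambda$. The shift is $(Su)(x)=[u_\leftarrow(x+e_1),u_\rightarrow(x-e_1),u_\downarrow(x+e_2),u_\uparrow(x-e_2)]^{\mathsf T}$. A quantum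 walk is $U=SC$ on $\mathcal{H}$, with $C$ multiplication by $C(x)\in\mathrm{U}(4)$. Fix a positive integer $M_0$ and let $\Omega^i=\{x\in\mathbf{Z}^2 : |x_1|\le M_0,\ |x_2|\le M_0\}$. All quantum walks here satisfy $C(x)=I_4$ for $x\in\mathbf{Z}^2\setminus\Omega^i$, so $V=U-S$ has finite rank. Complex translation: for $\theta\in\mathbf{T}_{\mathbf{C}}$, $T(\theta)$ is multiplication by $\mathrm{diag}[e^{i\theta x_1},e^{-i\theta x_1},e^{i\theta x_2},e^{-i\theta x_2}]$. For $\theta\in\mathcal{O}^-_0$, $U(\theta)=T(\theta)UT(\theta)^{-1}$ means the bounded operator $e^{-i\theta}S+T(\theta)VT(\theta)^{-1}$ on $\mathcal{H}$. Non-penetrable barrier. Let $K_1^\pm=\{x\in\Omega^i : x_1=\pm M_0\}$, $K_2^\pm=\{x\in\Omega^i : x_2=\pm M_0\}$, $K=K_1^+\cup K_1^-\cup K_2^+\cup K_2^-$. $U_{np}=SC_{np}$ is a quantum walk on $\mathcal{H}$, where $C_{np}$ is multiplication by $C_{np}(x)\in\mathrm{U}(4)$ with $C_{np}(x)=I_4$ for $x\in\mathbf{Z}^2\setminus\Omega^i$, satisfying, for all $u$, $(U_{np}u)_\rightarrow(x+e_1)=u_\leftarrow(x)$ for $x\in K_1^+$; $(U_{np}u)_\leftarrow(x-e_1)=u_\rightarrow(x)$ for $x\in K_1^-$; $(U_{np}u)_\uparrow(x+e_2)=u_\downarrow(x)$ for $x\in K_2^+$; $(U_{np}u)_\downarrow(x-e_2)=u_\uparrow(x)$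 for $x\in K_2^-$. Perturbation. For $\epsilon\in(0,1]$, $U_\epsilon=SC_\epsilon$ with $C_\epsilon(x)\in\mathrm{U}(4)$, $C_\epsilon(x)=C_{np}(x)$ for $x\in\mathbf{Z}^2\setminus K$, and $|C_\epsilon(x)-C_{np}(x)|_\infty<\epsilon$ for $x\in K$, where $|A|_\infty=\max_{j,k}|a_{j,k}|$. Loop. For fixed constants $a,b>0$ and $s,\epsilon>0$, $\mathcal{L}_{\epsilon,s}(\mu_0)$ is the counterclockwise boundary of the rectangle with vertices $\mu_0\pm a\epsilon^s\pm ib\epsilon^s$; $\epsilon$ is taken so small that there is no $\mu\ne\mu_0$ inside the loop with $e^{-i\mu}\in\sigma_p(U_{np})$. *)

(* Defs.v *)
From mathcomp Require Import all_boot all_order all_algebra.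
From mathcomp Require Export spectral.
From mathcomp Require Export complex.
From mathcomp Require Import all_classical all_reals all_analysis.
Set Implicit Arguments.
Unset Strict Implicit.
Unset Printing Implicit Defensive.
Import Order.TTheory GRing.Theory Num.Theory.
Local Open Scope classical_set_scope.
Local Open Scope ring_scope.
Local Open Scope complex_scope.

(** * Complex exponential and integrals along circles *)

Definition cexp (R : realType) (z : R[i]) : R[i] :=
  (expR (complex.Re z))%:C * (cos (complex.Im z) +i* sin (complex.Im z)).

Definition cmod (R : realType) (z : R[i]) : R := complex.Re `|z|.

Definition cintegral (R : realType) (D : set R) (f : R -> R[i]) : R[i] :=
  (\int[@lebesgue_measure R]_(t in D) complex.Re (f t))
  +i* (\int[@lebesgue_measure R]_(t in D) complex.Im (f t)).

(* Counterclockwise parametrization z = lam + r e^(it), dz = i r e^(it) dt. *)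
Definition circle_integral (R : realType) (lam : R[i]) (r : R)
    (f : R[i] -> R[i]) : R[i] :=
  cintegral `[0, 2 * pi]
    (fun t : R => f (lam + r%:C * cexp ('i * t%:C)) *
                  ('i * r%:C * cexp ('i * t%:C))).

(** * The Hilbert space l^2(Z^2; C^4) *)

Notation site := (int * int)%type.

(* All functions Z^2 -> C^4; the Hilbert space is the subspace [ell2]. Operators
   are given by formulas that make sense on all functions, and every spectral
   notion below only involves their action on [ell2]. *)
Notation wavefn R := (site -> 'cV[R[i]]_4).

Definition norm2 (R : realType) (u : wavefn R) : \bar R :=
  \esum_(x in [set: site]) (\sum_(j < 4) cmod (u x j 0) ^+ 2)%:E.

Definition ell2 (R : realType) : set (wavefn R) :=
  [set u | (norm2 u < +oo)%E].

Notation operator R := (wavefn R -> wavefn R).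

(** * Spectral notions *)

Definition has_dim (F : fieldType) (V : lmodType F) (E : set V) (n : nat) :
    Prop :=
  exists e : 'I_n -> V,
    (forall c : 'I_n -> F, \sum_(i < n) c i *: e i = 0 -> forall i, c i = 0) /\
    E = [set v | exists c : 'I_n -> F, v = \sum_(i < n) c i *: e i].

Definition ell2_eigenspace (R : realType) (A : operator R) (lam : R[i]) :
    set (wavefn R) :=
  [set u | ell2 u /\ A u = lam *: u].

Definition point_spectrum (R : realType) (A : operator R) : set R[i] :=
  [set lam | exists2 u, ell2_eigenspace A lam u & u <> 0].

(* A - z is a bijection of l^2 onto itself with bounded inverse. *)
Definition resolvent_set (R : realType) (A : operator R) : set R[i] :=
  [set z |
    (forall v, ell2 v -> ell2 (A v - z *: v)) /\
    (forall u, ell2 u -> exists! v, ell2 v /\ A v - z *: v = u) /\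
    (exists M : R, forall v, ell2 v ->
       (norm2 v <= M%:E * norm2 (A v - z *: v)%R)%E)].

(* (A - z)^-1 u; a junk value unless z is in the resolvent set. *)
Definition resolvent (R : realType) (A : operator R) (z : R[i])
    (u : wavefn R) : wavefn R :=
  xget 0 [set v | ell2 v /\ A v - z *: v = u].

(* - (2 pi i)^-1 times the integral of (A - z)^-1 u over the circle of radius r
   around lam, computed componentwise: evaluation of a component at a site is a
   bounded functional on l^2, so it commutes with the operator integral. *)
Definition riesz_projection (R : realType) (A : operator R) (lam : R[i])
    (r : R) (u : wavefn R) : wavefn R :=
  fun x => \col_j
    (- ((2 * pi)%:C * 'i)^-1 *
       circle_integral lam r (fun z => resolvent A z u x j 0)).

Definition algebraic_multiplicity (R : realType) (A : operator R)
    (lam : R[i]) (n : nat) : Prop :=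
  point_spectrum A lam /\
  exists2 r0 : R, 0 < r0 &
    (forall z, 0 < cmod (z - lam) < r0 -> resolvent_set A z) /\
    (forall r, 0 < r < r0 ->
       has_dim [set riesz_projection A lam r u | u in @ell2 R] n).

(* There are finitely many eigenvalues of A in D, all of them isolated, and
   their algebraic multiplicities add up to n. *)
Definition eigenvalue_count (R : realType) (A : operator R) (D : set R[i])
    (n : nat) : Prop :=
  exists (s : seq R[i]) (m : R[i] -> nat),
    [/\ uniq s,
        forall lam, lam \in s <-> D lam /\ point_spectrum A lam,
        forall lam, lam \in s -> algebraic_multiplicity A lam (m lam) &
        n = (\sum_(lam <- s) m lam)%N].

(** * Quantum walks *)

(* Order of the components: left, right, down, up. *)
Definition dir_left : 'I_4 := @Ordinal 4 0 isT.
Definition dir_right : 'I_4 := @Ordinal 4 1 isT.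
Definition dir_down : 'I_4 := @Ordinal 4 2 isT.
Definition dir_up : 'I_4 := @Ordinal 4 3 isT.

Definition e1 : site := (1, 0).
Definition e2 : site := (0, 1).

Definition col4 (K : Type) (a b c d : K) : 'cV[K]_4 :=
  \col_(j < 4) nth a [:: a; b; c; d] j.

Definition walk_shift (R : realType) (u : wavefn R) : wavefn R :=
  fun x => col4 (u (x + e1) dir_left 0) (u (x - e1) dir_right 0)
                (u (x + e2) dir_down 0) (u (x - e2) dir_up 0).

Definition mult_op (R : realType) (C : site -> 'M[R[i]]_4) (u : wavefn R) :
    wavefn R :=
  fun x => C x *m u x.

Definition walk (R : realType) (C : site -> 'M[R[i]]_4) : operator R :=
  fun u => walk_shift (mult_op C u).

Definition Omega_i (M0 : nat) : set site :=
  [set x | `|x.1| <= M0%:Z /\ `|x.2| <= M0%:Z].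

Definition coin (R : realType) (M0 : nat) (C : site -> 'M[R[i]]_4) : Prop :=
  (forall x, C x \is unitarymx) /\
  (forall x, ~ Omega_i M0 x -> C x = 1%:M).

(** * Complex translation *)

Definition translation_mx (R : realType) (theta : R[i]) (x : site) :
    'M[R[i]]_4 :=
  diag_mx (col4 (cexp ('i * theta * x.1%:~R)) (cexp (- ('i * theta * x.1%:~R)))
                (cexp ('i * theta * x.2%:~R)) (cexp (- ('i * theta * x.2%:~R))))^T.

Definition translation (R : realType) (theta : R[i]) : operator R :=
  mult_op (translation_mx theta).

Definition translation_inv (R : realType) (theta : R[i]) : operator R :=
  mult_op (fun x => invmx (translation_mx theta x)).

(* e^(-i theta) S + T(theta) V T(theta)^-1 with V = U - S. *)
Definition translated_walk (R : realType) (C : site -> 'M[R[i]]_4)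
    (theta : R[i]) : operator R :=
  fun u => cexp (- ('i * theta)) *: walk_shift u +
    translation theta
      (let v := translation_inv theta u in walk C v - walk_shift v).

(** * Non-penetrable barrier *)

Definition K1p (M0 : nat) : set site := [set x | Omega_i M0 x /\ x.1 = M0%:Z].
Definition K1m (M0 : nat) : set site := [set x | Omega_i M0 x /\ x.1 = - M0%:Z].
Definition K2p (M0 : nat) : set site := [set x | Omega_i M0 x /\ x.2 = M0%:Z].
Definition K2m (M0 : nat) : set site := [set x | Omega_i M0 x /\ x.2 = - M0%:Z].
Definition barrier (M0 : nat) : set site := K1p M0 `|` K1m M0 `|` K2p M0 `|` K2m M0.

Definition nonpenetrable (R : realType) (M0 : nat) (C : site -> 'M[R[i]]_4) :
    Prop :=
  forall u : wavefn R, ell2 u ->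
  [/\ forall x, K1p M0 x -> walk C u (x + e1) dir_right 0 = u x dir_left 0,
      forall x, K1m M0 x -> walk C u (x - e1) dir_left 0 = u x dir_right 0,
      forall x, K2p M0 x -> walk C u (x + e2) dir_up 0 = u x dir_down 0 &
      forall x, K2m M0 x -> walk C u (x - e2) dir_down 0 = u x dir_up 0].

(** * The loops *)

(* Region enclosed by the boundary of the rectangle mu0 +- a eps^s +- i b eps^s;
   points of C / 2 pi Z are represented by complex numbers. *)
Definition rect_inside (R : realType) (a b s eps mu0 : R) : set R[i] :=
  [set kappa | `|complex.Re kappa - mu0| < a * eps `^ s /\
               `|complex.Im kappa| < b * eps `^ s].

(* The closed rectangle embeds in C / 2 pi Z, and mu0 is the only point mu inside
   with e^(-i mu) an eigenvalue of A. *)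
Definition admissible_loop (R : realType) (A : operator R)
    (a b s eps mu0 : R) : Prop :=
  a * eps `^ s < pi /\
  (forall mu, rect_inside a b s eps mu0 mu ->
     point_spectrum A (cexp (- ('i * mu))) -> mu = mu0%:C).

(* For an admissible loop, kappa |-> e^(-i kappa) is injective on the closed
   rectangle, so this is the region enclosed by the image of its boundary. *)
Definition exp_loop_inside (R : realType) (a b s eps mu0 : R) : set R[i] :=
  [set cexp (- ('i * kappa)) | kappa in rect_inside a b s eps mu0].

(* Main.v *)
Require Import Defs.
From mathcomp Require Import all_boot all_order all_algebra.
From mathcomp Require Import spectral complex.
From mathcomp Require Import all_classical all_reals all_analysis.
From mathcomp Require Import ring lra zify.
Import Order.TTheory GRing.Theory Num.Theory.
Import numFieldNormedType.Exports.
Local Open Scope classical_set_scope.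
Local Open Scope ring_scope.
Local Open Scope complex_scope.
Set Implicit Arguments.
Unset Strict Implicit.
Unset Printing Implicit Defensive.

(** The shift moves each of the four components along a lattice direction, so
    what leaves the box never returns.  With respect to the amplitudes that have
    not yet met the box, those inside it, and those that have left it, a walk is
    block triangular, and outside the box it is a multiple [c] of a permutation
    of the indices, with [c = e^(-i theta)] of modulus less than one after the
    complex translation.  Hence for [cmod c < cmod z] the resolvent is explicit:
    a Neumann series for the free shift ([free_resolvent]) and the inverse of
    [B - z], where [B] is the compression of the operator to the box, a finite
    matrix.  Consequently the eigenvalues of modulus larger than [cmod c] are
    those of [B].

    Algebraic multiplicities agree as well ([algebraic_multiplicity_core]).  The
    Fitting decomposition of [B] lifts to the whole space: every [u] is
    [e + (A - lam)^k g] with [(A - lam)^k e = 0] ([fitting_decomposition]).  The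
    resolvent of [e] is a finite sum of negative powers of [z - lam] whose
    residue is [- e].  The resolvent of the other term is [(z - lam)^k] times
    the resolvent of [g] plus a polynomial; its entries are uniform limits of
    polynomials near [lam], so that their circle integrals vanish.  The Riesz
    projection therefore maps [u] to [e], and restriction to the box identifies
    its range with the generalized eigenspace of [B].

    The compression does not see the complex translation, up to conjugation by a
    diagonal matrix ([walk_core_mx_translated]): it is similar to the compression
    of the untranslated walk.  For the non-penetrable walk this matrix is normal
    ([walk_core_mx_normal]), being unitary on the amplitudes that do not enter
    the box from outside and zero on the others, and its eigenspaces at points of
    the unit circle are those of the walk itself ([has_dim_eigenspace]), since
    nothing leaves the box.

    What remains is a finite-dimensional perturbation problem: matrices at
    distance [eps] from a normal one.  Their eigenvalues near [lam] stay at
    distance [O(eps)], by Gershgorin's argument, and their number with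
    multiplicity is the dimension of the unperturbed eigenspace
    ([normal_perturbation]).  The loop has size [eps^s] with [s < 1]; for small
    [eps] it encloses a disc of radius [C eps] around [lam] and excludes the rest
    of the spectrum, so that it counts exactly these eigenvalues. *)

(** * Modulus and exponential of complex numbers *)

Section Modulus.
Variable R : realType.
Implicit Types x y z : R[i].

Lemma cmodE z : `|z| = (cmod z)%:C.
Proof. by rewrite /cmod normc_def. Qed.

Lemma cmod_ge0 z : 0 <= cmod z.
Proof. by rewrite -ler0c -cmodE. Qed.

Lemma cmodM x y : cmod (x * y) = cmod x * cmod y.
Proof. by apply: complexI; rewrite rmorphM /= -!cmodE normrM. Qed.

Lemma cmodD x y : cmod (x + y) <= cmod x + cmod y.
Proof. by rewrite -lecR rmorphD /= -!cmodE ler_normD. Qed.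

Lemma cmodN x : cmod (- x) = cmod x.
Proof. by apply: complexI; rewrite -!cmodE normrN. Qed.

Lemma cmodBC x y : cmod (x - y) = cmod (y - x).
Proof. by rewrite -cmodN opprB. Qed.

Lemma cmodB x y : cmod (x - y) <= cmod x + cmod y.
Proof. by rewrite (le_trans (cmodD _ _)) ?cmodN. Qed.

Lemma cmod_sub_le x y : cmod x - cmod y <= cmod (x - y).
Proof. by rewrite lerBlDr -{1}(subrK y x) cmodD. Qed.

Lemma cmod0 : cmod (0 : R[i]) = 0.
Proof. by apply: complexI; rewrite -cmodE normr0. Qed.

Lemma cmod1 : cmod (1 : R[i]) = 1.
Proof. by apply: complexI; rewrite -cmodE normr1. Qed.

Lemma cmod_eq0 z : (cmod z == 0) = (z == 0).
Proof. by rewrite -(normr_eq0 z) cmodE -(inj_eq (@complexI R)) . Qed.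

Lemma cmod_gt0 z : (0 < cmod z) = (z != 0).
Proof. by rewrite lt_def cmod_ge0 andbT cmod_eq0. Qed.

Lemma cmodV z : cmod z^-1 = (cmod z)^-1.
Proof.
by apply: complexI; rewrite -cmodE normfV cmodE fmorphV.
Qed.

Lemma cmodX z n : cmod (z ^+ n) = cmod z ^+ n.
Proof. by apply: complexI; rewrite rmorphXn /= -!cmodE normrX. Qed.

Lemma cmod_real (a : R) : cmod a%:C = `|a|.
Proof.
by rewrite /cmod normc_def /= expr0n /= addr0 sqrtr_sqr.
Qed.

Lemma cmod_sum (I : Type) (s : seq I) (P : pred I) (F : I -> R[i]) :
  cmod (\sum_(i <- s | P i) F i) <= \sum_(i <- s | P i) cmod (F i).
Proof.
elim/big_rec2: _ => [|i a b _ h]; first by rewrite cmod0.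
by rewrite (le_trans (cmodD _ _)) // lerD2l.
Qed.

Lemma cmod_prod (I : Type) (s : seq I) (P : pred I) (F : I -> R[i]) :
  cmod (\prod_(i <- s | P i) F i) = \prod_(i <- s | P i) cmod (F i).
Proof. by elim/big_rec2: _ => [|i a b _ <-]; rewrite ?cmod1 ?cmodM. Qed.

Lemma cmodRe z : `|complex.Re z| <= cmod z.
Proof. by rewrite -lecR -cmodE normc_ge_Re. Qed.

Lemma cmodIm z : `|complex.Im z| <= cmod z.
Proof.
rewrite /cmod normc_def /= -(ler_pXn2r (ltn0Sn 1)) ?nnegrE ?sqrtr_ge0//.
rewrite sqr_sqrtr ?addr_ge0 ?sqr_ge0//.
by rewrite real_normK ?num_real// lerDr sqr_ge0.
Qed.

Lemma cmod_sqr z : cmod z ^+ 2 = complex.Re z ^+ 2 + complex.Im z ^+ 2.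
Proof. by rewrite /cmod normc_def /= sqr_sqrtr ?addr_ge0 ?sqr_ge0. Qed.

Lemma cmod_le_ReIm z : cmod z <= `|complex.Re z| + `|complex.Im z|.
Proof.
rewrite -(ler_pXn2r (ltn0Sn 1)) ?nnegrE ?cmod_ge0 ?addr_ge0//.
rewrite cmod_sqr sqrrD !real_normK ?num_real//.
by rewrite lerD2r lerDl mulrn_wge0// mulr_ge0.
Qed.

Lemma cmodi : cmod ('i : R[i]) = 1.
Proof. by rewrite /cmod normc_def /= expr0n expr1n add0r sqrtr1. Qed.

Lemma cexpD x y : cexp (x + y) = cexp x * cexp y.
Proof.
rewrite /cexp; case: x y => a b [c d] /=.
rewrite expRD sinD cosD rmorphM /=.
by apply/eqP; rewrite eq_complex /=; apply/andP; split; apply/eqP; ring.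
Qed.

Lemma cexp0 : cexp (0 : R[i]) = 1.
Proof. by rewrite /cexp /= expR0 sin0 cos0 mul1r. Qed.

Lemma cexpNK x : cexp x * cexp (- x) = 1.
Proof. by rewrite -cexpD subrr cexp0. Qed.

Lemma cexp_neq0 x : cexp x != 0.
Proof.
apply/eqP => h; have := cexpNK x; rewrite h mul0r => /eqP.
by rewrite eq_sym oner_eq0.
Qed.

Lemma cexp_Im0 (t : R) : cexp ('i * t%:C) = cos t +i* sin t.
Proof.
rewrite /cexp /=.
have -> : (0 * t - 1 * 0 : R) = 0 by ring.
have -> : (0 * 0 + 1 * t : R) = t by ring.
by rewrite expR0 mul1r.
Qed.

Lemma cmod_cexp z : cmod (cexp z) = expR (complex.Re z).
Proof.
rewrite /cexp cmodM cmod_real ger0_norm ?expR_ge0//.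
rewrite /cmod normc_def /= cos2Dsin2 sqrtr1 mulr1//.
Qed.

Lemma cmod_cexpNi z : cmod (cexp (- ('i * z))) = expR (complex.Im z).
Proof.
rewrite cmod_cexp; congr expR; case: z => a b /=; ring.
Qed.

End Modulus.

(** * Series dominated by a geometric series *)

Section GeometricSeries.
Variable R : realType.

Lemma geometric_partial_le (t : R) (n : nat) : 0 <= t < 1 ->
  \sum_(k < n) t ^+ k <= (1 - t)^-1.
Proof.
move=> /andP[t0 t1]; rewrite -[leRHS]mul1r ler_pdivlMr ?subr_gt0// mulrC.
have -> : (1 - t) * \sum_(k < n) t ^+ k = 1 - t ^+ n.
  by rewrite -[in RHS]opprB subrX1 -mulNr opprB.
by rewrite gerBl exprn_ge0.
Qed.

(** Passage to the limit in inequalities that hold up to a geometric error; it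
    replaces all other limits in the estimates on square-summable families. *)
Lemma small_of_all_pow (t A B C : R) : 0 <= t < 1 ->
  (forall n : nat, A <= B + C * t ^+ n) -> A <= B.
Proof.
move=> /andP[t0 t1] h.
have : B + C * t ^+ n @[n --> \oo] --> B + C * 0.
  by apply: cvgD; [exact: cvg_cst|apply: cvgMr; apply: cvg_expr;
     rewrite ger0_norm].
rewrite mulr0 addr0 => cv.
apply: (cvgr_to_ge cv).
by near=> n; exact: h.
Unshelve. all: by end_near.
Qed.

Lemma real_geometric_series (x : nat -> R) (K t : R) : 0 <= t < 1 ->
  (forall n, `|x n| <= K * t ^+ n) ->
  forall n, `|limn (series x) - \sum_(k < n) x k| <= K * t ^+ n / (1 - t).
Proof.
move=> /andP[t0 t1] hx.
have K0 : 0 <= K by have := hx 0%N; rewrite expr0 mulr1; apply: le_trans.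
have cvx : cvgn (series x).
  apply: normed_cvg; apply: (@series_le_cvg _ _ (geometric K t)).
  - by move=> n; exact: normr_ge0.
  - by move=> n; rewrite /= mulr_ge0// exprn_ge0.
  - by move=> n; exact: hx.
  - by apply: is_cvg_geometric_series; rewrite ger0_norm.
move=> n.
have cv : `|series x m - \sum_(k < n) x k| @[m --> \oo] -->
   `|limn (series x) - \sum_(k < n) x k|.
  by apply: cvg_norm; apply: cvgB => //; exact: cvg_cst.
apply: (cvgr_to_le cv).
near=> m.
have nm : (n <= m)%N by near: m; exists n.
rewrite /series /= -(big_mkord xpredT x) (big_cat_nat (n:=n))//= big_mkord addrAC subrr add0r.
rewrite (le_trans (ler_norm_sum _ _ _))//.
rewrite -{1}[n]add0n big_addn big_mkord.
rewrite (@le_trans _ _ (\sum_(i < m - n) K * t ^+ n * t ^+ i))//.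
  by apply: ler_sum => i _; rewrite -mulrA -exprD addnC; exact: hx.
rewrite -mulr_sumr ler_wpM2l ?mulr_ge0 ?exprn_ge0//.
by rewrite geometric_partial_le// t0.
Unshelve. all: by end_near.
Qed.

Definition cseries_sum (h : nat -> R[i]) : R[i] :=
  limn (series (fun n => complex.Re (h n))) +i*
  limn (series (fun n => complex.Im (h n))).

Lemma ReB (x y : R[i]) : complex.Re (x - y) = complex.Re x - complex.Re y.
Proof. by case: x y => ? ? []. Qed.

Lemma ImB (x y : R[i]) : complex.Im (x - y) = complex.Im x - complex.Im y.
Proof. by case: x y => ? ? []. Qed.

Lemma Re_sum (I : Type) (s : seq I) (P : pred I) (F : I -> R[i]) :
  complex.Re (\sum_(i <- s | P i) F i) = \sum_(i <- s | P i) complex.Re (F i).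
Proof.
by elim/big_rec2: _ => // i a b _ <-; case: (F i) => ? ?; case: b.
Qed.

Lemma Im_sum (I : Type) (s : seq I) (P : pred I) (F : I -> R[i]) :
  complex.Im (\sum_(i <- s | P i) F i) = \sum_(i <- s | P i) complex.Im (F i).
Proof.
by elim/big_rec2: _ => // i a b _ <-; case: (F i) => ? ?; case: b.
Qed.

(** The tail after [n] terms is again geometric, which makes the partial sums a
    uniform approximation in every parameter that preserves the domination. *)
Lemma cseries_sumP (h : nat -> R[i]) (K t : R) : 0 <= t < 1 ->
  (forall n, cmod (h n) <= K * t ^+ n) ->
  forall n, cmod (cseries_sum h - \sum_(k < n) h k) <=
            2 * K / (1 - t) * t ^+ n.
Proof.
move=> ht hh n; rewrite (le_trans (cmod_le_ReIm _))//.
have -> : 2 * K / (1 - t) * t ^+ n =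
   K * t ^+ n / (1 - t) + K * t ^+ n / (1 - t) by ring.
rewrite !ReB !ImB Re_sum Im_sum /=.
apply: lerD; apply: real_geometric_series => // m;
  by rewrite (le_trans _ (hh m))// ?cmodRe ?cmodIm.
Qed.

Lemma cseries_sum0 (h : nat -> R[i]) : (forall n, h n = 0) -> cseries_sum h = 0.
Proof.
move=> h0; apply/eqP; rewrite -cmod_eq0 eq_le cmod_ge0 andbT.
have := @cseries_sumP h 0 0 _ _ 0; rewrite !lexx ltr01 big_ord0 subr0.
rewrite mulr0 mul0r mul0r; apply=> // n.
by rewrite h0 cmod0 mul0r.
Qed.

End GeometricSeries.

(** * Square-summable families *)

Section SquareSummable.
Variables (R : realType) (I : choiceType).
Implicit Types (f g : I -> R[i]) (K L : R) (s : seq I).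

(** The squared l2 norm enters through its finite partial sums, so that norm
    bounds are proved by finite sums only. *)
Definition sqsum_le f K :=
  forall s, uniq s -> \sum_(p <- s) cmod (f p) ^+ 2 <= K.

Definition sq_summable f := exists K, sqsum_le f K.

Definition bounded_by f K := forall p, cmod (f p) <= K.

Lemma sqsum_ge0 f K : sqsum_le f K -> 0 <= K.
Proof. by move=> /(_ [::] isT); rewrite big_nil. Qed.

Lemma sqsum_bounded f K : sqsum_le f K -> bounded_by f (Num.sqrt K).
Proof.
move=> h p; have := h [:: p] isT; rewrite big_seq1 => hp.
by rewrite -(ler_pXn2r (ltn0Sn 1)) ?nnegrE ?cmod_ge0 ?sqrtr_ge0// sqr_sqrtr//
  (sqsum_ge0 h).
Qed.

Lemma sq_summable_bounded f : sq_summable f -> exists2 K, 0 <= K & bounded_by f K.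
Proof. by case=> K /sqsum_bounded h; exists (Num.sqrt K). Qed.

Lemma sqrD_le (a b : R) : (a + b) ^+ 2 <= 2 * a ^+ 2 + 2 * b ^+ 2.
Proof.
rewrite -subr_ge0.
have -> : 2 * a ^+ 2 + 2 * b ^+ 2 - (a + b) ^+ 2 = (a - b) ^+ 2 by ring.
exact: sqr_ge0.
Qed.

Lemma sqsumD f g K L : sqsum_le f K -> sqsum_le g L ->
  sqsum_le (fun p => f p + g p) (2 * K + 2 * L).
Proof.
move=> hf hg s us.
rewrite (@le_trans _ _ (2 * (\sum_(p <- s) cmod (f p) ^+ 2) +
   2 * (\sum_(p <- s) cmod (g p) ^+ 2)))//.
  rewrite !mulr_sumr -big_split ler_sum//= => p _.
  by rewrite (le_trans _ (sqrD_le _ _))// ler_pXn2r ?nnegrE ?cmodD ?addr_ge0 ?cmod_ge0.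
by rewrite lerD// ler_pM2l// ?hf ?hg.
Qed.

Lemma sqsumZ f K (a : R[i]) : sqsum_le f K ->
  sqsum_le (fun p => a * f p) (cmod a ^+ 2 * K).
Proof.
move=> hf s us; under eq_bigr do rewrite cmodM exprMn.
by rewrite -mulr_sumr ler_wpM2l ?exprn_ge0 ?cmod_ge0 ?hf.
Qed.

Lemma sqsum_comp f K (tau : I -> I) : injective tau -> sqsum_le f K ->
  sqsum_le (f \o tau) K.
Proof.
move=> ti hf s us; rewrite -(big_map tau xpredT (fun p => cmod (f p) ^+ 2)).
by rewrite hf// map_inj_uniq.
Qed.

Lemma sqsum_dominated f g K : (forall p, cmod (g p) <= cmod (f p)) ->
  sqsum_le f K -> sqsum_le g K.
Proof.
move=> gf hf s us; apply: le_trans (hf s us); apply: ler_sum => p _.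
by rewrite ler_pXn2r ?nnegrE ?cmod_ge0.
Qed.

Lemma sq_summableD f g : sq_summable f -> sq_summable g ->
  sq_summable (fun p => f p + g p).
Proof. by move=> [K hK] [L hL]; eexists; exact: (sqsumD hK hL). Qed.

Lemma sq_summableZ f (a : R[i]) : sq_summable f -> sq_summable (fun p => a * f p).
Proof. by move=> [K hK]; eexists; exact: (sqsumZ a hK). Qed.

Lemma sq_summable0 : sq_summable (fun=> 0).
Proof. by exists 0 => s _; rewrite big1// => p _; rewrite cmod0 expr0n. Qed.

Lemma sq_summable_sum (J : Type) (s : seq J) (F : J -> I -> R[i]) :
  (forall j, sq_summable (F j)) -> sq_summable (fun p => \sum_(j <- s) F j p).
Proof.
move=> hF; elim: s => [|j s ih].
  by under eq_fun do rewrite big_nil; exact: sq_summable0.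
by under eq_fun do rewrite big_cons; exact: sq_summableD.
Qed.

Lemma sq_summable_finite f (ss : seq I) : (forall p, f p != 0 -> p \in ss) ->
  sq_summable f.
Proof.
elim: ss f => [|q ss ih] f fs.
  suff -> : f = fun=> 0 by exact: sq_summable0.
  by apply/funext => p; apply/eqP/negPn/negP => /fs.
have -> : f = fun p => (if p == q then f q else 0) + (if p == q then 0 else f p).
  by apply/funext => p; case: eqP => [->|]; rewrite ?addr0 ?add0r.
apply: sq_summableD; last first.
  apply: ih => p; case: (eqVneq p q) => [_|pq /fs]; first by rewrite eqxx.
  by rewrite in_cons (negbTE pq).
exists (cmod (f q) ^+ 2) => s us.
rewrite (bigID (pred1 q)) /= [X in _ + X]big1 ?addr0; last first.
  by move=> p /negbTE ->; rewrite cmod0 expr0n.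
rewrite -big_filter; have := filter_pred1_uniq us.
case: (boolP (q \in s)) => qs h.
  by rewrite h// big_seq1 eqxx.
rewrite (@eq_in_filter _ _ pred0) ?filter_pred0; last first.
  by move=> x xs /=; apply: contraNF qs => /eqP <-.
by rewrite big_nil exprn_ge0// cmod_ge0.
Qed.

(** Iterating the inequality bounds [f p] by [K t^n]; this is the uniqueness
    principle behind every injectivity statement about the shift. *)
Lemma bounded_contraction0 f K (t : R) (tau : I -> I) : 0 <= t < 1 ->
  bounded_by f K -> (forall p, cmod (f p) <= t * cmod (f (tau p))) ->
  forall p, f p = 0.
Proof.
move=> ht fK ft p; apply/eqP; rewrite -cmod_eq0 eq_le cmod_ge0 andbT.
have /andP[t0 _] := ht.
apply: (@small_of_all_pow _ t _ 0 K) => // n; rewrite add0r mulrC.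
elim: n p => [|n ih] p; first by rewrite expr0 mul1r.
by rewrite (le_trans (ft p))// exprS -mulrA ler_wpM2l.
Qed.

End SquareSummable.

(** * The resolvent of the free shift *)

Section FreeResolvent.
Variables (R : realType) (I : choiceType) (tau : I -> I) (c : R[i]).
Implicit Types (u : I -> R[i]) (z : R[i]).

(** The inverse of [u |-> c u(tau .) - z u] given by its Neumann series. *)
Definition free_resolvent z u : I -> R[i] := fun p =>
  - z^-1 * cseries_sum (fun k => (c / z) ^+ k * u (iter k tau p)).

Lemma ratio_lt1 z : cmod c < cmod z -> 0 <= cmod (c / z) < 1.
Proof.
move=> cz; have z0 : 0 < cmod z by exact: le_lt_trans (cmod_ge0 _) cz.
by rewrite cmod_ge0 cmodM cmodV ltr_pdivrMr// mul1r.
Qed.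

Lemma free_resolvent_approx z u K : cmod c < cmod z -> bounded_by u K ->
  forall p n, cmod (free_resolvent z u p -
     - z^-1 * \sum_(k < n) (c / z) ^+ k * u (iter k tau p)) <=
   (cmod z)^-1 * (2 * K / (1 - cmod (c / z)) * cmod (c / z) ^+ n).
Proof.
move=> cz uK p n; rewrite /free_resolvent -[X in cmod X]mulrBr (cmodM (- _)) cmodN cmodV.
rewrite ler_wpM2l ?invr_ge0 ?cmod_ge0//.
apply: cseries_sumP; first exact: ratio_lt1.
by move=> k; rewrite cmodM cmodX mulrC ler_wpM2r// exprn_ge0// cmod_ge0.
Qed.

Lemma free_resolvent0 z u p : (forall k, u (iter k tau p) = 0) ->
  free_resolvent z u p = 0.
Proof.
by move=> h; rewrite /free_resolvent cseries_sum0 ?mulr0// => n; rewrite h mulr0.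
Qed.

Lemma free_resolventP z u K : cmod c < cmod z -> bounded_by u K ->
  forall p, c * free_resolvent z u (tau p) - z * free_resolvent z u p = u p.
Proof.
move=> cz uK p; apply/eqP; rewrite -subr_eq0 -cmod_eq0 eq_le cmod_ge0 andbT.
have z0 : z != 0 by rewrite -cmod_gt0 (le_lt_trans (cmod_ge0 _) cz).
set t := cmod (c / z).
set D := (cmod z)^-1 * (2 * K / (1 - t)).
apply: (@small_of_all_pow _ t _ 0 (cmod c * D + cmod z * (D * t))).
  exact: ratio_lt1.
move=> n; rewrite add0r.
have h1 := free_resolvent_approx cz uK (tau p) n.
have h2 := free_resolvent_approx cz uK p n.+1.
set F1 := free_resolvent z u (tau p) in h1 *.
set F2 := free_resolvent z u p in h2 *.
set S1 := - z^-1 * _ in h1; set S2 := - z^-1 * _ in h2.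
have key : c * S1 - z * S2 = u p.
  rewrite /S1 /S2 big_ord_recl /= expr0 mul1r.
  rewrite [X in u p + X](eq_bigr (fun i : 'I_n => c / z * ((c / z) ^+ i * u (iter i tau (tau p))))).
    by rewrite -mulr_sumr; field.
  by move=> i _; rewrite mulrA -exprS -iterSr.
have -> : c * F1 - z * F2 - u p = c * (F1 - S1) - z * (F2 - S2).
  by rewrite -key; ring.
rewrite (le_trans (cmodB _ _))// !cmodM mulrDl lerD//.
  by rewrite -mulrA ler_wpM2l ?cmod_ge0// (le_trans h1)// /D mulrA.
rewrite -mulrA ler_wpM2l ?cmod_ge0// (le_trans h2)//.
by rewrite exprS /D /t !mulrA.
Qed.

Lemma free_resolvent_bounded z u K : cmod c < cmod z -> bounded_by u K ->
  bounded_by (free_resolvent z u) ((cmod z)^-1 * (2 * K / (1 - cmod (c / z)))).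
Proof.
move=> cz uK p; have := free_resolvent_approx cz uK p 0.
by rewrite big_ord0 mulr0 subr0 expr0 mulr1.
Qed.

Lemma free_resolvent_unique z u v K : cmod c < cmod z -> bounded_by u K ->
  bounded_by v K ->
  (forall p, c * u (tau p) - z * u p = c * v (tau p) - z * v p) -> u = v.
Proof.
move=> cz uK vK uv; apply/funext => p; apply/eqP; rewrite -subr_eq0; apply/eqP.
have z0 : z != 0 by rewrite -cmod_gt0 (le_lt_trans (cmod_ge0 _) cz).
apply: (@bounded_contraction0 _ _ (fun p => u p - v p) (K + K) (cmod (c / z)) tau).
- exact: ratio_lt1.
- by move=> q; rewrite (le_trans (cmodB _ _))// lerD.
- move=> q; rewrite -cmodM.
  suff -> : c / z * (u (tau q) - v (tau q)) = u q - v q by [].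
  apply: (mulfI z0); rewrite mulrA [z * (c / z)]mulrCA divff// mulr1.
  rewrite !mulrBr; have /eqP := uv q.
  by rewrite -subr_eq0 => /eqP h; apply/eqP; rewrite -subr_eq0 -h; apply/eqP; ring.
Qed.

(** Convexity of the square turns [|v| <= t |v(tau .)| + |u|/|z|] into a
    recursion for [|v|^2] that is summed over finite sets of indices. *)
Lemma free_resolvent_sqsum z u K : injective tau -> cmod c < cmod z ->
  sqsum_le u K ->
  sqsum_le (free_resolvent z u) (K / (cmod z - cmod c) ^+ 2).
Proof.
move=> ti cz uK s us.
have uB := sqsum_bounded uK.
set v := free_resolvent z u.
have vB := free_resolvent_bounded cz uB.
have vP := free_resolventP cz uB.
set t := cmod (c / z); have ht := ratio_lt1 cz; have /andP[t0 t1] := ht.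
have z0 : 0 < cmod z by exact: le_lt_trans (cmod_ge0 _) cz.
have t1' : 0 < 1 - t by rewrite subr_gt0.
have zn : z != 0 by rewrite -cmod_gt0.
set M := (cmod z)^-1 * _ in vB.
pose D := ((cmod z) ^+ 2 * (1 - t))^-1.
have D0 : 0 <= D by rewrite invr_ge0 mulr_ge0 ?exprn_ge0 ?cmod_ge0 ?ltW.
have rec p : cmod (v p) ^+ 2 <= t * cmod (v (tau p)) ^+ 2 + D * cmod (u p) ^+ 2.
  have -> : v p = c / z * v (tau p) - u p / z.
    have /eqP := vP p; rewrite subr_eq => /eqP h.
    apply: (mulfI zn); have -> : z * v p = c * v (tau p) - u p by rewrite h addrC addKr.
    by field.
  have h : cmod (c / z * v (tau p) - u p / z) <= t * cmod (v (tau p)) + cmod (u p) / cmod z.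
    by rewrite (le_trans (cmodB _ _))// !cmodM -cmodM cmodV.
  apply: (@le_trans _ _ ((t * cmod (v (tau p)) + cmod (u p) / cmod z) ^+ 2)).
    rewrite ler_pXn2r ?nnegrE ?cmod_ge0// addr_ge0 ?mulr_ge0 ?cmod_ge0//.
    by rewrite invr_ge0 cmod_ge0.
  set a := cmod (v (tau p)); set b := cmod (u p); set y := cmod z.
  rewrite -subr_ge0.
  have -> : t * a ^+ 2 + D * b ^+ 2 - (t * a + b / y) ^+ 2 =
     t / (1 - t) * ((1 - t) * a - b / y) ^+ 2.
    by rewrite /D -/y; field; rewrite !gt_eqF.
  by rewrite mulr_ge0 ?sqr_ge0// divr_ge0// ltW.
have iter_rec n p : cmod (v p) ^+ 2 <=
    D * (\sum_(k < n) t ^+ k * cmod (u (iter k tau p)) ^+ 2) + t ^+ n * M ^+ 2.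
  elim: n p => [|n ih] p.
    rewrite big_ord0 mulr0 add0r expr0 mul1r.
    by rewrite ler_pXn2r ?nnegrE ?cmod_ge0 ?vB// (le_trans _ (vB p))// cmod_ge0.
  rewrite (le_trans (rec p))//.
  rewrite (le_trans (lerD (ler_wpM2l t0 (ih (tau p))) (lexx _)))//.
  rewrite big_ord_recl /= expr0 mul1r.
  rewrite [X in _ <= D * (_ + X) + _](eq_bigr (fun i : 'I_n =>
      t * (t ^+ i * cmod (u (iter i tau (tau p))) ^+ 2))).
    by rewrite -mulr_sumr (exprS t n) le_eqVlt; apply/orP; left; apply/eqP; ring.
  by move=> i _; rewrite mulrA -exprS -iterSr.
apply: (@small_of_all_pow _ t _ _ ((size s)%:R * M ^+ 2)) => // n.
apply: (@le_trans _ _ (\sum_(p <- s)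
    (D * (\sum_(k < n) t ^+ k * cmod (u (iter k tau p)) ^+ 2) + t ^+ n * M ^+ 2))).
  by apply: ler_sum => p _; exact: iter_rec.
rewrite big_split /= lerD//; last first.
  rewrite big_const_seq count_predT iter_addr addr0 -mulr_natl le_eqVlt.
  by apply/orP; left; apply/eqP; ring.
rewrite -mulr_sumr exchange_big /=.
have -> : K / (cmod z - cmod c) ^+ 2 = D * ((1 - t)^-1 * K).
  by rewrite /D /t cmodM cmodV; field; rewrite !gt_eqF// subr_gt0.
rewrite ler_wpM2l//.
apply: (@le_trans _ _ (\sum_(k < n) t ^+ k * K)).
  apply: ler_sum => k _; rewrite -mulr_sumr ler_wpM2l ?exprn_ge0//.
  apply: (@sqsum_comp _ _ u K (iter k tau)) => //.
  by elim: (val k) => //= m ih x y /ti /ih.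
rewrite -mulr_suml ler_wpM2r ?(sqsum_ge0 uK)//.
exact: geometric_partial_le.
Qed.

End FreeResolvent.

(** * Perturbations of the shift supported on a finite core *)

Section FiniteRankPerturbation.
Variables (R : realType) (I : choiceType) (sigma tau : I -> I).
Hypothesis tauK : cancel tau sigma.
Variables (n : nat) (iota : 'I_n.+1 -> I).
Hypothesis iota_inj : injective iota.
Variables (c : R[i]) (W : 'I_n.+1 -> I -> R[i]).

Definition in_core (p : I) := exists i, iota i = p.

(** The perturbation only produces amplitudes one step after the core. *)
Hypothesis W_supp : forall i p, W i p != 0 -> in_core (tau p).

(** The indices that the shift reaches from the core; everything else evolves
    freely and never feels the perturbation. *)
Definition downstream (p : I) := exists k, in_core (iter k tau p).

(** What leaves the core never comes back: this makes the operator block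
    triangular with respect to upstream, core and outgoing indices. *)
Hypothesis no_reentry :
  forall p, downstream p -> ~ in_core p -> ~ in_core (sigma p).

Implicit Types (f g u v : I -> R[i]) (z : R[i]) (w a : 'rV[R[i]]_n.+1).

Definition restrict_core f : 'rV[R[i]]_n.+1 := \row_i f (iota i).

Definition spread a : I -> R[i] := fun p => \sum_i a 0 i * W i p.

Definition perturbed_shift f : I -> R[i] :=
  fun p => c * f (tau p) + spread (restrict_core f) p.

(** The compression of the operator to the core, acting on row vectors: row [i]
    is the image of the point mass at [iota i]. *)
Definition core_mx : 'M[R[i]]_n.+1 :=
  \matrix_(i, j) (c * (tau (iota j) == iota i)%:R + W i (iota j)).

Definition supp_downstream f := forall p, ~ downstream p -> f p = 0.

Definition minus_scalar z f : I -> R[i] := fun p => perturbed_shift f p - z * f p.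

Lemma tau_inj : injective tau. Proof. exact: can_inj tauK. Qed.

Lemma downstream_core p : in_core p -> downstream p.
Proof. by exists 0%N. Qed.

Lemma downstream_tau p : downstream (tau p) -> downstream p.
Proof. by case=> k h; exists k.+1; rewrite iterSr. Qed.

Lemma spread0 a p : ~ in_core (tau p) -> spread a p = 0.
Proof.
move=> h; rewrite /spread big1// => i _.
by have [->|/W_supp//] := eqVneq (W i p) 0; rewrite mulr0.
Qed.

Lemma spread_delta i : W i = spread (delta_mx 0 i).
Proof.
apply/funext => p; rewrite /spread (bigD1 i)//= mxE !eqxx mul1r big1 ?addr0// => k ki.
by rewrite mxE (negbTE ki) andbF mul0r.
Qed.

Lemma supp_spread a : supp_downstream (spread a).
Proof.
by move=> p np; apply: spread0 => /downstream_core /downstream_tau.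
Qed.

Lemma sq_summable_spread a : sq_summable (spread a).
Proof.
apply: (@sq_summable_finite _ _ _ [seq sigma (iota i) | i <- enum 'I_n.+1]) => p.
move=> sp; apply/mapP.
have : in_core (tau p) by apply: contrapT => /(spread0 a) /eqP; exact/negP.
by case=> i hi; exists i; rewrite ?mem_enum// hi tauK.
Qed.

Lemma sq_summable_perturbed_shift f : sq_summable f -> sq_summable (perturbed_shift f).
Proof.
move=> hf; apply: sq_summableD; last exact: sq_summable_spread.
case: (sq_summableZ c hf) => K hK; exists K.
exact: (sqsum_comp tau_inj hK).
Qed.

Lemma sq_summable_minus_scalar z f : sq_summable f -> sq_summable (minus_scalar z f).
Proof.
move=> hf; rewrite /minus_scalar; under eq_fun do rewrite -mulNr.
by apply: sq_summableD; [exact: sq_summable_perturbed_shift|exact: sq_summableZ].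
Qed.

Lemma minus_scalar0 z : minus_scalar z (fun=> 0) = fun=> 0.
Proof.
apply/funext => p; rewrite /minus_scalar /perturbed_shift /spread !mulr0 subr0 add0r.
by apply: big1 => i _; rewrite mxE mul0r.
Qed.

Lemma minus_scalarD z f g : minus_scalar z (fun p => f p + g p) =
  fun p => minus_scalar z f p + minus_scalar z g p.
Proof.
apply/funext => p; rewrite /minus_scalar /perturbed_shift /spread.
rewrite (eq_bigr (fun i => restrict_core f 0 i * W i p + restrict_core g 0 i * W i p)).
  by rewrite big_split /=; ring.
by move=> i _; rewrite !mxE mulrDl.
Qed.

Lemma minus_scalarZ z (b : R[i]) f : minus_scalar z (fun p => b * f p) =
  fun p => b * minus_scalar z f p.
Proof.
apply/funext => p; rewrite /minus_scalar /perturbed_shift /spread.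
rewrite (eq_bigr (fun i => b * (restrict_core f 0 i * W i p))).
  by rewrite -mulr_sumr; ring.
by move=> i _; rewrite !mxE mulrA.
Qed.

Lemma minus_scalarB z f g : minus_scalar z (fun p => f p - g p) =
  fun p => minus_scalar z f p - minus_scalar z g p.
Proof.
have -> : (fun p => f p - g p) = (fun p => f p + -1 * g p).
  by apply/funext => p; rewrite mulN1r.
rewrite minus_scalarD; apply/funext => p.
by rewrite minus_scalarZ mulN1r.
Qed.

Lemma supp_minus_scalar z f : supp_downstream f -> supp_downstream (minus_scalar z f).
Proof.
move=> hf p np; rewrite /minus_scalar /perturbed_shift supp_spread// hf; last first.
  by move=> /downstream_tau.
by rewrite hf// !mulr0 addr0 subr0.
Qed.

Lemma core_pick (p : I) : in_core p \/ forall i, p != iota i.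
Proof.
have [[i hi]|h] := pselect (in_core p); first by left; exists i.
by right => i; apply/eqP => e; apply: h; exists i.
Qed.

Lemma sum_core (b : 'I_n.+1 -> R[i]) (p : I) i : iota i = p ->
  \sum_k b k * (p == iota k)%:R = b i.
Proof.
move=> <-; rewrite (bigD1 i)//= eqxx mulr1 big1 ?addr0// => k ki.
by rewrite (inj_eq iota_inj) eq_sym (negbTE ki) mulr0.
Qed.

Lemma upstream_core i : ~ in_core (tau (iota i)) -> ~ downstream (tau (iota i)).
Proof.
move=> h d; apply: (no_reentry d h); rewrite tauK; by exists i.
Qed.

(** On downstream families nothing enters the core from outside, so restriction
    to the core intertwines the operator with its compression. *)
Lemma restrict_minus_scalar z f : supp_downstream f ->
  restrict_core (minus_scalar z f) = restrict_core f *m (core_mx - z%:M).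
Proof.
move=> hf; rewrite mulmxBr mul_mx_scalar; apply/rowP => j; rewrite !mxE.
rewrite /minus_scalar; congr (_ - _).
rewrite /perturbed_shift /spread.
under [RHS]eq_bigr do rewrite !mxE mulrDr.
rewrite big_split /=; congr (_ + _); last by apply: eq_bigr => i _; rewrite mxE.
have [[i hi]|h] := core_pick (tau (iota j)).
  under eq_bigr do rewrite mulrCA.
  by rewrite -mulr_sumr (sum_core _ hi) hi.
rewrite hf ?mulr0; last first.
  by apply: upstream_core => -[i /esym /eqP]; apply/negP.
by rewrite big1// => i _; rewrite (negbTE (h i)) !mulr0.
Qed.

Lemma cmodz_neq0 z : cmod c < cmod z -> z != 0.
Proof. by move=> h; rewrite -cmod_gt0 (le_lt_trans (cmod_ge0 _) h). Qed.

(** Upstream of the core nothing feeds the shift, so a solution of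
    [(A - z) v = u] with [u] downstream vanishes there by contraction. *)
Lemma supp_of_minus_scalar z v : cmod c < cmod z -> sq_summable v ->
  supp_downstream (minus_scalar z v) -> supp_downstream v.
Proof.
move=> cz /sq_summable_bounded[K K0 vK] h p np.
have z0 := cmodz_neq0 cz.
pose f q := if `[< downstream q >] then 0 else v q.
suff : f p = 0 by rewrite /f; case: asboolP.
apply: (@bounded_contraction0 _ _ f K (cmod (c / z)) tau).
- exact: ratio_lt1.
- by move=> q; rewrite /f; case: asboolP; rewrite ?cmod0.
move=> q; rewrite /f; case: asboolP => [_|nq].
  by rewrite cmod0 mulr_ge0 ?cmod_ge0.
have ntq : ~ downstream (tau q) by move=> /downstream_tau.
case: asboolP => // _.
have := h _ nq; rewrite /minus_scalar /perturbed_shift supp_spread// addr0.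
move=> /eqP; rewrite subr_eq0 => /eqP e.
rewrite -cmodM; suff -> : c / z * v (tau q) = v q by [].
by apply: (mulfI z0); rewrite -e; field.
Qed.

Lemma minus_scalar_inj z v : cmod c < cmod z -> sq_summable v ->
  (forall p, minus_scalar z v p = 0) -> restrict_core v = 0 -> forall p, v p = 0.
Proof.
move=> cz /sq_summable_bounded[K K0 vK] h v0 p.
have -> // : v = fun=> 0.
apply: (@free_resolvent_unique R I tau c z v _ K) => //.
  by move=> q; rewrite cmod0.
move=> q; have := h q; rewrite /minus_scalar /perturbed_shift v0 /spread.
rewrite big1 ?addr0 ?mulr0 ?subr0// => i _; by rewrite mxE mul0r.
Qed.

(** Candidate for the solution of [(A - z) v = u] whose values on the core are [w]:
    once these values are known, the perturbation is a known source term. *)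
Definition core_solution z u w : I -> R[i] :=
  free_resolvent tau c z (fun p => u p - spread w p).

Lemma sq_summable_free z u : cmod c < cmod z -> sq_summable u ->
  sq_summable (free_resolvent tau c z u).
Proof.
by move=> cz [K hK]; eexists; exact: (free_resolvent_sqsum tau_inj cz hK).
Qed.

Lemma sq_summableB u v : sq_summable u -> sq_summable v ->
  sq_summable (fun p => u p - v p).
Proof.
move=> hu hv; under eq_fun do rewrite -mulN1r.
by apply: sq_summableD => //; exact: sq_summableZ.
Qed.

Lemma sq_summable_core_solution z u w : cmod c < cmod z -> sq_summable u ->
  sq_summable (core_solution z u w).
Proof.
move=> cz hu; apply: sq_summable_free => //; apply: sq_summableB => //.
exact: sq_summable_spread.
Qed.

Lemma supp_core_solution z u w : supp_downstream u ->
  supp_downstream (core_solution z u w).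
Proof.
move=> hu p np; apply: free_resolvent0 => k.
have nk : ~ downstream (iter k tau p).
  by elim: k => [|k ih]//= /downstream_tau.
by rewrite hu// supp_spread// subr0.
Qed.

(** The difference between the solution of the free equation and the
    prescribed values [w], cut off outside the core, satisfies a homogeneous
    contraction; hence the values of the solution on the core are [w]. *)
Lemma restrict_core_solution z u w : cmod c < cmod z -> sq_summable u ->
  supp_downstream u -> w *m (core_mx - z%:M) = restrict_core u ->
  restrict_core (core_solution z u w) = w.
Proof.
move=> cz hu su hw; have z0 := cmodz_neq0 cz.
have sv := sq_summable_core_solution w cz hu.
have dv := supp_core_solution z w su.
have [K0 _ hK0] : exists2 K, 0 <= K & bounded_by (fun p => u p - spread w p) K.
  by apply: sq_summable_bounded; apply: sq_summableB => //; exact: sq_summable_spread.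
have eqv := free_resolventP tau cz hK0; rewrite -/(core_solution z u w) in eqv.
set v := core_solution z u w in sv dv eqv *.
have [K K_ge0 hK] := sq_summable_bounded sv.
pose d p := \sum_k (v p - w 0 k) * (p == iota k)%:R.
have d_core i : d (iota i) = v (iota i) - w 0 i.
  by rewrite /d (@sum_core (fun k => v (iota i) - w 0 k) _ i).
have d_out p : ~ in_core p -> d p = 0.
  move=> np; rewrite /d big1// => i _; case: eqP => [e|_]; last by rewrite mulr0.
  by case: np; exists i.
apply/rowP => j; rewrite mxE; apply/eqP; rewrite -subr_eq0 -d_core; apply/eqP.
apply: (@bounded_contraction0 _ _ d (\sum_k (K + cmod (w 0 k))) (cmod (c / z)) tau).
- exact: ratio_lt1.
- move=> p; rewrite /d (le_trans (cmod_sum _ _ _))//; apply: ler_sum => k _.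
  rewrite cmodM; case: eqP => _; last by rewrite cmod0 mulr0 addr_ge0 ?cmod_ge0.
  by rewrite cmod1 mulr1 (le_trans (cmodB _ _))// lerD.
move=> p; have [[i <-]|np] := core_pick p; last first.
  rewrite d_out; first by rewrite cmod0 mulr_ge0 ?cmod_ge0.
  by move=> [i /esym/eqP]; apply/negP.
rewrite -cmodM; suff -> : c / z * d (tau (iota i)) = d (iota i) by [].
apply: (mulfI z0); have -> : z * (c / z * d (tau (iota i))) = c * d (tau (iota i)).
  by field.
have eq1 := eqv (iota i).
have /rowP/(_ i) := hw; rewrite mulmxBr mul_mx_scalar !mxE.
under eq_bigr do rewrite mxE mulrDr.
rewrite big_split /= => eq2.
have zv : z * v (iota i) = c * v (tau (iota i)) - (u (iota i) - spread w (iota i)).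
  by rewrite -eq1; ring.
have zw : z * w 0 i = \sum_j0 w 0 j0 * (c * (tau (iota i) == iota j0)%:R)
    + spread w (iota i) - u (iota i).
  by rewrite -eq2 /spread; ring.
rewrite d_core mulrBr zv zw.
have [[k hk]|h] := core_pick (tau (iota i)).
  rewrite -hk d_core; under eq_bigr do rewrite mulrCA.
  by rewrite hk -mulr_sumr (sum_core _ hk); ring.
have nt : ~ in_core (tau (iota i)) by move=> [k /esym/eqP]; apply/negP.
rewrite d_out// dv; last exact: upstream_core.
by rewrite big1 => [|k _]; [ring|rewrite (negbTE (h k)) !mulr0].
Qed.

Lemma core_solutionP z u w : cmod c < cmod z -> sq_summable u ->
  supp_downstream u -> w *m (core_mx - z%:M) = restrict_core u ->
  minus_scalar z (core_solution z u w) = u.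
Proof.
move=> cz hu su hw; apply/funext => p.
rewrite /minus_scalar /perturbed_shift restrict_core_solution//.
have [K0 _ hK0] : exists2 K, 0 <= K & bounded_by (fun p => u p - spread w p) K.
  by apply: sq_summable_bounded; apply: sq_summableB => //; exact: sq_summable_spread.
have := free_resolventP tau cz hK0 p; rewrite -/(core_solution z u w) => h.
rewrite addrAC h; ring.
Qed.

Lemma sq_summable_iter z k f : sq_summable f ->
  sq_summable (iter k (minus_scalar z) f).
Proof.
by move=> hf; elim: k => //= k ih; exact: sq_summable_minus_scalar.
Qed.

Lemma supp_iter z k f : supp_downstream f ->
  supp_downstream (iter k (minus_scalar z) f).
Proof. by move=> hf; elim: k => //= k ih; exact: supp_minus_scalar. Qed.

Lemma iter_minus_scalar0 z k : iter k (minus_scalar z) (fun=> 0) = fun=> 0.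
Proof. by elim: k => //= k ->; exact: minus_scalar0. Qed.

Lemma iter_minus_scalarD z k f g : iter k (minus_scalar z) (fun p => f p + g p) =
  fun p => iter k (minus_scalar z) f p + iter k (minus_scalar z) g p.
Proof. by elim: k => //= k ->; exact: minus_scalarD. Qed.

Lemma restrict_iter z k f : supp_downstream f ->
  restrict_core (iter k (minus_scalar z) f) =
  restrict_core f *m (core_mx - z%:M) ^+ k.
Proof.
move=> hf; elim: k => [|k ih]; first by rewrite expr0 mulmx1.
rewrite iterS restrict_minus_scalar; last exact: supp_iter.
by rewrite ih exprSr mulmxA.
Qed.

Lemma supp_of_iter z k f : cmod c < cmod z -> sq_summable f ->
  supp_downstream (iter k (minus_scalar z) f) -> supp_downstream f.
Proof.
move=> cz; elim: k f => // k ih f hf; rewrite iterSr => h.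
apply: (supp_of_minus_scalar cz hf); apply: ih => //.
exact: sq_summable_minus_scalar.
Qed.

(** Together with [generalized_kernel_surj], restriction to the core identifies
    the kernel of [(A - z)^k] with that of the [k]-th power of the matrix: a
    chain is lifted one step at a time by [core_solution]. *)
Lemma generalized_kernel_inj z k f : cmod c < cmod z -> sq_summable f ->
  iter k (minus_scalar z) f = (fun=> 0) -> restrict_core f = 0 -> f = fun=> 0.
Proof.
move=> cz; elim: k f => // k ih f hf h f0.
have sf : supp_downstream f.
  by apply: (supp_of_iter cz hf (k:=k.+1)); rewrite h.
rewrite iterSr in h.
have := ih _ (sq_summable_minus_scalar z hf) h.
rewrite restrict_minus_scalar// f0 mul0mx => /(_ erefl) Lf.
by apply/funext; apply: (minus_scalar_inj cz hf) => // p; rewrite Lf.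
Qed.

Lemma generalized_kernel_surj z k w : cmod c < cmod z ->
  w *m (core_mx - z%:M) ^+ k = 0 ->
  exists f, [/\ sq_summable f, iter k (minus_scalar z) f = (fun=> 0) &
                restrict_core f = w].
Proof.
move=> cz; elim: k w => [|k ih] w.
  rewrite expr0 mulmx1 => ->; exists (fun=> 0); split=> //.
    exact: sq_summable0.
  by apply/rowP => i; rewrite !mxE.
rewrite exprS mulmxA => /ih [u [su hu ru]].
have du : supp_downstream u by apply: (supp_of_iter cz su (k:=k)); rewrite hu.
exists (core_solution z u w); split.
- exact: sq_summable_core_solution.
- by rewrite iterSr core_solutionP.
- by rewrite restrict_core_solution.
Qed.

Lemma iter_range z k u w : cmod c < cmod z -> sq_summable u ->
  supp_downstream u -> restrict_core u = w *m (core_mx - z%:M) ^+ k ->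
  exists g, [/\ sq_summable g, supp_downstream g,
     iter k (minus_scalar z) g = u & restrict_core g = w].
Proof.
move=> cz su du; elim: k w => [|k ih] w.
  by rewrite expr0 mulmx1 => hw; exists u.
rewrite exprS mulmxA => /ih [g [sg dg hg rg]].
exists (core_solution z g w); split.
- exact: sq_summable_core_solution.
- exact: supp_core_solution.
- by rewrite iterSr core_solutionP.
- by rewrite restrict_core_solution.
Qed.

Lemma minus_scalar_free z g : cmod c < cmod z -> sq_summable g ->
  minus_scalar z (free_resolvent tau c z g) = fun p =>
  g p + spread (restrict_core (free_resolvent tau c z g)) p.
Proof.
move=> cz /sq_summable_bounded[K _ gK]; apply/funext => p.
by rewrite /minus_scalar /perturbed_shift -[in RHS](free_resolventP tau cz gK p); ring.
Qed.

(** The free resolvent inverts [A - z] up to a downstream error, because the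
    perturbation only creates downstream amplitudes. *)
Lemma range_mod_downstream z k u : cmod c < cmod z -> sq_summable u ->
  exists2 g, sq_summable g &
    supp_downstream (fun p => u p - iter k (minus_scalar z) g p).
Proof.
move=> cz su; elim: k => [|k [g sg hg]].
  by exists u => // p _; rewrite subrr.
exists (free_resolvent tau c z g); first exact: sq_summable_free.
rewrite iterSr minus_scalar_free// iter_minus_scalarD => p np.
rewrite opprD addrA hg// (@supp_iter z k (spread _))// ?subr0//.
exact: supp_spread.
Qed.

(** A Bezout relation between [X^n] and the part of the characteristic polynomial
    prime to [X], evaluated at the matrix. *)
Lemma fitting_row (A : 'M[R[i]]_n.+1) w : exists x y,
  w = x + y *m A ^+ n.+1 /\ x *m A ^+ n.+1 = 0.
Proof.
have cn0 : char_poly A != 0 by rewrite monic_neq0 ?char_poly_monic.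
have [m [q hq cq]] := multiplicity_XsubC (char_poly A) 0.
rewrite cn0 /= in hq; rewrite subr0 in cq.
have qn0 : q != 0 by apply: contraNneq hq => ->; rewrite root0.
have mn : (m <= n.+1)%N.
  have := size_char_poly A; rewrite cq size_mul ?expf_neq0 ?polyX_eq0//.
  rewrite size_polyXn addnS /= => /eqP; rewrite -size_poly_gt0 in qn0.
  by move: (size q) qn0 => [//|k] _; rewrite addSn eqSS => /eqP <-; rewrite leq_addl.
have cop : coprimep ('X^(n.+1) : {poly R[i]}) q.
  rewrite coprimep_expl// coprimep_sym -['X]subr0 coprimep_XsubC//.
have [[a b] /= hab] := Bezout_eq1_coprimepP _ _ cop.
have hX : horner_mx A 'X^(n.+1) = A ^+ n.+1 by rewrite rmorphXn /= horner_mx_X.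
exists (w *m horner_mx A (b * q)), (w *m horner_mx A a); split.
  rewrite -mulmxA -hX -!mulmxDr mulmxE -rmorphM -rmorphD addrC hab rmorph1 mulmx1//.
rewrite -mulmxA -hX mulmxE -rmorphM /=.
have -> : b * q * 'X^(n.+1) = b * 'X^(n.+1 - m) * char_poly A.
  by rewrite cq -{1}(subnK mn) exprD; ring.
by rewrite rmorphM /= Cayley_Hamilton mulr0 mulmx0.
Qed.

(** Fitting decomposition of the whole space: the upstream part is removed
    with the free resolvent and the downstream part is controlled by its
    values on the core, where the finite-dimensional decomposition applies. *)
Lemma fitting_decomposition z u : cmod c < cmod z -> sq_summable u ->
  exists e g, [/\ sq_summable e, sq_summable g,
    iter n.+1 (minus_scalar z) e = (fun=> 0) &
    u = fun p => e p + iter n.+1 (minus_scalar z) g p].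
Proof.
move=> cz su.
have [g sg dg] := range_mod_downstream n.+1 cz su.
set u' := (fun p => _ - _) in dg.
have su' : sq_summable u' by apply: sq_summableB => //; exact: sq_summable_iter.
have [x [y [hxy x0]]] := fitting_row (core_mx - z%:M) (restrict_core u').
have [e [se he re]] := generalized_kernel_surj cz x0.
have de : supp_downstream e by apply: (supp_of_iter cz se (k:=n.+1)); rewrite he.
have [g' [sg' _ hg' _]] : exists g, [/\ sq_summable g, supp_downstream g,
     iter n.+1 (minus_scalar z) g = (fun p => u' p - e p) & restrict_core g = y].
  apply: iter_range => //; first exact: sq_summableB.
    by move=> p np; rewrite dg// de// subr0.
  apply/rowP => i; have /rowP/(_ i) := hxy; have /rowP/(_ i) := re.
  by rewrite !mxE => -> ->; ring.
exists e, (fun p => g p + g' p); split=> //; first exact: sq_summableD.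
by apply/funext => p; rewrite iter_minus_scalarD hg' /u'; ring.
Qed.

(** The free resolvent [y] solves the equation up to the downstream error [b],
    which is then removed by [core_solution] with the core values given by the
    inverse matrix. *)
Definition core_resolvent z u : I -> R[i] :=
  let y := free_resolvent tau c z u in
  let b := spread (restrict_core y) in
  fun p => y p + core_solution z (fun q => - b q)
    (restrict_core (fun q => - b q) *m invmx (core_mx - z%:M)) p.

Lemma sq_summableN u : sq_summable u -> sq_summable (fun p => - u p).
Proof.
by move=> hu; under eq_fun do rewrite -mulN1r; exact: sq_summableZ.
Qed.

Lemma sq_summable_core_resolvent z u : cmod c < cmod z -> sq_summable u ->
  sq_summable (core_resolvent z u).
Proof.
move=> cz su; apply: sq_summableD; first exact: sq_summable_free.
apply: sq_summable_core_solution => //; apply: sq_summableN.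
exact: sq_summable_spread.
Qed.

Lemma core_resolventP z u : cmod c < cmod z -> core_mx - z%:M \in unitmx ->
  sq_summable u -> minus_scalar z (core_resolvent z u) = u.
Proof.
move=> cz zu su; rewrite minus_scalarD minus_scalar_free// core_solutionP//.
- by apply/funext => p; rewrite addrK.
- by apply: sq_summableN; exact: sq_summable_spread.
- by move=> p np; rewrite supp_spread// oppr0.
- by rewrite mulmxKV.
Qed.

Lemma minus_scalar_unit_inj z u v : cmod c < cmod z ->
  core_mx - z%:M \in unitmx -> sq_summable u -> sq_summable v ->
  minus_scalar z u = minus_scalar z v -> u = v.
Proof.
move=> cz zu su sv huv.
have sd := sq_summableB su sv.
have h : minus_scalar z (fun p => u p - v p) = fun=> 0.
  by rewrite minus_scalarB huv; apply/funext => p; rewrite subrr.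
have d : supp_downstream (fun p => u p - v p).
  by apply: (supp_of_minus_scalar cz sd); rewrite h.
have : restrict_core (fun p => u p - v p) = 0.
  have := restrict_minus_scalar z d; rewrite h => e.
  rewrite -[LHS](mulmxK zu) -e.
  by apply/rowP => i; rewrite !mxE big1// => j _; rewrite !mxE mul0r.
move=> r0; apply/funext => p; apply/eqP; rewrite -subr_eq0; apply/eqP.
by apply: (minus_scalar_inj cz sd _ r0) => q; rewrite h.
Qed.

(** Boundedness of the resolvent is checked on the building blocks of its formula,
    free resolvents and finite-rank operators. *)
Definition op_bounded (T : (I -> R[i]) -> I -> R[i]) :=
  exists2 M, 0 <= M & forall u K, sqsum_le u K -> sqsum_le (T u) (M * K).

Definition form_bounded (phi : (I -> R[i]) -> R[i]) :=
  exists2 M, 0 <= M & forall u K, sqsum_le u K -> cmod (phi u) ^+ 2 <= M * K.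

Lemma op_boundedD S T : op_bounded S -> op_bounded T ->
  op_bounded (fun u p => S u p + T u p).
Proof.
move=> [M M0 hM] [N N0 hN]; exists (2 * M + 2 * N).
  by rewrite addr_ge0 ?mulr_ge0.
move=> u K uK; rewrite mulrDl -!mulrA.
by apply: sqsumD; [exact: hM|exact: hN].
Qed.

Lemma op_boundedN S : op_bounded S -> op_bounded (fun u p => - S u p).
Proof.
move=> [M M0 hM]; exists M => // u K /hM; apply: sqsum_dominated => p.
by rewrite cmodN.
Qed.

Lemma form_boundedD (phi psi : (I -> R[i]) -> R[i]) : form_bounded phi ->
  form_bounded psi -> form_bounded (fun u => phi u + psi u).
Proof.
move=> [M M0 hM] [N N0 hN]; exists (2 * M + 2 * N).
  by rewrite addr_ge0 ?mulr_ge0.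
move=> u K uK.
apply: (@le_trans _ _ ((cmod (phi u) + cmod (psi u)) ^+ 2)).
  by rewrite ler_pXn2r ?nnegrE ?cmodD ?addr_ge0 ?cmod_ge0.
by rewrite (le_trans (sqrD_le _ _))// [leRHS]mulrDl -!mulrA lerD// ler_pM2l ?hM ?hN.
Qed.

Lemma form_bounded_scale (phi : (I -> R[i]) -> R[i]) (b : R[i]) :
  form_bounded phi -> form_bounded (fun u => phi u * b).
Proof.
move=> [M M0 hM]; exists (cmod b ^+ 2 * M); first by rewrite mulr_ge0 ?exprn_ge0 ?cmod_ge0.
move=> u K uK; rewrite cmodM exprMn [leLHS]mulrC -[leRHS]mulrA ler_wpM2l ?hM//.
by rewrite exprn_ge0 ?cmod_ge0.
Qed.

Lemma form_bounded_sum (J : Type) (s : seq J) (phi : J -> (I -> R[i]) -> R[i]) :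
  (forall j, form_bounded (phi j)) -> form_bounded (fun u => \sum_(j <- s) phi j u).
Proof.
move=> h; elim: s => [|j s ih].
  by exists 0 => // u K _; rewrite big_nil cmod0 expr0n mul0r.
by under eq_fun do rewrite big_cons; exact: form_boundedD.
Qed.

Lemma op_bounded_spread (b : (I -> R[i]) -> 'rV[R[i]]_n.+1) :
  (forall i, form_bounded (fun u => b u 0 i)) ->
  op_bounded (fun u => spread (b u)).
Proof.
move=> hb; rewrite /spread; elim: (index_enum _) => [|i s ih].
  exists 0 => // u K _ t ut; rewrite mul0r big1// => p _.
  by rewrite big_nil cmod0 expr0n.
under eq_fun do under eq_fun do rewrite big_cons.
apply: op_boundedD => //.
have [Q hQ] : sq_summable (W i).
  by rewrite spread_delta; exact: sq_summable_spread.
have [M M0 hM] := hb i; exists (M * Q); first by rewrite mulr_ge0// (sqsum_ge0 hQ).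
move=> u K uK t ut; apply: le_trans (sqsumZ (b u 0 i) hQ ut) _.
by rewrite [leRHS]mulrAC ler_wpM2r ?(sqsum_ge0 hQ)// hM.
Qed.

Lemma form_bounded_eval (T : (I -> R[i]) -> I -> R[i]) p : op_bounded T ->
  form_bounded (fun u => T u p).
Proof.
move=> [M M0 hM]; exists M => // u K /hM /(_ [:: p] isT).
by rewrite big_seq1.
Qed.

Lemma op_bounded_free (T : (I -> R[i]) -> I -> R[i]) z : cmod c < cmod z ->
  op_bounded T -> op_bounded (fun u => free_resolvent tau c z (T u)).
Proof.
move=> cz [M M0 hM]; exists (M / (cmod z - cmod c) ^+ 2).
  by rewrite mulr_ge0// invr_ge0 sqr_ge0.
move=> u K /hM /(free_resolvent_sqsum tau_inj cz).
by rewrite mulrAC.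
Qed.

Lemma op_bounded_core_resolvent z : cmod c < cmod z ->
  op_bounded (core_resolvent z).
Proof.
move=> cz.
have bid : op_bounded id by exists 1 => // u K; rewrite mul1r.
have bfree := op_bounded_free cz bid.
have bspread : op_bounded (fun u => (fun q => - spread
   (restrict_core (free_resolvent tau c z u)) q)).
  apply: op_boundedN; apply: op_bounded_spread => i.
  under eq_fun do rewrite mxE.
  exact: (form_bounded_eval (iota i) bfree).
apply: op_boundedD => //.
pose b u := fun q => - spread (restrict_core (free_resolvent tau c z u)) q.
apply: (@op_bounded_free (fun u p => b u p -
  spread (restrict_core (b u) *m invmx (core_mx - z%:M)) p)) => //.
apply: op_boundedD => //; apply: op_boundedN; apply: op_bounded_spread => i.
under eq_fun do rewrite mxE.
apply: form_bounded_sum => j; apply: form_bounded_scale.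
under eq_fun do rewrite mxE.
exact: (form_bounded_eval (iota j) bspread).
Qed.

End FiniteRankPerturbation.

(** * Functions uniformly approximated by polynomials *)

Section PolynomialApproximation.
Variables (R : realType) (lam : R[i]) (delta : R).
Implicit Types (f g h : R[i] -> R[i]) (z : R[i]).

Definition punctured z := 0 < cmod (z - lam) <= delta.

(** A substitute for analyticity near an isolated point [lam]: the class is an
    algebra closed under uniform limits, contains [1 / (z - a)] for distant [a],
    and its members have vanishing integrals along circles around [lam].  The
    point itself is excluded so that removable singularities need no value. *)
Definition poly_approx f := forall e : R, 0 < e ->
  exists p : {poly R[i]}, forall z, punctured z -> cmod (f z - p.[z - lam]) <= e.

Lemma pow_small (C t e : R) : 0 <= t < 1 -> 0 < e -> exists n : nat, C * t ^+ n <= e.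
Proof.
move=> /andP[t0 t1] e0.
have cv : C * t ^+ n @[n --> \oo] --> C * 0.
  by apply: cvgMr; apply: cvg_expr; rewrite ger0_norm.
rewrite mulr0 in cv; have /= := cvgr_le 0 cv e e0.
by case=> N _ /(_ N (leqnn N)); exists N.
Qed.

Lemma poly_approx_ext f g : (forall z, punctured z -> f z = g z) ->
  poly_approx f -> poly_approx g.
Proof.
move=> fg hf e e0; have [p hp] := hf e e0; exists p => z hz.
by rewrite -fg//; exact: hp.
Qed.

Lemma poly_approx_lim f :
  (forall e, 0 < e -> exists2 g, poly_approx g &
     forall z, punctured z -> cmod (f z - g z) <= e) -> poly_approx f.
Proof.
move=> h e e0; have e2 : 0 < e / 2 by rewrite divr_gt0.
have [g hg fg] := h _ e2; have [p hp] := hg _ e2.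
exists p => z hz; rewrite [e]splitr -(subrKA (g z)) (le_trans (cmodD _ _))// lerD//.
  exact: fg.
exact: hp.
Qed.

Lemma poly_approx_cst (a : R[i]) : poly_approx (fun=> a).
Proof.
move=> e e0; exists a%:P => z _; rewrite hornerC subrr cmod0; exact: ltW.
Qed.

Lemma poly_approx_shift : poly_approx (fun z => z - lam).
Proof.
move=> e e0; exists 'X => z _; rewrite hornerX subrr cmod0; exact: ltW.
Qed.

Lemma poly_approxD f g : poly_approx f -> poly_approx g ->
  poly_approx (fun z => f z + g z).
Proof.
move=> hf hg e e0; have e2 : 0 < e / 2 by rewrite divr_gt0.
have [p hp] := hf _ e2; have [q hq] := hg _ e2.
exists (p + q) => z hz; rewrite hornerD opprD addrACA [e]splitr.
by rewrite (le_trans (cmodD _ _))// lerD// ?hp ?hq.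
Qed.

Lemma poly_bounded (p : {poly R[i]}) : exists2 K, 0 < K &
  forall z, punctured z -> cmod (p.[z - lam]) <= K.
Proof.
elim/poly_ind: p => [|p a [K K0 hK]].
  by exists 1 => // z _; rewrite horner0 cmod0.
exists (K * `|delta| + cmod a + 1).
  by rewrite ltr_wpDl// addr_ge0 ?cmod_ge0// mulr_ge0// ltW.
move=> z hz; rewrite hornerMXaddC.
rewrite (le_trans (cmodD _ _))// cmodM -addrA lerD ?lerDl//.
rewrite ler_pM ?cmod_ge0 ?hK//; have /andP[_ h] := hz.
by rewrite (le_trans h)// ler_norm.
Qed.

Lemma poly_approx_bounded f : poly_approx f -> exists2 K, 0 < K &
  forall z, punctured z -> cmod (f z) <= K.
Proof.
move=> /(_ 1 ltr01)[p hp]; have [K K0 hK] := poly_bounded p.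
exists (1 + K); first by rewrite addr_gt0.
move=> z hz; rewrite -[f z](subrK (p.[z - lam])) (le_trans (cmodD _ _))// lerD//.
  exact: hp.
exact: hK.
Qed.

Lemma poly_approxM f g : poly_approx f -> poly_approx g ->
  poly_approx (fun z => f z * g z).
Proof.
move=> hf hg; have [A A0 hA] := poly_approx_bounded hf.
have [B B0 hB] := poly_approx_bounded hg.
move=> e e0.
have e1 : 0 < e / 2 / (B + 1) by rewrite !divr_gt0// addr_gt0.
have e2' : 0 < e / 2 / A by rewrite !divr_gt0.
have e2 : 0 < Num.min 1 (e / 2 / A) by rewrite lt_min ltr01.
have [p hp] := hf _ e1; have [q hq] := hg _ e2.
exists (p * q) => z hz; rewrite hornerM.
have -> : f z * g z - p.[z - lam] * q.[z - lam] =
  f z * (g z - q.[z - lam]) + (f z - p.[z - lam]) * q.[z - lam] by ring.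
rewrite [e]splitr (le_trans (cmodD _ _))// !cmodM lerD//.
  apply: (@le_trans _ _ (A * (e / 2 / A))); last by rewrite mulrC divfK// gt_eqF.
  rewrite ler_pM ?cmod_ge0 ?hA// (le_trans (hq z hz))//.
  by rewrite ge_min lexx orbT.
apply: (@le_trans _ _ (e / 2 / (B + 1) * (B + 1))).
  rewrite ler_pM ?cmod_ge0 ?hp//.
  rewrite -[q.[_]](subrK (g z)) (le_trans (cmodD _ _))// addrC lerD ?hB// cmodBC.
  by rewrite (le_trans (hq z hz))// ge_min lexx.
by rewrite divfK// gt_eqF// addr_gt0.
Qed.

Lemma poly_approxN f : poly_approx f -> poly_approx (fun z => - f z).
Proof.
move=> hf; have h := poly_approxM (poly_approx_cst (-1)) hf.
by apply: poly_approx_ext h => z _; rewrite mulN1r.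
Qed.

Lemma poly_approxB f g : poly_approx f -> poly_approx g ->
  poly_approx (fun z => f z - g z).
Proof. by move=> hf /poly_approxN; exact: poly_approxD. Qed.

Lemma poly_approx_id : poly_approx id.
Proof.
have h := poly_approxD poly_approx_shift (poly_approx_cst lam).
by apply: poly_approx_ext h => z _; rewrite subrK.
Qed.

Lemma poly_approx_sum (J : Type) (s : seq J) (P : pred J) (F : J -> R[i] -> R[i]) :
  (forall j, poly_approx (F j)) -> poly_approx (fun z => \sum_(j <- s | P j) F j z).
Proof.
move=> h; elim: s => [|j s ih].
  by under eq_fun do rewrite big_nil; exact: poly_approx_cst.
under eq_fun do rewrite big_cons.
by case: (P j) => //; exact: poly_approxD.
Qed.

Lemma poly_approx_prod (J : eqType) (s : seq J) (F : J -> R[i] -> R[i]) :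
  (forall j, j \in s -> poly_approx (F j)) ->
  poly_approx (fun z => \prod_(j <- s) F j z).
Proof.
elim: s => [|j s ih] h.
  by under eq_fun do rewrite big_nil; exact: poly_approx_cst.
under eq_fun do rewrite big_cons.
apply: poly_approxM; first by apply: h; rewrite mem_head.
by apply: ih => k ks; apply: h; rewrite in_cons ks orbT.
Qed.

Lemma poly_approxX f k : poly_approx f -> poly_approx (fun z => f z ^+ k).
Proof.
move=> hf; elim: k => [|k ih].
  by under eq_fun do rewrite expr0; exact: poly_approx_cst.
by under eq_fun do rewrite exprS; exact: poly_approxM.
Qed.

(** Geometric series in [(z - lam) / (a - lam)]. *)
Lemma poly_approx_inv (a : R[i]) : delta < cmod (a - lam) ->
  poly_approx (fun z => (z - a)^-1).
Proof.
move=> da; have [d0|d0] := ltP 0 delta; last first.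
  move=> e _; exists 0 => z /andP[z0 zd].
  by have := lt_le_trans z0 (le_trans zd d0); rewrite ltxx.
set b := a - lam in da *.
have b0 : 0 < cmod b by exact: lt_trans da.
have bn0 : b != 0 by rewrite -cmod_gt0.
have ht : 0 <= delta / cmod b < 1.
  by rewrite divr_ge0 ?ltW//= ltr_pdivrMr// mul1r.
set t := delta / cmod b in ht.
apply: poly_approx_lim => e e0.
have [N hN] := pow_small (cmod b - delta)^-1 ht e0.
exists (fun z => - b^-1 * \sum_(k < N) ((z - lam) * b^-1) ^+ k).
  apply: poly_approxM; first exact: poly_approx_cst.
  apply: poly_approx_sum => k; apply: poly_approxX; apply: poly_approxM.
    exact: poly_approx_shift.
  exact: poly_approx_cst.
move=> z /andP[_ zd]; set x := (z - lam) * b^-1.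
have wb : z - a = (z - lam) - b by rewrite /b opprB addrA subrK.
have lowb : cmod b - delta <= cmod (z - a).
  rewrite wb cmodBC (le_trans _ (cmod_sub_le _ _))// lerB//.
have db0 : 0 < cmod b - delta by rewrite subr_gt0.
have za0 : z - a != 0 by rewrite -cmod_gt0 (lt_le_trans db0).
have xE : x - 1 = (z - a) / b by rewrite wb /x [RHS]mulrBl divff.
have x1 : x - 1 != 0 by rewrite xE mulf_neq0// invr_eq0.
have geo : \sum_(k < N) x ^+ k = (x ^+ N - 1) / (x - 1).
  by rewrite subrX1 [_ * \sum_(i < N) _]mulrC mulfK.
have -> : (z - a)^-1 - - b^-1 * \sum_(k < N) x ^+ k = (z - a)^-1 * x ^+ N.
  by rewrite geo xE; field; rewrite za0.
rewrite cmodM cmodV cmodX (le_trans _ hN)//.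
apply: ler_pM; rewrite ?invr_ge0 ?exprn_ge0 ?cmod_ge0//.
  by rewrite lef_pV2 ?posrE// cmod_gt0.
rewrite lerXn2r ?nnegrE ?cmod_ge0//; first by case/andP: ht.
by rewrite /x cmodM cmodV ler_wpM2r// invr_ge0 cmod_ge0.
Qed.

Lemma poly_approx_det m (A : R[i] -> 'M[R[i]]_m) :
  (forall i j, poly_approx (fun z => A z i j)) ->
  poly_approx (fun z => \det (A z)).
Proof.
move=> hA; rewrite /determinant; apply: poly_approx_sum => s.
apply: poly_approxM; first exact: poly_approx_cst.
by apply: poly_approx_prod => i _.
Qed.

(** The poles of the inverse of [B - z] at an eigenvalue have order at most
    the size of [B]: each linear factor of the characteristic polynomial
    absorbs one factor [z - lam]. *)
Lemma poly_approx_invmx n (B : 'M[R[i]]_n.+1) i j :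
  (forall x, eigenvalue B x -> x != lam -> delta < cmod (x - lam)) ->
  poly_approx (fun z => (z - lam) ^+ n.+1 * invmx (B - z%:M) i j).
Proof.
move=> hB.
have [rs hrs] := closed_field_poly_normal (char_poly B).
rewrite (monicP (char_poly_monic B)) scale1r in hrs.
have szrs : size rs = n.+1.
  by have := size_char_poly B; rewrite hrs size_prod_XsubC => -[].
have inrs x : x \in rs -> eigenvalue B x.
  by rewrite eigenvalue_root_char hrs root_prod_XsubC.
have detE z : \det (B - z%:M) = \prod_(x <- rs) (x - z).
  have -> : B - z%:M = - (z%:M - B) by rewrite opprB.
  rewrite -scaleN1r detZ.
  have -> : \det (z%:M - B) = (char_poly B).[z].
    rewrite /char_poly -[RHS]/(horner_eval z (\det _)) -det_map_mx /char_poly_mx; congr (\det _).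
    by apply/matrixP => k l; rewrite !mxE /= /horner_eval hornerD hornerN hornerMn hornerX hornerC.
  rewrite hrs horner_prod -szrs; elim: (rs) => [|x s ih].
    by rewrite !big_nil expr0 mul1r.
  rewrite !big_cons exprS -ih hornerXsubC; ring.
have cofP : poly_approx (fun z => (\adj (B - z%:M)) i j).
  under eq_fun do rewrite mxE /cofactor.
  apply: poly_approxM; first exact: poly_approx_cst.
  apply: poly_approx_det => k l; under eq_fun do rewrite !mxE.
  apply: poly_approxB; first exact: poly_approx_cst.
  by case: eqP => _; [exact: poly_approx_id|exact: poly_approx_cst].
have prodP : poly_approx (fun z => \prod_(x <- rs) ((z - lam) / (x - z))).
  apply: poly_approx_prod => x /inrs ex.
  have [->|xl] := eqVneq x lam.
    apply: (poly_approx_ext (f:=fun=> -1)); last exact: poly_approx_cst.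
    move=> z /andP[z0 _]; rewrite -[lam - z]opprB invrN mulrN divff//.
    by rewrite -cmod_gt0.
  apply: poly_approxM; first exact: poly_approx_shift.
  have h := poly_approxN (poly_approx_inv (hB _ ex xl)).
  by apply: poly_approx_ext h => z _; rewrite -[x - z]opprB invrN.
apply: poly_approx_ext (poly_approxM prodP cofP) => z hz.
rewrite /invmx.
have zu : B - z%:M \in unitmx.
  rewrite unitmxE detE unitfE; rewrite prodf_seq_neq0; apply/allP => x /inrs ex /=.
  have [->|xl] := eqVneq x lam.
    by case/andP: hz => h _; rewrite -cmod_gt0 cmodBC.
  rewrite subr_eq0; apply: contraTneq (hB _ ex xl) => ->.
  by rewrite -leNgt; case/andP: hz.
rewrite zu [in RHS]mxE detE mulrA; congr (_ * _).
have -> : (z - lam) ^+ n.+1 = (z - lam) ^+ size rs by rewrite szrs.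
elim: (rs) => [|x s ih]; first by rewrite !big_nil /= expr0 divr1.
rewrite !big_cons ih exprS invfM; ring.
Qed.

End PolynomialApproximation.

(** * Resolvent entries have polynomial approximations *)

Section ResolventApproximation.
Variables (R : realType) (I : choiceType) (tau : I -> I) (c lam : R[i]) (delta : R).
Hypothesis delta_small : cmod c + delta < cmod lam.
Implicit Types (z : R[i]) (u : R[i] -> I -> R[i]).

Let rho := cmod lam - delta.

Lemma rho_le z : punctured lam delta z -> rho <= cmod z.
Proof.
move=> /andP[_ h]; rewrite lerBlDr -lerBlDl (le_trans _ h)// cmodBC.
exact: cmod_sub_le.
Qed.

Lemma c_lt_rho : cmod c < rho. Proof. by rewrite ltrBrDr. Qed.

Lemma rho_gt0 : 0 < rho. Proof. exact: le_lt_trans (cmod_ge0 _) c_lt_rho. Qed.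

Lemma punctured_gt_c z : punctured lam delta z -> cmod c < cmod z.
Proof. by move/rho_le; apply: lt_le_trans c_lt_rho. Qed.

Lemma poly_approx_inv_id : poly_approx lam delta (fun z => z^-1).
Proof.
have h : delta < cmod (0 - lam).
  rewrite sub0r cmodN; apply: le_lt_trans delta_small.
  by rewrite lerDr cmod_ge0.
have := poly_approx_inv h; apply: poly_approx_ext => z _; by rewrite subr0.
Qed.

(** The partial sums of the Neumann series converge uniformly, since the ratio
    stays below [cmod c / rho] on the whole disc. *)
Lemma poly_approx_free u K p :
  (forall q, poly_approx lam delta (fun z => u z q)) ->
  (forall z, punctured lam delta z -> bounded_by (u z) K) ->
  poly_approx lam delta (fun z => free_resolvent tau c z (u z) p).
Proof.
move=> hu hK; apply: poly_approx_lim => e e0.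
pose t := cmod c / rho.
have rho0 := rho_gt0.
have ht : 0 <= t < 1.
  by rewrite divr_ge0 ?cmod_ge0 ?(ltW rho0)//= ltr_pdivrMr// mul1r c_lt_rho.
have [N hN] := pow_small (rho^-1 * (2 * `|K| / (1 - t))) ht e0.
exists (fun z => - z^-1 * \sum_(k < N) (c / z) ^+ k * u z (iter k tau p)).
  apply: poly_approxM; first by apply: poly_approxN; exact: poly_approx_inv_id.
  apply: poly_approx_sum => k; apply: poly_approxM => //; apply: poly_approxX.
  by apply: poly_approxM; [exact: poly_approx_cst|exact: poly_approx_inv_id].
move=> z hz; have rz := rho_le hz; have z0 := lt_le_trans rho0 rz.
have cz := punctured_gt_c hz.
have tz : cmod (c / z) <= t.
  rewrite cmodM cmodV ler_wpM2l ?cmod_ge0//.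
  by rewrite lef_pV2 ?posrE.
have K0 : 0 <= K by rewrite (le_trans _ (hK z hz p))// cmod_ge0.
apply: (le_trans (free_resolvent_approx tau cz (hK z hz) p N)).
apply: le_trans hN; rewrite -[leRHS]mulrA ger0_norm//.
have /andP[t0 t1] := ht.
apply: ler_pM.
- by rewrite invr_ge0 cmod_ge0.
- rewrite !mulr_ge0// ?exprn_ge0 ?cmod_ge0// invr_ge0 subr_ge0.
  by rewrite (le_trans tz) ?ltW.
- by rewrite lef_pV2 ?posrE.
apply: ler_pM.
- by rewrite !mulr_ge0// invr_ge0 subr_ge0 (le_trans tz) ?ltW.
- by rewrite exprn_ge0 ?cmod_ge0.
- rewrite ler_wpM2l ?mulr_ge0// lef_pV2 ?posrE ?subr_gt0//; first exact: lerB.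
  exact: le_lt_trans tz t1.
- by rewrite lerXn2r ?nnegrE ?cmod_ge0.
Qed.

Lemma free_resolventZ z (a : R[i]) (v : I -> R[i]) K : cmod c < cmod z ->
  bounded_by v K ->
  free_resolvent tau c z (fun p => a * v p) = fun p => a * free_resolvent tau c z v p.
Proof.
move=> cz vK.
have avK : bounded_by (fun p => a * v p) (cmod a * K).
  by move=> p; rewrite cmodM ler_wpM2l ?cmod_ge0.
have b1 := free_resolvent_bounded tau cz avK.
have b2 : bounded_by (fun p => a * free_resolvent tau c z v p)
    (cmod a * ((cmod z)^-1 * (2 * K / (1 - cmod (c / z))))).
  by move=> p; rewrite cmodM ler_wpM2l ?cmod_ge0// (free_resolvent_bounded tau cz vK).
set B1 := (_ * _) in b1; set B2 := (_ * _) in b2.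
have lr : (B1 <= Num.max B1 B2) /\ (B2 <= Num.max B1 B2).
  by rewrite !le_max !lexx orbT.
apply: (free_resolvent_unique (tau:=tau) cz (K:=Num.max B1 B2)).
- by move=> p; exact: le_trans (b1 p) lr.1.
- by move=> p; exact: le_trans (b2 p) lr.2.
move=> p; rewrite (free_resolventP tau cz avK) -(free_resolventP tau cz vK p); ring.
Qed.

Variables (n : nat) (iota : 'I_n.+1 -> I) (W : 'I_n.+1 -> I -> R[i]) (KW : R).
Hypothesis W_bounded : forall i, bounded_by (W i) KW.

Let B := core_mx tau iota c W.

Hypothesis lam_isolated : forall x, eigenvalue B x -> x != lam -> delta < cmod (x - lam).

(** The only poles come from the inverse of the core matrix, and the factor
    [(z - lam)^(n+1)] removes them; it is moved inside the free resolvent, where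
    the coefficients become uniformly bounded. *)
Lemma poly_approx_core_resolvent (g : I -> R[i]) K p : bounded_by g K ->
  poly_approx lam delta (fun z => (z - lam) ^+ n.+1 *
    core_resolvent tau iota c W z g p).
Proof.
move=> gK.
pose y z := free_resolvent tau c z g.
have hy q : poly_approx lam delta (y^~ q).
  by apply: (poly_approx_free (K:=K)) => // q'; exact: poly_approx_cst.
pose m z := (z - lam) ^+ n.+1.
have hm : poly_approx lam delta m by apply: poly_approxX; exact: poly_approx_shift.
pose b z := spread W (restrict_core iota (y z)).
have hb q : poly_approx lam delta (b^~ q).
  apply: poly_approx_sum => i; apply: poly_approxM; last exact: poly_approx_cst.
  by under eq_fun do rewrite mxE; exact: hy.
pose w z := restrict_core iota (fun q => - b z q) *m invmx (B - z%:M).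
have hw i : poly_approx lam delta (fun z => m z * w z 0 i).
  have h : poly_approx lam delta (fun z => \sum_j - b z (iota j) *
      (m z * invmx (B - z%:M) j i)).
    apply: poly_approx_sum => j; apply: poly_approxM; first exact: poly_approxN.
    exact: poly_approx_invmx.
  apply: poly_approx_ext h => z _; rewrite /w mxE mulr_sumr.
  by apply: eq_bigr => j _; rewrite mxE mulrCA.
pose al i z := m z * (- restrict_core iota (y z) 0 i - w z 0 i).
have hal i : poly_approx lam delta (al i).
  have h : poly_approx lam delta (fun z => - (m z * y z (iota i)) - m z * w z 0 i).
    by apply: poly_approxB => //; apply: poly_approxN; exact: poly_approxM.
  apply: poly_approx_ext h => z _; rewrite /al.
  have -> : restrict_core iota (y z) 0 i = y z (iota i) by rewrite mxE.
  ring.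
pose u z q := \sum_i al i z * W i q.
have hu q : poly_approx lam delta (u^~ q).
  by apply: poly_approx_sum => i; apply: poly_approxM => //; exact: poly_approx_cst.
have [Ka hKa] : {Ka : 'I_n.+1 -> R & forall i z,
    punctured lam delta z -> cmod (al i z) <= Ka i}.
  apply: (@choice _ _ (fun i (k : R) => forall z,
    punctured lam delta z -> cmod (al i z) <= k)) => i.
  by have [k _ hk] := poly_approx_bounded (hal i); exists k.
have uK z : punctured lam delta z -> bounded_by (u z) (\sum_i Ka i * KW).
  move=> hz q; rewrite (le_trans (cmod_sum _ _ _))//; apply: ler_sum => i _.
  by rewrite cmodM ler_pM ?cmod_ge0 ?W_bounded// hKa.
have h := poly_approxD (poly_approxM hm (hy p)) (poly_approx_free p hu uK).
apply: poly_approx_ext h => z hz; rewrite /core_resolvent mulrDr; congr (_ + _).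
have cz := punctured_gt_c hz.
rewrite /core_solution.
set v := (fun q => _ - _).
have uv q : u z q = m z * v q.
  rewrite /v /u /spread -sumrN -sumrB mulr_sumr; apply: eq_bigr => i _.
  by rewrite /al /w /b /y; ring.
have m0 : m z != 0.
  by rewrite expf_neq0// -cmod_gt0; case/andP: hz.
have vK : bounded_by v ((cmod (m z))^-1 * \sum_i Ka i * KW).
  move=> q; rewrite -[v q](mulKf m0) -uv cmodM cmodV ler_wpM2l ?invr_ge0 ?cmod_ge0//.
  exact: uK.
have uE : u z = fun q => m z * v q by apply/funext => q; exact: uv.
by rewrite uE (free_resolventZ (m z) cz vK).
Qed.

End ResolventApproximation.

(** * Integrals along circles *)

Section CircleIntegral.
Variable R : realType.
Implicit Types (F G : R -> R[i]) (m : int) (z : R[i]).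

Definition ccontinuous F :=
  continuous (fun t => complex.Re (F t)) /\ continuous (fun t => complex.Im (F t)).

Let D : set R := `[0, 2 * pi].
Let mu := @lebesgue_measure R.

Lemma measurable_period : measurable (D : set (measurableTypeR R)).
Proof. exact: measurable_itv. Qed.

Lemma continuous_integrable_period (f : R -> R) : continuous f ->
  mu.-integrable D (EFin \o f).
Proof.
move=> cf; apply: continuous_compact_integrable; first exact: segment_compact.
by apply: continuous_subspaceT.
Qed.

Lemma ReD (x y : R[i]) : complex.Re (x + y) = complex.Re x + complex.Re y.
Proof. by case: x y => ? ? []. Qed.
Lemma ImD (x y : R[i]) : complex.Im (x + y) = complex.Im x + complex.Im y.
Proof. by case: x y => ? ? []. Qed.
Lemma ReM (x y : R[i]) : complex.Re (x * y) =
  complex.Re x * complex.Re y - complex.Im x * complex.Im y.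
Proof. by case: x y => ? ? []. Qed.
Lemma ImM (x y : R[i]) : complex.Im (x * y) =
  complex.Re x * complex.Im y + complex.Im x * complex.Re y.
Proof. by case: x y => ? ? []. Qed.

Lemma complex_ext (x y : R[i]) : complex.Re x = complex.Re y ->
  complex.Im x = complex.Im y -> x = y.
Proof. by case: x y => ? ? [] ? ? /= -> ->. Qed.

Lemma ccontinuousD F G : ccontinuous F -> ccontinuous G ->
  ccontinuous (fun t => F t + G t).
Proof.
move=> [f1 f2] [g1 g2]; split.
  under eq_fun do rewrite ReD; move=> t; apply: continuousD; [exact: f1|exact: g1].
under eq_fun do rewrite ImD; move=> t; apply: continuousD; [exact: f2|exact: g2].
Qed.

Lemma ccontinuousM F G : ccontinuous F -> ccontinuous G ->
  ccontinuous (fun t => F t * G t).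
Proof.
move=> [f1 f2] [g1 g2]; split.
  under eq_fun do rewrite ReM; move=> t; apply: cvgB; apply: cvgM;
    [exact: f1|exact: g1|exact: f2|exact: g2].
under eq_fun do rewrite ImM; move=> t; apply: cvgD; apply: cvgM;
    [exact: f1|exact: g2|exact: f2|exact: g1].
Qed.

Lemma ccontinuous_cst (a : R[i]) : ccontinuous (fun=> a).
Proof. by split=> t; exact: cvg_cst. Qed.

Lemma ccontinuous_sum (J : Type) (s : seq J) (F : J -> R -> R[i]) :
  (forall j, ccontinuous (F j)) -> ccontinuous (fun t => \sum_(j <- s) F j t).
Proof.
move=> h; elim: s => [|j s ih].
  by under eq_fun do rewrite big_nil; exact: ccontinuous_cst.
by under eq_fun do rewrite big_cons; exact: ccontinuousD.
Qed.

Lemma eq_cintegral F G : (forall t, F t = G t) -> cintegral D F = cintegral D G.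
Proof. by move=> h; congr cintegral; apply/funext. Qed.

Lemma cintegralD F G : ccontinuous F -> ccontinuous G ->
  cintegral D (fun t => F t + G t) = cintegral D F + cintegral D G.
Proof.
move=> [f1 f2] [g1 g2]; apply: complex_ext; rewrite ?ReD ?ImD /=.
  under eq_Rintegral do rewrite ReD.
  by rewrite RintegralD//; [exact: measurable_period|exact: continuous_integrable_period..].
under eq_Rintegral do rewrite ImD.
by rewrite RintegralD//; [exact: measurable_period|exact: continuous_integrable_period..].
Qed.

Lemma cintegralZ (a : R[i]) F : ccontinuous F ->
  cintegral D (fun t => a * F t) = a * cintegral D F.
Proof.
move=> [f1 f2]; have mD := measurable_period.
have cz (k : R) (f : R -> R) : continuous f -> continuous (fun t => k * f t).
  by move=> cf t; apply: continuousM; [exact: cvg_cst|exact: cf].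
apply: complex_ext; rewrite ?ReM ?ImM /=.
  under eq_Rintegral do rewrite ReM.
  by rewrite RintegralB//; [rewrite !RintegralZl//|..];
    apply: continuous_integrable_period => //; exact: cz.
under eq_Rintegral do rewrite ImM.
by rewrite RintegralD//; [rewrite !RintegralZl//|..];
    apply: continuous_integrable_period => //; exact: cz.
Qed.

Lemma cintegral_sum (J : Type) (s : seq J) (F : J -> R -> R[i]) :
  (forall j, ccontinuous (F j)) ->
  cintegral D (fun t => \sum_(j <- s) F j t) = \sum_(j <- s) cintegral D (F j).
Proof.
move=> h; elim: s => [|j s ih].
  rewrite big_nil; under eq_fun do rewrite big_nil.
  rewrite (_ : (fun=> 0) = (fun t : R => 0 * (fun=> 0 : R[i]) t)).
    by rewrite cintegralZ ?mul0r//; exact: ccontinuous_cst.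
  by apply/funext => t; rewrite mul0r.
under eq_fun do rewrite big_cons.
by rewrite cintegralD// ?ih ?big_cons//; exact: ccontinuous_sum.
Qed.

Lemma pi2_ge0 : 0 <= 2 * pi :> R. Proof. by rewrite mulr_ge0// pi_ge0. Qed.

Lemma Rintegral_bound (f : R -> R) e : continuous f -> (forall t, `|f t| <= e) ->
  `|\int[mu]_(t in D) f t| <= 2 * pi * e.
Proof.
move=> cf fe; have mD := measurable_period.
rewrite (le_trans (le_normr_Rintegral (mu:=@lebesgue_measure R) mD
  (continuous_integrable_period cf)))//.
rewrite (@le_trans _ _ (\int[mu]_(t in D) e))//.
  apply: le_Rintegral => //.
    apply: continuous_integrable_period => t.
    by apply: continuous_comp; [exact: cf|exact: norm_continuous].
  by apply: continuous_integrable_period => t; exact: cvg_cst.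
rewrite Rintegral_cst// mulrC.
have h : lebesgue_measure (D : set (measurableTypeR R)) = (2 * pi)%:E.
  rewrite /D lebesgue_measure_itv /= lte_fin.
  have := pi2_ge0; rewrite le_eqVlt => /orP[/eqP <-|->].
    by rewrite ltxx.
  by rewrite oppr0 addr0.
by rewrite (congr1 fine h : fine _ = _).
Qed.

Lemma cintegral_bound F e : ccontinuous F -> (forall t, cmod (F t) <= e) ->
  cmod (cintegral D F) <= 4 * pi * e.
Proof.
move=> [f1 f2] h; rewrite (le_trans (cmod_le_ReIm _))//=.
have -> : 4 * pi * e = 2 * pi * e + 2 * pi * e by ring.
rewrite lerD// Rintegral_bound// => t; apply: le_trans (h t);
  [exact: cmodRe|exact: cmodIm].
Qed.

(** Trigonometric monomials [e^(i m t)], with [m] possibly negative: on a circle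
    around [lam], the powers of [z - lam] become multiples of them. *)
Definition circ m (t : R) : R[i] := cos (m%:~R * t) +i* sin (m%:~R * t).

Lemma circD m k t : circ (m + k) t = circ m t * circ k t.
Proof.
rewrite /circ intrD mulrDl cosD sinD; apply: complex_ext => /=; ring.
Qed.

Lemma circ0 t : circ 0 t = 1.
Proof. by rewrite /circ mul0r cos0 sin0. Qed.

Lemma circ1 t : circ 1 t = cexp ('i * t%:C).
Proof. by rewrite cexp_Im0 /circ mul1r. Qed.

Lemma circN m t : circ (- m) t = (circ m t)^-1.
Proof.
have h : circ m t * circ (- m) t = 1 by rewrite -circD subrr circ0.
have m0 : circ m t != 0.
  by apply/eqP => e; move: h; rewrite e mul0r => /eqP; rewrite eq_sym oner_eq0.
by apply: (mulfI m0); rewrite h divff.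
Qed.

Lemma circX k t : circ 1 t ^+ k = circ k%:Z t.
Proof.
elim: k => [|k ih]; first by rewrite expr0 circ0.
by rewrite exprS ih -circD.
Qed.

Lemma cmod_circ m t : cmod (circ m t) = 1.
Proof. by rewrite /cmod normc_def /= cos2Dsin2 sqrtr1. Qed.

Lemma is_derive_scale (a t : R) : is_derive t 1 (fun x : R => a * x) a.
Proof.
have -> : (fun x : R => a * x) = a \*: (@id R) by [].
by apply: is_derive_eq; rewrite /GRing.scale /= mulr1.
Qed.

Lemma continuous_scale (a : R) : continuous (fun t : R => a * t).
Proof. by move=> t; apply: continuousM; [exact: cvg_cst|exact: cvg_id]. Qed.

Lemma ccontinuous_circ m : ccontinuous (circ m).
Proof.
split=> t /=.
  apply: (@continuous_comp _ _ _ (fun t : R => m%:~R * t) cos).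
    exact: continuous_scale.
  exact: continuous_cos.
apply: (@continuous_comp _ _ _ (fun t : R => m%:~R * t) sin).
  exact: continuous_scale.
exact: continuous_sin.
Qed.

Lemma Rintegral_FTC (f F : R -> R) : continuous f ->
  (forall t : R, is_derive t 1 F (f t)) ->
  \int[mu]_(t in D) f t = F (2 * pi) - F 0.
Proof.
move=> cf hF; have p0 : 0 < 2 * pi :> R by rewrite mulr_gt0// pi_gt0.
rewrite /Rintegral (continuous_FTC2 (F:=F) p0)//.
- exact: continuous_subspaceT.
- have dF t : derivable F t 1 by case: (hF t).
  have cF : continuous F by move=> t; apply/differentiable_continuous/derivable1_diffP.
  split=> [t _//||].
    exact: cvg_at_right_filter (cF _).
  exact: cvg_at_left_filter (cF _).
- by move=> t _; rewrite derive1E; case: (hF t).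
Qed.

Lemma cintegral_circ m : cintegral D (circ m) = (if m == 0 then 2 * pi else 0)%:C.
Proof.
have mD := measurable_period.
have [->|m0] := eqVneq m 0.
  rewrite (eq_cintegral (G:=fun=> 1)); last exact: circ0.
  apply: complex_ext => /=.
    by rewrite (@Rintegral_FTC (fun=> 1) id) ?subr0// => t; exact: cvg_cst.
  by rewrite (@Rintegral_FTC (fun=> 0) (fun=> 0)) ?subr0// => t; exact: cvg_cst.
have mR : (m%:~R : R) != 0 by rewrite intr_eq0.
have per : circ m (2 * pi) = 1.
  have per1 : circ 1 (2 * pi) = 1.
    by rewrite /circ mul1r mulrC mulr_natr cos2pi sin2pi.
  have pern k : circ k%:Z (2 * pi) = 1 by rewrite -circX per1 expr1n.
  by case: (intP m) => [|k|k]; rewrite ?circN pern ?invr1.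
have [perc pers] : cos (m%:~R * (2 * pi)) = 1 :> R /\ sin (m%:~R * (2 * pi)) = 0 :> R.
  by case: per.
have ds (t : R) : is_derive t 1 (fun t => m%:~R^-1 * sin (m%:~R * t)) (cos (m%:~R * t)).
  have h := is_derive1_comp (is_derive_sin (m%:~R * t)) (is_derive_scale m%:~R t).
  apply: is_derive_eq (is_deriveZ m%:~R^-1 h) _.
  by rewrite /GRing.scale /= mulrCA mulVf// mulr1.
have dc (t : R) : is_derive t 1 (fun t => - (m%:~R^-1 * cos (m%:~R * t))) (sin (m%:~R * t)).
  have h := is_derive1_comp (is_derive_cos (m%:~R * t)) (is_derive_scale m%:~R t).
  apply: is_derive_eq (is_deriveN (is_deriveZ m%:~R^-1 h)) _.
  by rewrite /GRing.scale /= mulNr mulrN opprK mulrCA mulVf// mulr1.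
have [cc cs] := ccontinuous_circ m.
apply: complex_ext => /=.
  by rewrite (Rintegral_FTC cc ds) pers !mulr0 sin0 mulr0 subrr.
by rewrite (Rintegral_FTC cs dc) perc !mulr0 cos0 subrr.
Qed.

Lemma continuous_uniform_approx (f : R -> R) :
  (forall e, 0 < e -> exists2 g, continuous g & forall t, `|f t - g t| <= e) ->
  continuous f.
Proof.
move=> h t; apply/cvgrPdist_le => e e0.
have e3 : 0 < e / 3 by rewrite divr_gt0.
have [g cg fg] := h _ e3.
have := cg t => /cvgrPdist_le /(_ _ e3) near_g.
near=> x.
have -> : f t - f x = (f t - g t) + ((g t - g x) + (g x - f x)) by ring.
have -> : e = e / 3 + (e / 3 + e / 3) by field.
rewrite (le_trans (ler_normD _ _))// lerD//.
rewrite (le_trans (ler_normD _ _))// lerD//; first by near: x.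
by rewrite distrC.
Unshelve. all: by end_near.
Qed.

Lemma ccontinuous_uniform_approx F :
  (forall e, 0 < e -> exists2 G, ccontinuous G & forall t, cmod (F t - G t) <= e) ->
  ccontinuous F.
Proof.
move=> h; split; apply: continuous_uniform_approx => e /h [G [g1 g2] FG].
  exists (fun t => complex.Re (G t)) => // t.
  by rewrite -ReB (le_trans (cmodRe _)).
exists (fun t => complex.Im (G t)) => // t.
by rewrite -ImB (le_trans (cmodIm _)).
Qed.

(** Residue computation: the analytic part is replaced by polynomials, whose
    circle integrals vanish exactly. *)
Lemma circle_integral_laurent (lam : R[i]) (delta r : R) (f h : R[i] -> R[i])
    (k : nat) (a : nat -> R[i]) : 0 < r <= delta ->
  poly_approx lam delta h ->
  (forall z, punctured lam delta z ->
     f z = \sum_(j < k.+1) a j / (z - lam) ^+ j.+1 + h z) ->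
  circle_integral lam r f = (2 * pi)%:C * 'i * a 0%N.
Proof.
move=> /andP[r0 rd] hh hf.
have rn0 : r%:C != 0 :> R[i] by rewrite -cmod_gt0 cmod_real gtr0_norm.
pose gam (t : R) : R[i] := lam + r%:C * circ 1 t.
have gamE t : gam t - lam = r%:C * circ 1 t by rewrite /gam addrC addKr.
have gam_p t : punctured lam delta (gam t).
  by rewrite /punctured gamE cmodM cmod_circ cmod_real gtr0_norm// mulr1 r0.
pose P (p : {poly R[i]}) t := p.[gam t - lam] * ('i * r%:C * circ 1 t).
have PE p t : P p t = \sum_(j < size p) p`_j * ('i * r%:C ^+ j.+1) * circ (j.+1%:Z) t.
  rewrite /P horner_coef mulr_suml; apply: eq_bigr => j _.
  by rewrite gamE -circX exprMn !exprS; ring.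
have cP p : ccontinuous (P p).
  rewrite (_ : P p = fun t => \sum_(j < size p) p`_j * ('i * r%:C ^+ j.+1) * circ (j.+1%:Z) t).
    by apply: ccontinuous_sum => j; apply: ccontinuousM;
      [exact: ccontinuous_cst|exact: ccontinuous_circ].
  by apply/funext => t; exact: PE.
have IP p : cintegral D (P p) = 0.
  rewrite (eq_cintegral (PE p)) cintegral_sum; last first.
    by move=> j; apply: ccontinuousM; [exact: ccontinuous_cst|exact: ccontinuous_circ].
  rewrite big1// => j _; rewrite cintegralZ; last exact: ccontinuous_circ.
  by rewrite cintegral_circ /= mulr0.
pose H t := h (gam t) * ('i * r%:C * circ 1 t).
have HP e p : (forall z, punctured lam delta z -> cmod (h z - p.[z - lam]) <= e) ->
    forall t, cmod (H t - P p t) <= e * r.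
  move=> hp t; rewrite /H /P -mulrBl cmodM ler_pM ?cmod_ge0 ?hp//.
  by rewrite !cmodM cmodi cmod_real cmod_circ gtr0_norm// mul1r mulr1.
have cH : ccontinuous H.
  apply: ccontinuous_uniform_approx => e e0.
  have [p hp] := hh (e / r) (divr_gt0 e0 r0); exists (P p) => // t.
  by have := HP _ _ hp t; rewrite divfK// gt_eqF.
have IH : cintegral D H = 0.
  apply/eqP; rewrite -cmod_eq0 eq_le cmod_ge0 andbT; apply/ler_addgt0Pr => e e0.
  rewrite add0r; have pi0 := pi_gt0 R.
  have c0 : 0 < 4 * pi * r by rewrite !mulr_gt0.
  have [p hp] := hh (e / (4 * pi * r)) (divr_gt0 e0 c0).
  have -> : cintegral D H = cintegral D (fun t => H t + -1 * P p t) + cintegral D (P p).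
    rewrite -cintegralD//; last first.
      by apply: ccontinuousD => //; apply: ccontinuousM => //; exact: ccontinuous_cst.
    by apply: eq_cintegral => t; rewrite mulN1r subrK.
  rewrite IP addr0 (le_trans (cintegral_bound (e:=e / (4 * pi * r) * r) _ _))//.
  - by apply: ccontinuousD => //; apply: ccontinuousM => //; exact: ccontinuous_cst.
  - by move=> t; rewrite mulN1r; exact: HP.
  rewrite [leLHS](_ : _ = e / (4 * pi * r) * (4 * pi * r)); last first.
    by rewrite mulrCA.
  by rewrite divfK// gt_eqF.
pose A (j : nat) t := a j * 'i * (r%:C ^+ j)^-1 * circ (- (j%:Z)) t.
have cA j : ccontinuous (A j).
  by apply: ccontinuousM; [exact: ccontinuous_cst|exact: ccontinuous_circ].
rewrite /circle_integral.
rewrite (@eq_cintegral _ (fun t => \sum_(j < k.+1) A j t + H t)); last first.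
  move=> t; rewrite -circ1 -/(gam t) hf// mulrDl; congr (_ + _).
  rewrite mulr_suml; apply: eq_bigr => j _.
  rewrite /A gamE circN -circX exprMn invfM !exprS.
  have c0 : circ 1 t != 0 by rewrite -cmod_gt0 cmod_circ.
  move: (circ 1 t) c0 => w c0; move: (r%:C) rn0 => q q0.
  by field; rewrite ?q0 ?c0 ?expf_neq0.
rewrite cintegralD//; last exact: ccontinuous_sum.
rewrite IH addr0 cintegral_sum// big_ord_recl big1 ?addr0; last first.
  move=> j _; rewrite cintegralZ; last exact: ccontinuous_circ.
  by rewrite cintegral_circ /= mulr0.
rewrite cintegralZ; last exact: ccontinuous_circ.
rewrite cintegral_circ /= expr0 invr1 mulr1; ring.
Qed.

End CircleIntegral.

(** * Wave functions as families of amplitudes *)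

Section WaveFunctions.
Variable R : realType.
Implicit Types (u v : wavefn R) (f : (site * 'I_4)%type -> R[i]) (K : R).

Notation index := (site * 'I_4)%type.

Definition amplitude u (p : index) : R[i] := u p.1 p.2 0.

Definition of_amplitude f : wavefn R := fun x => \col_j f (x, j).

Lemma of_amplitudeK f : amplitude (of_amplitude f) = f.
Proof. by apply/funext => -[x j]; rewrite /amplitude mxE. Qed.

Lemma amplitudeK u : of_amplitude (amplitude u) = u.
Proof.
by apply/funext => x; apply/matrixP => j k; rewrite mxE ord1.
Qed.

Lemma amplitude_inj : injective amplitude.
Proof. exact: can_inj amplitudeK. Qed.

Lemma amplitudeD u v : amplitude (u + v) = fun p => amplitude u p + amplitude v p.
Proof. by apply/funext => p; rewrite /amplitude !mxE. Qed.

Lemma amplitudeB u v : amplitude (u - v) = fun p => amplitude u p - amplitude v p.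
Proof. by apply/funext => p; rewrite /amplitude !mxE. Qed.

Lemma amplitudeZ (a : R[i]) u : amplitude (a *: u) = fun p => a * amplitude u p.
Proof. by apply/funext => p; rewrite /amplitude !mxE. Qed.

Lemma amplitude0 : amplitude 0 = fun=> 0.
Proof. by apply/funext => p; rewrite /amplitude mxE. Qed.

Lemma sum_le_subset (T : eqType) (s t : seq T) (F : T -> R) :
  (forall x, 0 <= F x) -> uniq s -> uniq t -> {subset s <= t} ->
  \sum_(x <- s) F x <= \sum_(x <- t) F x.
Proof.
move=> F0 us ut st; rewrite [leRHS](bigID (mem s)) /= -[X in _ <= X + _]big_filter.
rewrite (perm_big [seq x <- t | x \in s]) /= ?lerDl ?sumr_ge0//.
apply: uniq_perm => //; first exact: filter_uniq.
move=> x; rewrite mem_filter; case: (boolP (x \in s)) => //= /st ->.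
by [].
Qed.

Lemma sum_site_index (s : seq site) (F : index -> R) :
  \sum_(x <- s) \sum_(j < 4) F (x, j) =
  \sum_(p <- [seq (x, j) | x <- s, j <- enum 'I_4]) F p.
Proof.
rewrite big_allpairs; apply: eq_bigr => x _.
by rewrite big_enum.
Qed.

Lemma norm2_le u K : (norm2 u <= K%:E)%E <-> sqsum_le (amplitude u) K.
Proof.
split=> h.
  move=> s us.
  pose X := undup [seq p.1 | p <- s].
  have uX : uniq [seq (x, j) | x <- X, j <- enum 'I_4].
    apply: allpairs_uniq; [exact: undup_uniq|exact: enum_uniq|].
    by move=> [x j] [y k] _ _ /=.
  apply: (@le_trans _ _ (\sum_(p <- [seq (x, j) | x <- X, j <- enum 'I_4])
      cmod (amplitude u p) ^+ 2)).
    apply: sum_le_subset => //; first by move=> p; rewrite exprn_ge0// cmod_ge0.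
    move=> [x j] sx; apply: allpairs_f; last by rewrite mem_enum.
    by rewrite mem_undup; apply/mapP; exists (x, j).
  rewrite -sum_site_index -lee_fin; apply: le_trans h.
  apply: esum_ge; exists [set` X]; first by split.
  rewrite -fsbig_seq ?undup_uniq//= sumEFin lee_fin.
  by [].
apply: ge_ereal_sup => _ [A [fA _] <-].
rewrite fsbig_finite//= sumEFin lee_fin.
rewrite (sum_site_index _ (fun p => cmod (amplitude u p) ^+ 2)) h//.
apply: allpairs_uniq; [exact: finmap.fset_uniq|exact: enum_uniq|].
by move=> [x j] [y k] _ _ /=.
Qed.

Lemma norm2_ge0 u : (0 <= norm2 u)%E.
Proof.
apply: esum_ge0 => x _; rewrite lee_fin; apply: sumr_ge0 => j _.
by rewrite exprn_ge0// cmod_ge0.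
Qed.

Lemma norm2_fin u : ell2 u -> exists2 K, norm2 u = K%:E & 0 <= K.
Proof.
move=> hu; have := norm2_ge0 u; move: hu; rewrite /ell2 /=.
case: (norm2 u) => //= K _ K0; by exists K.
Qed.

Lemma ell2P u : ell2 u <-> sq_summable (amplitude u).
Proof.
split=> [/norm2_fin[K hK _]|[K /norm2_le hK]].
  by exists K; apply/norm2_le; rewrite hK.
by apply: le_lt_trans hK _; rewrite ltry.
Qed.

End WaveFunctions.

(** * Dimension of a space with finite-dimensional coordinates *)

Section Dimension.
Variable R : realType.

Lemma has_dim_row_space (V : lmodType R[i]) (E : set V) n
    (P : V -> 'rV[R[i]]_n) (K : 'M[R[i]]_n) :
  E 0 -> (forall (a : R[i]) u v, E u -> E v -> E (a *: u + v)) ->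
  (forall (a : R[i]) u v, P (a *: u + v) = a *: P u + P v) ->
  (forall u, E u -> P u = 0 -> u = 0) ->
  (forall u, E u -> (P u <= K)%MS) ->
  (forall w, (w <= K)%MS -> exists2 u, E u & P u = w) ->
  has_dim E (\rank K).
Proof.
move=> E0 Elin Plin Pinj PK Psurj.
have PD u v : P (u + v) = P u + P v.
  by rewrite -[u in LHS]scale1r Plin scale1r.
have P0 : P 0 = 0.
  by apply: (addrI (P 0)); rewrite -PD !addr0.
have PZ a u : P (a *: u) = a *: P u by rewrite -[a *: u]addr0 Plin P0 addr0.
have [e he] : {e : 'I_(\rank K) -> V & forall i, E (e i) /\ P (e i) = row i (row_base K)}.
  apply: (@choice _ _ (fun i u => E u /\ P u = row i (row_base K))) => i.
  have [|u Eu Pu] := Psurj (row i (row_base K)); last by exists u.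
  by rewrite (submx_trans (row_sub _ _))// eq_row_base.
have EZ (a : R[i]) u : E u -> E (a *: u) by move=> Eu; rewrite -[a *: u]addr0; exact: Elin.
have Esum (c : 'I_(\rank K) -> R[i]) : E (\sum_i c i *: e i).
  elim/big_ind : _ => [//|u v Eu Ev|i _]; last by apply: EZ; exact: (he i).1.
  by rewrite -[u]scale1r; exact: Elin.
have Psum (c : 'I_(\rank K) -> R[i]) :
    P (\sum_i c i *: e i) = (\row_i c i) *m row_base K.
  rewrite (big_morph P PD P0) mulmx_sum_row; apply: eq_bigr => i _.
  by rewrite PZ (he i).2 mxE.
exists e; split.
  move=> c c0; have := Psum c; rewrite c0 P0 => /esym h.
  have : \row_i c i = 0.
    by apply: (row_free_inj (row_base_free K)); rewrite h mul0mx.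
  by move=> /rowP h' i; have := h' i; rewrite !mxE.
apply/seteqP; split=> [u Eu|_ [c ->]]; last exact: Esum.
have : (P u <= row_base K)%MS by rewrite eq_row_base; exact: PK.
move=> /submxP[d hd]; exists (fun i => d 0 i).
apply/eqP; rewrite -subr_eq0; apply/eqP; apply: Pinj.
  rewrite addrC -scaleN1r; apply: Elin => //; exact: Esum.
rewrite -[- _]scaleN1r addrC Plin Psum scaleN1r hd.
suff -> : \row_i d 0 i = d by rewrite addNr.
by apply/rowP => i; rewrite mxE.
Qed.

End Dimension.

(** * Spectrum and algebraic multiplicities of the perturbed shift *)

Section OperatorSpectrum.
Variable R : realType.
Notation index := (site * 'I_4)%type.
Variables (sigma tau : index -> index).
Hypothesis tauK : cancel tau sigma.
Variables (n : nat) (iota : 'I_n.+1 -> index).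
Hypothesis iota_inj : injective iota.
Variables (c : R[i]) (W : 'I_n.+1 -> index -> R[i]).
Hypothesis W_supp : forall i p, W i p != 0 -> in_core iota (tau p).
Hypothesis no_reentry : forall p, downstream tau iota p -> ~ in_core iota p ->
  ~ in_core iota (sigma p).
Variable A : operator R.
Hypothesis A_amplitude : forall u,
  amplitude (A u) = perturbed_shift tau iota c W (amplitude u).

Implicit Types (u v : wavefn R) (z lam : R[i]).

Let B := core_mx tau iota c W.
Let L := minus_scalar tau iota c W.
Let Rz := core_resolvent tau iota c W.

Lemma amplitude_minus z v : amplitude (A v - z *: v) = L z (amplitude v).
Proof. by rewrite amplitudeB A_amplitude amplitudeZ. Qed.

Lemma eigenvalueNunit z : eigenvalue B z = (B - z%:M \notin unitmx).
Proof.
rewrite /eigenvalue /eigenspace kermx_eq0 row_free_unit//.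
Qed.

Lemma ell2_minus z v : ell2 v -> ell2 (A v - z *: v).
Proof.
move=> /ell2P hv; apply/ell2P; rewrite amplitude_minus.
exact: (sq_summable_minus_scalar tauK c W_supp z hv).
Qed.

(** An eigenvector of the operator is downstream and determined by its values on
    the core, and those of the matrix lift. *)
Lemma point_spectrum_core z : cmod c < cmod z ->
  point_spectrum A z <-> eigenvalue B z.
Proof.
move=> cz; split.
  move=> [u [/ell2P su hu] u0].
  rewrite eigenvalueNunit; apply/negP => zu; apply: u0.
  apply: amplitude_inj; rewrite amplitude0.
  apply: (minus_scalar_unit_inj tauK iota_inj W_supp no_reentry cz zu su).
    exact: sq_summable0.
  by rewrite minus_scalar0 -[LHS]amplitude_minus hu subrr amplitude0.
move=> /eigenvalueP [w hw w0].
have hw' : w *m (B - z%:M) ^+ 1 = 0.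
  by rewrite expr1 mulmxBr hw mul_mx_scalar subrr.
have [f [sf hf rf]] := generalized_kernel_surj tauK iota_inj W_supp no_reentry cz hw'.
exists (of_amplitude f).
  split; first by apply/ell2P; rewrite of_amplitudeK.
  apply/eqP; rewrite -subr_eq0; apply/eqP; apply: amplitude_inj.
  by rewrite amplitude_minus of_amplitudeK amplitude0.
move=> f0; move/eqP: w0; apply; rewrite -rf.
apply/rowP => i; rewrite !mxE -[f]of_amplitudeK f0.
by rewrite /amplitude mxE.
Qed.

Lemma resolvent_unique z u v w : cmod c < cmod z -> ~~ eigenvalue B z ->
  ell2 u -> ell2 v -> ell2 w -> A v - z *: v = u -> A w - z *: w = u -> v = w.
Proof.
rewrite eigenvalueNunit negbK => cz zu _ /ell2P sv /ell2P sw hv hw.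
apply: amplitude_inj.
apply: (minus_scalar_unit_inj tauK iota_inj W_supp no_reentry cz zu sv sw).
by rewrite -[LHS]amplitude_minus -[RHS]amplitude_minus hv hw.
Qed.

Lemma core_resolvent_ell2 z u : cmod c < cmod z -> ~~ eigenvalue B z ->
  ell2 u -> ell2 (of_amplitude (Rz z (amplitude u))) /\
  A (of_amplitude (Rz z (amplitude u))) - z *: of_amplitude (Rz z (amplitude u)) = u.
Proof.
rewrite eigenvalueNunit negbK => cz zu /ell2P su; split.
  apply/ell2P; rewrite of_amplitudeK.
  exact: (sq_summable_core_resolvent tauK W_supp cz su).
apply: amplitude_inj; rewrite amplitude_minus of_amplitudeK.
exact: (core_resolventP tauK iota_inj W_supp no_reentry cz zu su).
Qed.

Lemma resolventE z u v : cmod c < cmod z -> ~~ eigenvalue B z ->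
  ell2 u -> ell2 v -> A v - z *: v = u -> resolvent A z u = v.
Proof.
move=> cz zu su sv hv; apply: xget_unique => // w [sw hw].
exact: (resolvent_unique cz zu su).
Qed.

Lemma resolvent_set_core z : cmod c < cmod z -> ~~ eigenvalue B z ->
  resolvent_set A z.
Proof.
move=> cz zu; split; first by move=> v; exact: ell2_minus.
split.
  move=> u su; have [s1 s2] := core_resolvent_ell2 cz zu su.
  exists (of_amplitude (Rz z (amplitude u))); split=> // v [sv hv].
  exact: (resolvent_unique cz zu su).
have [M M0 hM] := op_bounded_core_resolvent tauK W_supp cz.
exists M => v sv.
have su := ell2_minus z sv.
have [K hK K0] := norm2_fin su.
have [s1 s2] := core_resolvent_ell2 cz zu su.
rewrite hK -EFinM; apply/norm2_le.
rewrite (resolvent_unique cz zu su sv s1 erefl s2) of_amplitudeK.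
by apply: hM; apply/norm2_le; rewrite hK.
Qed.

Section Multiplicity.
Variable lam : R[i].
Hypothesis lam_gt : cmod c < cmod lam.

Lemma isolated_delta : exists2 delta, 0 < delta &
  cmod c + delta < cmod lam /\
  forall x, eigenvalue B x -> x != lam -> delta < cmod (x - lam).
Proof.
have [rs hrs] := closed_field_poly_normal (char_poly B).
rewrite (monicP (char_poly_monic B)) scale1r in hrs.
pose d0 := (cmod lam - cmod c) / 2.
have d00 : 0 < d0 by rewrite divr_gt0// subr_gt0.
suff [delta d1 [d2 d3]] : exists2 delta, 0 < delta & delta <= d0 /\
    forall x, x \in rs -> x != lam -> delta < cmod (x - lam).
  exists delta => //; split.
    rewrite (le_lt_trans (y:=cmod c + d0)) ?lerD2l//.
    rewrite -ltrBrDl ltr_pdivrMr// mulr_natr mulr2n ltrDl subr_gt0//.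
  by move=> x; rewrite eigenvalue_root_char hrs root_prod_XsubC; exact: d3.
elim: (rs) => [|x s [delta d1 [d2 d3]]]; first by exists d0.
have [->|xl] := eqVneq x lam.
  exists delta => //; split=> // y; rewrite in_cons => /orP[/eqP ->|]; last exact: d3.
  by rewrite eqxx.
have x0 : 0 < cmod (x - lam) by rewrite cmod_gt0 subr_eq0.
exists (Num.min delta (cmod (x - lam) / 2)).
  by rewrite lt_min d1 divr_gt0.
split; first by rewrite ge_min d2.
move=> y; rewrite in_cons => /orP[/eqP -> _|ys yl]; last first.
  by rewrite gt_min d3.
by rewrite gt_min; apply/orP; right; rewrite ltr_pdivrMr// mulr_natr mulr2n ltrDl.
Qed.

Variable delta : R.
Hypothesis delta_small : cmod c + delta < cmod lam.
Hypothesis lam_isolated : forall x, eigenvalue B x -> x != lam -> delta < cmod (x - lam).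

Lemma punctured_regular z : punctured lam delta z ->
  cmod c < cmod z /\ ~~ eigenvalue B z.
Proof.
move=> hz; split; first exact: (punctured_gt_c delta_small).
move: hz => /andP[z0 zd]; apply/negP => /lam_isolated h.
have zl : z != lam by rewrite -subr_eq0 -cmod_gt0.
by have := lt_le_trans (h zl) zd; rewrite ltxx.
Qed.

Let k := n.+1.

(** Along the Fitting decomposition [u = e + (A - lam)^k g], the component [e] is
    killed by a power of [A - lam] and gives a finite sum of negative powers of
    [z - lam], while [(A - lam)^k] applied to [g] cancels the poles of the
    resolvent. *)
Lemma resolvent_expansion z (e g : index -> R[i]) : punctured lam delta z ->
  sq_summable e -> sq_summable g -> iter k (L lam) e = (fun=> 0) ->
  amplitude (resolvent A z (of_amplitude (fun p => e p + iter k (L lam) g p))) =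
  fun p => \sum_(j < k) (- iter j (L lam) e p) / (z - lam) ^+ j.+1 +
    (\sum_(j < k) (z - lam) ^+ j * iter (k.-1 - j) (L lam) g p +
     (z - lam) ^+ k * Rz z g p).
Proof.
move=> hz se sg he.
have [cz zu] := punctured_regular hz.
have w0 : z - lam != 0 by case/andP: hz; rewrite cmod_gt0.
have s_iter j f : sq_summable f -> sq_summable (iter j (L lam) f).
  exact: (sq_summable_iter tauK c W_supp).
have LzE f p : L z f p = L lam f p - (z - lam) * f p.
  by rewrite /L /minus_scalar; ring.
have L_sum m (F : 'I_m -> index -> R[i]) p : L lam (fun q => \sum_(j < m) F j q) p =
   \sum_(j < m) L lam (F j) p.
  elim: m F => [|m ih] F.
    rewrite big_ord0; under [X in L _ X]eq_fun do rewrite big_ord0.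
    by rewrite /L minus_scalar0.
  rewrite big_ord_recr; under [X in L _ X]eq_fun do rewrite big_ord_recr.
  by rewrite /L minus_scalarD -/L ih.
have L_scale (a : R[i]) f p : L lam (fun q => a * f q) p = a * L lam f p.
  by rewrite /L minus_scalarZ.
pose v1 p := \sum_(j < k) (- ((z - lam) ^+ j.+1)^-1) * iter j (L lam) e p.
pose v2 p := \sum_(j < k) (z - lam) ^+ j * iter (k.-1 - j) (L lam) g p.
pose v3 p := (z - lam) ^+ k * Rz z g p.
have sv : sq_summable (fun p => v1 p + (v2 p + v3 p)).
  apply: sq_summableD; last apply: sq_summableD.
  - by apply: sq_summable_sum => j; apply: sq_summableZ; exact: s_iter.
  - by apply: sq_summable_sum => j; apply: sq_summableZ; exact: s_iter.
  - by apply: sq_summableZ; exact: (sq_summable_core_resolvent tauK W_supp cz sg).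
have Lv1 p : L z v1 p = e p.
  rewrite LzE L_sum; under eq_bigr do rewrite L_scale -iterS.
  pose T j := - ((z - lam) ^+ j)^-1 * iter j (L lam) e p.
  rewrite /v1 mulr_sumr -sumrB (eq_bigr (fun j : 'I_k => - (T j - T j.+1))).
    rewrite sumrN -[\sum_(i < k) _](big_mkord xpredT (fun j => T j - T j.+1)).
    rewrite (eq_bigr (fun j => - (T j.+1 - T j))) ?sumrN ?telescope_sumr//.
      by rewrite /T he expr0 invr1 mulN1r mulr0 opprK sub0r opprK.
    by move=> j _; rewrite opprB.
  move=> j _; rewrite /T !exprS iterS; field.
  by rewrite w0 expf_neq0.
have Lv23 p : L z v2 p + L z v3 p = iter k (L lam) g p.
  have -> : L z v3 p = (z - lam) ^+ k * g p.
    rewrite /L minus_scalarZ; congr (_ * _).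
    rewrite eigenvalueNunit negbK in zu.
    by rewrite /Rz (core_resolventP tauK iota_inj W_supp no_reentry cz zu sg).
  rewrite LzE L_sum; under eq_bigr do rewrite L_scale -iterS.
  pose T j := (z - lam) ^+ j * iter (k - j) (L lam) g p.
  rewrite /v2 mulr_sumr -sumrB (eq_bigr (fun j : 'I_k => - (T j.+1 - T j))).
    rewrite sumrN -[\sum_(i < k) _](big_mkord xpredT (fun j => T j.+1 - T j)).
    rewrite telescope_sumr// /T expr0 mul1r subn0 subnn /=; ring.
  move=> j _; rewrite /T exprS.
  have jk : (j <= k.-1)%N by rewrite -ltnS.
  have -> : (k - j = (k.-1 - j).+1)%N by rewrite -subSn.
  by rewrite subSS; ring.
pose v := of_amplitude (fun p => v1 p + (v2 p + v3 p)).
rewrite (@resolventE z _ v cz zu).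
- rewrite of_amplitudeK; apply/funext => p; congr (_ + _).
  by apply: eq_bigr => j _; rewrite !mulNr mulrC.
- by apply/ell2P; rewrite of_amplitudeK; apply: sq_summableD => //; exact: s_iter.
- by apply/ell2P; rewrite of_amplitudeK.
apply: amplitude_inj; rewrite amplitude_minus !of_amplitudeK.
apply/funext => p; rewrite {1}/L minus_scalarD minus_scalarD -/L.
by rewrite Lv1 Lv23.
Qed.

Lemma W_bound : exists KW, forall i, bounded_by (W i) KW.
Proof.
have h i : exists K, bounded_by (W i) K.
  rewrite (spread_delta W i).
  have [K _ hK] := sq_summable_bounded (sq_summable_spread tauK W_supp (delta_mx 0 i)).
  by exists K.
have [K hK] := choice h.
exists (\sum_i `|K i|) => i p; rewrite (le_trans (hK i p))// (le_trans (ler_norm _))//.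
by rewrite (bigD1 i)//= lerDl sumr_ge0.
Qed.

(** In the expansion of the resolvent, only the coefficient [- e] of
    [1 / (z - lam)] contributes to the circle integral. *)
Lemma riesz_projection_fitting r (e g : index -> R[i]) : 0 < r <= delta ->
  sq_summable e -> sq_summable g -> iter k (L lam) e = (fun=> 0) ->
  riesz_projection A lam r (of_amplitude (fun p => e p + iter k (L lam) g p)) =
  of_amplitude e.
Proof.
move=> hr se sg he; apply/funext => x; apply/matrixP => j j'; rewrite !mxE.
pose p : index := (x, j).
have [K _ gK] := sq_summable_bounded sg.
have [KW hKW] := W_bound.
set u := of_amplitude (fun p => e p + _).
rewrite (@circle_integral_laurent R lam delta r _
  (fun z => \sum_(i < k) (z - lam) ^+ i * iter (k.-1 - i) (L lam) g p +
     (z - lam) ^+ k * Rz z g p) n (fun i => - iter i (L lam) e p))//.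
- rewrite /= mulrN -mulrA mulrA; set q := (_ * 'i).
  have q0 : q != 0.
    rewrite -cmod_gt0 /q cmodM cmodi mulr1 cmod_real normr_gt0 mulf_neq0//.
    by rewrite gt_eqF// pi_gt0.
  by rewrite mulrN mulNr opprK mulrA mulVf// mul1r.
- apply: poly_approxD.
    apply: poly_approx_sum => i; apply: poly_approxM; last exact: poly_approx_cst.
    by apply: poly_approxX; exact: poly_approx_shift.
  exact: (poly_approx_core_resolvent delta_small hKW lam_isolated p gK).
move=> z hz; rewrite -[LHS]/(amplitude (resolvent A z u) p).
by rewrite resolvent_expansion.
Qed.

Lemma riesz_range r : 0 < r <= delta ->
  [set riesz_projection A lam r u | u in @ell2 R] =
  [set u | ell2 u /\ iter k (L lam) (amplitude u) = fun=> 0].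
Proof.
move=> hr; apply/seteqP; split.
  move=> _ [u /ell2P su <-].
  have [e [g [se sg he hu]]] := fitting_decomposition tauK iota_inj W_supp no_reentry lam_gt su.
  rewrite -[u]amplitudeK hu riesz_projection_fitting//; split.
    by apply/ell2P; rewrite of_amplitudeK.
  by rewrite of_amplitudeK.
move=> u [su hu]; exists u => //.
have := riesz_projection_fitting hr (proj1 (ell2P u) su) (sq_summable0 R _) hu.
rewrite amplitudeK => h; rewrite -[RHS]h; congr riesz_projection.
apply: amplitude_inj; rewrite of_amplitudeK; apply/funext => p.
by rewrite (iter_minus_scalar0 tau iota c W) addr0.
Qed.

Lemma has_dim_riesz_range r : 0 < r <= delta ->
  has_dim [set riesz_projection A lam r u | u in @ell2 R]
    (\rank (kermx ((B - lam%:M) ^+ k))).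
Proof.
move=> hr; rewrite riesz_range//.
pose P (u : wavefn R) := restrict_core iota (amplitude u).
apply: (@has_dim_row_space _ _ _ _ P).
- split; first by apply/ell2P; rewrite amplitude0; exact: sq_summable0.
  by rewrite amplitude0 (iter_minus_scalar0 tau iota c W).
- move=> a u v [/ell2P su hu] [/ell2P sv hv]; split.
    by apply/ell2P; rewrite amplitudeD amplitudeZ; apply: sq_summableD => //; exact: sq_summableZ.
  rewrite amplitudeD amplitudeZ (iter_minus_scalarD tau iota c W) hv.
  suff -> : iter k (L lam) (fun p => a * amplitude u p) =
      fun p => a * iter k (L lam) (amplitude u) p.
    by rewrite hu; apply/funext => p; rewrite mulr0 addr0.
  elim: (k) => //= m ->; by rewrite /L minus_scalarZ.
- by move=> a u v; apply/rowP => i; rewrite !mxE amplitudeD amplitudeZ.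
- move=> u [/ell2P su hu] Pu; apply: amplitude_inj; rewrite amplitude0.
  exact: (generalized_kernel_inj tauK iota_inj W_supp no_reentry lam_gt su hu Pu).
- move=> u [/ell2P su hu]; apply/sub_kermxP; rewrite /P.
  have su' : supp_downstream tau iota (amplitude u).
    apply: (supp_of_iter tauK W_supp lam_gt su (k:=k)).
    by rewrite -/(L lam) hu.
  rewrite -(restrict_iter tauK iota_inj c W_supp no_reentry _ k su').
  by rewrite -/(L lam) hu; apply/rowP => i; rewrite !mxE.
- move=> w /sub_kermxP hw.
  have [f [sf hf rf]] := generalized_kernel_surj tauK iota_inj W_supp no_reentry lam_gt hw.
  exists (of_amplitude f); last by rewrite /P of_amplitudeK.
  by split; [apply/ell2P|]; rewrite of_amplitudeK.
Qed.

End Multiplicity.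

(** The range of the Riesz projection is the kernel of [(A - lam)^(n+1)], which
    restriction to the core identifies with a generalized eigenspace of [B]. *)
Lemma algebraic_multiplicity_core lam : cmod c < cmod lam -> eigenvalue B lam ->
  algebraic_multiplicity A lam (\rank (kermx ((B - lam%:M) ^+ n.+1))).
Proof.
move=> cl el; split; first exact/point_spectrum_core.
have [d d0 [d1 d2]] := isolated_delta cl.
exists d => //; split.
  move=> z /andP[z0 zd].
  have [cz zu] := @punctured_regular lam d d1 d2 z (introT andP (conj z0 (ltW zd))).
  exact: resolvent_set_core.
move=> r /andP[r0 rd]; apply: (has_dim_riesz_range cl d1 d2).
by rewrite r0 ltW.
Qed.

End OperatorSpectrum.

(** * Eigenvalues of perturbed diagonal matrices *)

Section DiagonalPerturbation.
Variables (R : realType) (n : nat).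
Implicit Types (d v w : 'rV[R[i]]_n.+1) (E M : 'M[R[i]]_n.+1) (e K : R)
  (x lam : R[i]) (ls s : seq R[i]).

Definition entries_le E e := forall i j, cmod (E i j) <= e.

Lemma row_max v : exists j, forall i, cmod (v 0 i) <= cmod (v 0 j).
Proof.
have [j _ hj] := @arg_maxP _ _ _ ord0 xpredT (fun j => cmod (v 0 j)) isT.
by exists j => i; exact: hj.
Qed.

Lemma row_max_gt0 v : v != 0 -> exists2 j, 0 < cmod (v 0 j) &
  forall i, cmod (v 0 i) <= cmod (v 0 j).
Proof.
move=> v0; have [j hj] := row_max v; exists j => //.
rewrite lt_def cmod_ge0 andbT; apply: contraNneq v0 => vj.
apply/eqP/rowP => i; rewrite mxE; apply/eqP; rewrite -cmod_eq0 eq_le cmod_ge0.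
by rewrite -vj hj.
Qed.

Lemma mulmx_row_le v E e m : 0 <= e -> (forall i, cmod (v 0 i) <= m) ->
  entries_le E e -> forall j, cmod ((v *m E) 0 j) <= n.+1%:R * (m * e).
Proof.
move=> e0 vm Ee j; rewrite mxE (le_trans (cmod_sum _ _ _))//.
rewrite -[n.+1 in leRHS]card_ord mulr_natl -sumr_const; apply: ler_sum => i _.
by rewrite cmodM ler_pM ?cmod_ge0.
Qed.

Lemma mulmx_diagE v d x j : (v *m (diag_mx d - x%:M)) 0 j = v 0 j * (d 0 j - x).
Proof.
by rewrite mulmxBr mul_mx_scalar mul_mx_diag !mxE; ring.
Qed.

(** Gershgorin's argument: compare both sides of the eigenvalue equation at an
    entry of largest modulus of the eigenvector. *)
Lemma gershgorin d E e x : 0 <= e -> entries_le E e ->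
  eigenvalue (diag_mx d + E) x -> exists j, cmod (x - d 0 j) <= n.+1%:R * e.
Proof.
move=> e0 Ee /eigenvalueP[v hv v0].
have [j vj hj] := row_max_gt0 v0; exists j.
rewrite -(ler_pM2l vj) -cmodM.
have -> : v 0 j * (x - d 0 j) = (v *m E) 0 j.
  have /rowP/(_ j) := hv; rewrite mulmxDr mul_mx_diag !mxE => h.
  by rewrite mulrBr [v 0 j * x]mulrC -h; ring.
by rewrite mulrCA; exact: mulmx_row_le.
Qed.

Definition apply_factors M v ls := foldl (fun w x => w *m (M - x%:M)) v ls.

Lemma apply_factorsD M v w ls :
  apply_factors M (v + w) ls = apply_factors M v ls + apply_factors M w ls.
Proof. by elim: ls v w => //= x ls ih v w; rewrite mulmxDl ih. Qed.

Lemma apply_factors_horner M v ls :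
  apply_factors M v ls = v *m horner_mx M (\prod_(x <- ls) ('X - x%:P)).
Proof.
elim: ls v => [|x ls ih] v; first by rewrite big_nil rmorph1 mulmx1.
rewrite /= ih big_cons rmorphM /= rmorphB /= horner_mx_X horner_mx_C.
by rewrite -mulmxE mulmxA.
Qed.

(** The recursion is the one that the proof of [apply_factors_le] produces; the
    constant is the same for all matrices of a given size. *)
Fixpoint factor_const K (k : nat) : R :=
  if k is k'.+1 then factor_const K k' * K + (K ^+ k' + factor_const K k') * n.+1%:R
  else 0.

Lemma factor_const_ge0 K k : 0 <= K -> 0 <= factor_const K k.
Proof.
move=> K0; elim: k => //= k ih.
by rewrite addr_ge0 ?mulr_ge0 ?addr_ge0 ?exprn_ge0.
Qed.

Lemma apply_factors_le d E e K ls v m : 0 <= e <= 1 -> 0 <= K ->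
  entries_le E e -> (forall j x, x \in ls -> cmod (d 0 j - x) <= K) ->
  (forall i, cmod (v 0 i) <= m) ->
  forall j, cmod (apply_factors (diag_mx d + E) v ls 0 j -
                  v 0 j * \prod_(x <- ls) (d 0 j - x)) <=
            e * factor_const K (size ls) * m.
Proof.
move=> /andP[e0 e1] K0 Ee.
elim: ls v m => [|x ls ih] v m dK vm j.
  by rewrite big_nil mulr1 subrr cmod0 /= mulr0 mul0r.
have m0 : 0 <= m by rewrite (le_trans _ (vm j))// cmod_ge0.
have dK' i y : y \in ls -> cmod (d 0 i - y) <= K.
  by move=> yl; apply: dK; rewrite in_cons yl orbT.
rewrite /= (_ : v *m (diag_mx d + E - x%:M) = v *m (diag_mx d - x%:M) + v *m E); last first.
  by rewrite -mulmxDr addrAC.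
rewrite apply_factorsD mxE big_cons mulrA -mulmx_diagE.
have vE := mulmx_row_le e0 vm Ee.
have vD i : cmod ((v *m (diag_mx d - x%:M)) 0 i) <= m * K.
  by rewrite mulmx_diagE cmodM ler_pM ?cmod_ge0// dK// mem_head.
have h1 := ih _ _ dK' vD j.
have h2 := ih _ _ dK' vE j.
set c := factor_const K (size ls) in h1 h2 *.
have c0 : 0 <= c by exact: factor_const_ge0.
have pK : cmod (\prod_(y <- ls) (d 0 j - y)) <= K ^+ size ls.
  rewrite cmod_prod; elim: (ls) dK' => [|y s ihs] hs; first by rewrite big_nil expr0.
  rewrite big_cons exprS ler_pM ?cmod_ge0//.
  - by apply: prodr_ge0 => z _; exact: cmod_ge0.
  - by apply: hs; rewrite mem_head.
  - by apply: ihs => i z zs; apply: hs; rewrite in_cons zs orbT.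
have h3 : cmod (apply_factors (diag_mx d + E) (v *m E) ls 0 j) <=
   (K ^+ size ls + c) * (n.+1%:R * (m * e)).
  rewrite -[X in cmod X](subrK ((v *m E) 0 j * \prod_(y <- ls) (d 0 j - y))).
  rewrite (le_trans (cmodD _ _))// addrC mulrDl lerD//.
    by rewrite cmodM mulrC ler_pM ?cmod_ge0.
  apply: le_trans h2 _; rewrite ler_wpM2r ?mulr_ge0//.
  by rewrite ler_piMl.
rewrite addrAC (le_trans (cmodD _ _))// (le_trans (lerD h1 h3))//.
by rewrite le_eqVlt; apply/orP; left; apply/eqP; ring.
Qed.

(** On a vector supported where the diagonal stays away from the roots, the
    product of the unperturbed factors is bounded below, and the perturbation is
    too small to make it vanish. *)
Lemma apply_factors_neq0 d E e K eta ls v : 0 <= e <= 1 -> 0 <= K -> 0 <= eta ->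
  entries_le E e -> (forall j x, x \in ls -> cmod (d 0 j - x) <= K) ->
  (forall j x, v 0 j != 0 -> x \in ls -> eta <= cmod (d 0 j - x)) ->
  v != 0 -> e * factor_const K (size ls) < eta ^+ size ls ->
  apply_factors (diag_mx d + E) v ls != 0.
Proof.
move=> he K0 eta0 Ee dK deta v0 small.
have [j vj hj] := row_max_gt0 v0.
have := apply_factors_le he K0 Ee dK hj j.
set y := apply_factors _ _ _; move=> h.
apply/eqP => y0; move: h; rewrite y0 mxE sub0r cmodN cmodM mulrC ler_pM2r//.
apply/negP; rewrite -ltNge (lt_le_trans small)//.
have vj0 : v 0 j != 0 by rewrite -cmod_gt0.
rewrite cmod_prod; elim: (ls) deta => [|x s ih] hs; first by rewrite big_nil expr0.
rewrite big_cons exprS ler_pM ?exprn_ge0//.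
  by apply: hs; rewrite ?mem_head.
by apply: ih => i z vi zs; apply: hs; rewrite // in_cons zs orbT.
Qed.

Lemma mxrank_direct_sum m1 m2 m3 (A : 'M[R[i]]_(m1, n.+1)) (B : 'M[R[i]]_(m2, n.+1))
    (D : 'M[R[i]]_(m3, n.+1)) :
  (D :=: A + B)%MS -> (A :&: B)%MS = 0 -> \rank D = (\rank A + \rank B)%N.
Proof. by move=> -> h; rewrite mxrank_disjoint_sum. Qed.

Lemma addn_complement (a b q m : nat) : (q <= m -> a + q <= m -> b + (m - q) <= m ->
  a + b = m -> a = m - q)%N.
Proof. by lia. Qed.

Lemma rank_kermxpoly_prod M s k : uniq s ->
  \rank (kermxpoly M (\prod_(x <- s) ('X - x%:P) ^+ k)) =
  (\sum_(x <- s) \rank (kermx ((M - x%:M) ^+ k)))%N.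
Proof.
elim: s => [|x s ih] /=; first by rewrite !big_nil kermxpoly1 mxrank0.
move=> /andP[xs us]; rewrite !big_cons.
have cop : coprimep (('X - x%:P) ^+ k) (\prod_(y <- s) ('X - y%:P) ^+ k).
  apply: coprimep_expl; elim: (s) xs => [|y t iht]; first by rewrite big_nil coprimep1.
  rewrite in_cons negb_or big_cons => /andP[xy xt].
  rewrite coprimepMr iht// andbT coprimep_expr// coprimep_XsubC.
  by rewrite root_XsubC eq_sym.
have e : kermxpoly M (('X - x%:P) ^+ k) = kermx ((M - x%:M) ^+ k).
  by rewrite /kermxpoly rmorphXn /= rmorphB /= horner_mx_X horner_mx_C.
apply: etrans (mxrank_direct_sum (kermxpolyM M cop) (mxdirect_kermxpoly M cop)) _.
exact: (congr2 addn (congr1 mxrank e) (ih us)).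
Qed.

Lemma generalized_eigenspaces_full M s : uniq s ->
  (forall x, x \in s <-> eigenvalue M x) ->
  (\sum_(x <- s) \rank (kermx ((M - x%:M) ^+ n.+1)))%N = n.+1.
Proof.
move=> us hs; rewrite -rank_kermxpoly_prod//.
rewrite (@kermxpoly_min _ n M _ _) ?mxrank1//.
apply: dvdp_trans (mxminpoly_dvd_char M) _.
have [rs hrs] := closed_field_poly_normal (char_poly M).
rewrite (monicP (char_poly_monic M)) scale1r in hrs.
have szrs : size rs = n.+1.
  by have := size_char_poly M; rewrite hrs size_prod_XsubC => -[].
have rsE x : (x \in s) = (x \in rs).
  apply/idP/idP => [/hs|xr]; first by rewrite eigenvalue_root_char hrs root_prod_XsubC.
  by apply/hs; rewrite eigenvalue_root_char hrs root_prod_XsubC.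
rewrite hrs -(prodr_undup_exp_count rs).
have ps : perm_eq (undup rs) s.
  by apply: uniq_perm => //; [exact: undup_uniq|move=> x; rewrite mem_undup rsE].
rewrite (perm_big _ ps) /=.
elim: (s) => [|x t ih]; first by rewrite !big_nil dvdpp.
rewrite !big_cons dvdp_mul// dvdp_exp2l//.
by rewrite -szrs count_size.
Qed.

Lemma mxrank_cap_row m1 m2 (A : 'M[R[i]]_(m1, n.+1)) (B : 'M[R[i]]_(m2, n.+1)) :
  (n.+1 < \rank A + \rank B)%N ->
  exists v : 'rV[R[i]]_n.+1, [/\ v != 0, (v <= A)%MS & (v <= B)%MS].
Proof.
move=> h; have : (A :&: B)%MS != 0.
  rewrite -mxrank_eq0 -lt0n -(ltn_add2l (\rank (A + B)%MS)) addn0 mxrank_sum_cap.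
  by rewrite (leq_ltn_trans _ h)// rank_leq_col.
case/rowV0Pn => v; rewrite sub_capmx => /andP[vA vB] v0; exists v; split=> //.
Qed.

Lemma kermxpoly_apply_factors M v ls :
  (v <= kermxpoly M (\prod_(x <- ls) ('X - x%:P)))%MS ->
  apply_factors M v ls = 0.
Proof. by rewrite apply_factors_horner => /sub_kermxP. Qed.

Definition repeat_each (s : seq R[i]) := flatten [seq nseq n.+1 x | x <- s].

Lemma prod_repeat_each s : \prod_(x <- repeat_each s) ('X - x%:P) =
  \prod_(x <- s) ('X - x%:P) ^+ n.+1 :> {poly R[i]}.
Proof.
rewrite /repeat_each big_flatten big_map; apply: eq_bigr => x _.
by rewrite big_nseq -Monoid.iteropE.
Qed.

Lemma size_repeat_each s : size (repeat_each s) = (size s * n.+1)%N.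
Proof.
by elim: s => //= x s ih; rewrite /repeat_each /= -/(repeat_each s) !size_cat size_nseq ih mulSn.
Qed.

Lemma mem_repeat_each s x : (x \in repeat_each s) = (x \in s).
Proof.
apply/flattenP/idP => [[t /mapP[y ys ->]]|xs].
  by rewrite mem_nseq => /andP[_ /eqP ->].
by exists (nseq n.+1 x); [apply/mapP; exists x|rewrite mem_nseq eqxx].
Qed.

Lemma spectrum_seq M : exists s, [/\ uniq s, (size s <= n.+1)%N &
  forall x, x \in s <-> eigenvalue M x].
Proof.
have [rs hrs] := closed_field_poly_normal (char_poly M).
rewrite (monicP (char_poly_monic M)) scale1r in hrs.
exists (undup rs); split; first exact: undup_uniq.
  have : size rs = n.+1.
    by have := size_char_poly M; rewrite hrs size_prod_XsubC => -[].
  by move=> <-; exact: size_undup.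
by move=> x; rewrite mem_undup eigenvalue_root_char hrs root_prod_XsubC.
Qed.

(** Neither the sum of the generalized eigenspaces near [lam] nor that of the
    others can be larger than in the unperturbed case: it would meet the span of
    the complementary coordinates, where its annihilating polynomial does not
    vanish by [apply_factors_neq0].  Since the two dimensions add up to the size
    of the matrix, both bounds are equalities. *)
Lemma diagonal_perturbation d lam : exists eta e0 : R, [/\ 0 < eta, 0 < e0 &
  forall e E, 0 <= e <= e0 -> entries_le E e ->
  (forall x, eigenvalue (diag_mx d + E) x -> cmod (x - lam) < eta ->
     cmod (x - lam) <= n.+1%:R * e) /\
  (forall s, uniq s -> (forall x, x \in s <->
      eigenvalue (diag_mx d + E) x /\ cmod (x - lam) < eta) ->
    (\sum_(x <- s) \rank (kermx ((diag_mx d + E - x%:M) ^+ n.+1)))%N =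
    \rank (kermx (diag_mx d - lam%:M)))].
Proof.
have [eta eta0 [eta1 heta]] : exists2 eta : R, 0 < eta & eta <= 1 /\
    forall j, d 0 j != lam -> 2 * eta <= cmod (d 0 j - lam).
  suff [eta eta0 [eta1 heta]] : exists2 eta : R, 0 < eta & eta <= 1 /\
      forall j, j \in enum 'I_n.+1 -> d 0 j != lam -> 2 * eta <= cmod (d 0 j - lam).
    by exists eta => //; split=> // j; apply: heta; rewrite mem_enum.
  elim: (enum _) => [|i s [eta eta0 [eta1 heta]]]; first by exists 1.
  have [di|di] := eqVneq (d 0 i) lam.
    exists eta => //; split=> // j; rewrite in_cons => /orP[/eqP ->|]; last exact: heta.
    by rewrite di eqxx.
  have c0 : 0 < cmod (d 0 i - lam) by rewrite cmod_gt0 subr_eq0.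
  exists (Num.min eta (cmod (d 0 i - lam) / 2)); first by rewrite lt_min eta0 divr_gt0.
  split; first by rewrite ge_min eta1.
  move=> j; rewrite in_cons => /orP[/eqP -> _|js dj].
    by rewrite mulrC -ler_pdivlMr// ge_min lexx orbT.
  by rewrite (le_trans _ (heta j js dj))// ler_pM2l// ge_min lexx.
pose Dm := \sum_i cmod (d 0 i).
have Dm_ge j : cmod (d 0 j) <= Dm.
  by rewrite /Dm (bigD1 j)//= lerDl sumr_ge0// => i _; exact: cmod_ge0.
have Dm0 : 0 <= Dm by apply: sumr_ge0 => i _; exact: cmod_ge0.
pose K := 2 * Dm + 1.
have K0 : 0 <= K by rewrite addr_ge0// mulr_ge0.
pose N := (n.+1 * n.+1)%N.
pose C := \sum_(k < N.+1) factor_const K k.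
have CK k : (k <= N)%N -> factor_const K k <= C.
  move=> kN; rewrite /C (bigD1 (Ordinal (kN : (k < N.+1)%N)))//= lerDl.
  by apply: sumr_ge0 => i _; exact: factor_const_ge0.
have C0 : 0 <= C by apply: sumr_ge0 => i _; exact: factor_const_ge0.
have C1 : 0 < C + 1 by rewrite ltr_wpDl.
pose e0 := Num.min (eta / (2 * n.+1%:R)) (eta ^+ N / (C + 1)).
have n0 : 0 < n.+1%:R :> R by [].
exists eta, e0; split=> //.
  by rewrite lt_min !divr_gt0 ?exprn_gt0 ?mulr_gt0.
move=> e E /andP[e_ge0 ee0] Ee.
have ne : n.+1%:R * e <= eta / 2.
  have : e <= eta / (2 * n.+1%:R) by rewrite (le_trans ee0)// ge_min lexx.
  rewrite ler_pdivlMr ?mulr_gt0// => h.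
  rewrite ler_pdivlMr// (_ : n.+1%:R * e * 2 = e * (2 * n.+1%:R))//; ring.
have small k : (k <= N)%N -> e * factor_const K k < eta ^+ k.
  move=> kN; apply: (@lt_le_trans _ _ (eta ^+ N)).
    apply: (@le_lt_trans _ _ (eta ^+ N / (C + 1) * C)).
      by rewrite ler_pM ?factor_const_ge0 ?CK// (le_trans ee0)// ge_min lexx orbT.
    by rewrite -mulrA gtr_pMr ?exprn_gt0// mulrC ltr_pdivrMr// mul1r ltrDl.
  by rewrite -(subnK kN) exprD ler_piMl ?exprn_ge0 ?exprn_ile1// ltW.
have e1 : 0 <= e <= 1.
  rewrite e_ge0 (le_trans ee0)// ge_min; apply/orP; left.
  rewrite ler_pdivrMr ?mulr_gt0// mul1r (le_trans eta1)//.
  by rewrite -[leLHS]mul1r ler_pM// ?ler1n.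
set M := diag_mx d + E.
have loc x : eigenvalue M x -> exists j, cmod (x - d 0 j) <= eta / 2 /\
    cmod (x - d 0 j) <= n.+1%:R * e.
  by move=> /(gershgorin e_ge0 Ee)[j hj]; exists j; split=> //; exact: le_trans ne.
have loc1 x : eigenvalue M x -> cmod (x - lam) < eta -> cmod (x - lam) <= n.+1%:R * e.
  move=> /loc[j [h1 h2]] h3; suff <- : d 0 j = lam by [].
  apply/eqP; apply/negPn/negP => /heta; apply/negP; rewrite -ltNge.
  rewrite (_ : d 0 j - lam = (d 0 j - x) + (x - lam)); last by rewrite subrKA.
  rewrite (le_lt_trans (cmodD _ _))// mulr2n mulrDl mul1r ler_ltD//.
  by rewrite cmodBC (le_trans h1)// ler_pdivrMr// mulr_natr mulr2n lerDl ltW.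
split=> // s us hs.
have [t [ut st ht]] := spectrum_seq M.
pose far := [seq x <- t | ~~ (cmod (x - lam) < eta)].
have ps : perm_eq s [seq x <- t | cmod (x - lam) < eta].
  apply: uniq_perm => //; first exact: filter_uniq.
  move=> x; rewrite mem_filter; apply/idP/andP => [/hs[h1 h2]|[h1 h2]].
    by split=> //; exact/ht.
  by apply/hs; split=> //; exact/ht.
have tot : (\sum_(x <- s) \rank (kermx ((M - x%:M) ^+ n.+1)) +
    \sum_(x <- far) \rank (kermx ((M - x%:M) ^+ n.+1)))%N = n.+1.
  apply: etrans (generalized_eigenspaces_full ut ht).
  rewrite (perm_big _ ps) /= !big_filter.
  by rewrite [RHS](bigID (fun x => cmod (x - lam) < eta)).
have xK j x : eigenvalue M x -> cmod (d 0 j - x) <= K.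
  move=> /loc[i [h _]].
  rewrite -(subrKA (d 0 i)) (le_trans (cmodD _ _))// /K mulrDl mul1r lerD//.
    by rewrite (le_trans (cmodB _ _))// lerD.
  by rewrite cmodBC (le_trans h)// ler_pdivrMr// mul1r (le_trans eta1)// ler1n.
have us_size : (size s <= n.+1)%N.
  by rewrite (perm_size ps) (leq_trans _ st)// size_filter count_size.
have far_size : (size far <= n.+1)%N.
  by rewrite (leq_trans _ st)// size_filter count_size.
have main (r : seq R[i]) m (V : 'M[R[i]]_(m, n.+1)) : uniq r -> (size r <= n.+1)%N ->
    (forall x, x \in r -> eigenvalue M x) ->
    (forall v j x, (v <= V)%MS -> v 0 j != 0 -> x \in r -> eta <= cmod (d 0 j - x)) ->
    (\sum_(x <- r) \rank (kermx ((M - x%:M) ^+ n.+1)) + \rank V <= n.+1)%N.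
  move=> ur rn rM hV; rewrite -rank_kermxpoly_prod// leqNgt; apply/negP.
  move=> /mxrank_cap_row[v [v0]]; rewrite -prod_repeat_each.
  move=> /kermxpoly_apply_factors hv vV.
  have kN : (size (repeat_each r) <= N)%N by rewrite size_repeat_each leq_mul2r rn orbT.
  have := @apply_factors_neq0 d E e K eta (repeat_each r) v e1 K0 (ltW eta0) Ee.
  rewrite hv eqxx => h; suff : false by [].
  apply: h => //.
  - by move=> j x; rewrite mem_repeat_each => /rM; exact: xK.
  - by move=> j x vj; rewrite mem_repeat_each; exact: (hV v j x vV vj).
  - exact: small.
pose q := \rank (diag_mx d - lam%:M).
pose q' := \rank (kermx (diag_mx d - lam%:M)).
have q'E : q' = (n.+1 - q)%N := mxrank_ker _.
have qn : (q <= n.+1)%N := rank_leq_row _.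
have near_le : (\sum_(x <- s) \rank (kermx ((M - x%:M) ^+ n.+1)) + q <= n.+1)%N.
  apply: main => //; first by move=> x /hs[].
  move=> v j x /submxP[w ->]; rewrite mulmx_diagE mulf_eq0 negb_or => /andP[_].
  rewrite subr_eq0 => /heta h /hs[h1 h2].
  have h3 := loc1 _ h1 h2.
  have -> : d 0 j - x = (d 0 j - lam) - (x - lam) by rewrite opprB subrKA.
  rewrite (le_trans _ (cmod_sub_le _ _))// lerBrDr (le_trans _ h)//.
  rewrite mulr2n mulrDl mul1r lerD// (le_trans h3)// (le_trans ne)//.
  by rewrite ler_pdivrMr// mulr_natr mulr2n lerDl ltW.
have far_le : (\sum_(x <- far) \rank (kermx ((M - x%:M) ^+ n.+1)) + q' <= n.+1)%N.
  apply: main => //; first exact: filter_uniq.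
    by move=> x; rewrite mem_filter => /andP[_ /ht].
  move=> v j x /sub_kermxP /rowP /(_ j); rewrite mulmx_diagE mxE => /eqP.
  rewrite mulf_eq0 => /orP[->//|]; rewrite subr_eq0 => /eqP -> _.
  by rewrite mem_filter -leNgt cmodBC => /andP[].
rewrite -[RHS]/q'; move: near_le far_le tot.
by rewrite q'E => h1 h2 h3; exact: addn_complement qn h1 h2 h3.
Qed.

End DiagonalPerturbation.

(** * Eigenvalues of perturbed normal matrices *)

Section NormalPerturbation.
Variables (R : realType) (n : nat).
Implicit Types (Q M : 'M[R[i]]_n.+1) (x lam : R[i]) (s : seq R[i]).

Lemma similar_minus Q M x : Q \in unitmx ->
  invmx Q *m M *m Q - x%:M = invmx Q *m (M - x%:M) *m Q.
Proof.
move=> uQ; rewrite mulmxBr mulmxBl; congr (_ - _).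
by rewrite mul_mx_scalar -scalemxAl mulVmx// scalemx1.
Qed.

Lemma rank_kermx_conj Q M : Q \in unitmx ->
  \rank (kermx (invmx Q *m M *m Q)) = \rank (kermx M).
Proof.
move=> uQ; have rQ : row_free Q by rewrite row_free_unit.
have fQ : row_full (invmx Q) by rewrite row_full_unit unitmx_inv.
by rewrite !mxrank_ker (mxrankMfree _ rQ) (eqmxMfull _ fQ).
Qed.

Lemma rank_kermx_similar Q M x k : Q \in unitmx ->
  \rank (kermx ((invmx Q *m M *m Q - x%:M) ^+ k)) = \rank (kermx ((M - x%:M) ^+ k)).
Proof.
move=> uQ; rewrite (similar_minus M x uQ).
have -> : (invmx Q *m (M - x%:M) *m Q) ^+ k = invmx Q *m (M - x%:M) ^+ k *m Q.
  elim: k => [|k ih]; first by rewrite !expr0 mulmx1 mulVmx.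
  by rewrite !exprS ih -!mulmxE !mulmxA mulmxK.
exact: rank_kermx_conj.
Qed.

Lemma eigenvalue_rank M x : eigenvalue M x = (\rank (kermx ((M - x%:M) ^+ 1)) != 0)%N.
Proof. by rewrite expr1 mxrank_eq0. Qed.

Lemma eigenvalue_similar Q M x : Q \in unitmx ->
  eigenvalue (invmx Q *m M *m Q) x = eigenvalue M x.
Proof. move=> uQ; rewrite !eigenvalue_rank.
exact: (congr1 (fun r => r != 0%N) (rank_kermx_similar M x 1 uQ)). Qed.

(** The spectral theorem conjugates a normal matrix to a diagonal one; the same
    conjugation multiplies the perturbation by a constant only. *)
Lemma normal_perturbation (M0 : 'M[R[i]]_n.+1) lam : M0 \is normalmx ->
  exists eta e0 C : R, [/\ 0 < eta, 0 < e0, 0 < C &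
  forall e M, 0 <= e <= e0 -> entries_le (M - M0) e ->
  (forall x, eigenvalue M x -> cmod (x - lam) < eta -> cmod (x - lam) <= C * e) /\
  (forall s, uniq s -> (forall x, x \in s <->
      eigenvalue M x /\ cmod (x - lam) < eta) ->
    (\sum_(x <- s) \rank (kermx ((M - x%:M) ^+ n.+1)))%N =
    \rank (kermx (M0 - lam%:M)))].
Proof.
move=> /orthomx_spectralP; set P := spectralmx M0; set d := spectral_diag M0 => M0E.
have uP : P \in unitmx by apply: unitarymx_unit; exact: spectral_unitarymx.
have [eta [e0 [eta0 e00 H]]] := diagonal_perturbation d lam.
pose S (A : 'M[R[i]]_n.+1) := \sum_i \sum_j cmod (A i j).
have S0 (A : 'M[R[i]]_n.+1) : 0 <= S A.
  by apply: sumr_ge0 => i _; apply: sumr_ge0 => j _; exact: cmod_ge0.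
have S_ge (A : 'M[R[i]]_n.+1) i : \sum_j cmod (A i j) <= S A.
  rewrite /S [leRHS](bigD1 i)//= lerDl; apply: sumr_ge0 => k _.
  by apply: sumr_ge0 => j _; exact: cmod_ge0.
pose k := S P * S (invmx P)^T + 1.
have k0 : 0 < k by rewrite ltr_wpDl// mulr_ge0.
have n0 : 0 < n.+1%:R :> R by [].
exists eta, (e0 / k), (n.+1%:R * k); split=> //.
- by rewrite divr_gt0.
- by rewrite mulr_gt0.
move=> e M /andP[e_ge0 ee] hM.
pose E := P *m (M - M0) *m invmx P.
have ME : M = invmx P *m (diag_mx d + E) *m P.
  rewrite mulmxDr mulmxDl -M0E /E !mulmxA mulVmx// mul1mx mulmxKV//.
  by rewrite addrC subrK.
have hE : entries_le E (k * e).
  move=> i j; rewrite /E mxE.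
  apply: (@le_trans _ _ (\sum_l (\sum_m cmod (P i m)) * e * cmod (invmx P l j))).
    rewrite (le_trans (cmod_sum _ _ _))//; apply: ler_sum => l _.
    rewrite cmodM ler_wpM2r ?cmod_ge0// mxE (le_trans (cmod_sum _ _ _))//.
    rewrite mulr_suml; apply: ler_sum => m _.
    by rewrite cmodM ler_wpM2l ?cmod_ge0.
  rewrite -mulr_sumr.
  have h2 : \sum_l cmod (invmx P l j) <= S (invmx P)^T.
    by apply: le_trans (S_ge _ j); apply: ler_sum => l _; rewrite mxE.
  rewrite mulrAC ler_wpM2r//.
  apply: (@le_trans _ _ (S P * S (invmx P)^T)); last by rewrite lerDl.
  by rewrite ler_pM// sumr_ge0// => m _; exact: cmod_ge0.
have [|H1 H2] := H (k * e) E _ hE.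
  by rewrite mulr_ge0 ?(ltW k0)//= mulrC -ler_pdivlMr.
split.
  by move=> x; rewrite ME eigenvalue_similar// -mulrA; exact: H1.
move=> s us hs; rewrite ME.
under eq_bigr do rewrite (rank_kermx_similar _ _ _ uP).
rewrite (H2 s us); last by move=> x; rewrite hs ME (eigenvalue_similar _ _ uP).
have h : \rank (kermx (invmx P *m diag_mx d *m P - lam%:M)) =
    \rank (kermx (diag_mx d - lam%:M)) := rank_kermx_similar (diag_mx d) lam 1 uP.
apply: (etrans (esym h)).
exact: (congr1 (fun X => \rank (kermx (X - lam%:M))) (esym M0E)).
Qed.

End NormalPerturbation.

(** * Free motion on the lattice *)

Section Hopping.

Notation index := (site * 'I_4)%type.

Definition hop (j : 'I_4) : site := nth 0 [:: - e1; e1; - e2; e2] j.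

Definition opposite (j : 'I_4) : 'I_4 :=
  nth j [:: dir_right; dir_left; dir_up; dir_down] j.

Definition forward (p : index) : index := (p.1 + hop p.2, p.2).
Definition backward (p : index) : index := (p.1 - hop p.2, p.2).

Lemma forwardK : cancel forward backward.
Proof. by move=> [x j]; rewrite /forward /backward /= addrK. Qed.

Lemma backwardK : cancel backward forward.
Proof. by move=> [x j]; rewrite /forward /backward /= subrK. Qed.

Lemma dir_case (P : 'I_4 -> Prop) : P dir_left -> P dir_right -> P dir_down ->
  P dir_up -> forall j, P j.
Proof.
move=> h0 h1 h2 h3 [m hm]; case: m hm => [|[|[|[|//]]]] hm.
- by rewrite (_ : Ordinal hm = dir_left)//; exact: val_inj.
- by rewrite (_ : Ordinal hm = dir_right)//; exact: val_inj.
- by rewrite (_ : Ordinal hm = dir_down)//; exact: val_inj.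
- by rewrite (_ : Ordinal hm = dir_up)//; exact: val_inj.
Qed.

Lemma oppositeK : involutive opposite.
Proof. by elim/dir_case; apply: val_inj. Qed.

Lemma hop_opposite j : hop (opposite j) = - hop j.
Proof. by elim/dir_case : j; rewrite /hop /= ?opprK. Qed.

Lemma iter_backward k p : iter k backward p = (p.1 - hop p.2 *+ k, p.2).
Proof.
elim: k => [|k ih]; first by rewrite mulr0n subr0; case: p.
by rewrite iterS ih /backward /= mulrSr opprD addrA.
Qed.

Lemma iter_forward k p : iter k forward p = (p.1 + hop p.2 *+ k, p.2).
Proof.
elim: k => [|k ih]; first by rewrite mulr0n addr0; case: p.
by rewrite iterS ih /forward /= mulrSr addrA.
Qed.

Lemma site_mulrn1 (z : site) m : (z *+ m).1 = z.1 *+ m.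
Proof. by elim: m => // m ih; rewrite !mulrSr /= ih. Qed.

Lemma site_mulrn2 (z : site) m : (z *+ m).2 = z.2 *+ m.
Proof. by elim: m => // m ih; rewrite !mulrSr /= ih. Qed.

Lemma hop_mulrn_inj j : injective (fun k => hop j *+ k).
Proof.
move=> k l h; have := congr1 fst h; have := congr1 snd h.
rewrite !site_mulrn1 !site_mulrn2; elim/dir_case : j {h} => /= h2 h1.
- by move: h1; rewrite !mulNrn => /oppr_inj /eqP; rewrite !natz => /eqP [].
- by move: h1 => /eqP; rewrite !natz => /eqP [].
- by move: h2; rewrite !mulNrn => /oppr_inj /eqP; rewrite !natz => /eqP [].
- by move: h2 => /eqP; rewrite !natz => /eqP [].
Qed.

(** A coordinate direction meets the box in an interval. *)
Lemma box_convex (M0 : nat) (x : site) (j : 'I_4) (k : nat) :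
  Omega_i M0 (x - hop j *+ k) -> Omega_i M0 (x + hop j) -> Omega_i M0 x.
Proof.
case: x => x y; rewrite /Omega_i /=.
rewrite site_mulrn1 site_mulrn2 !ler_norml.
have k0 : (0 : int) <= k%:R by [].
elim/dir_case : j; rewrite /hop /= ?mul0rn ?mulNrn ?oppr0 ?addr0 ?subr0 ?opprK
  => -[/andP[a1 a2] /andP[a3 a4]] [/andP[b1 b2] /andP[b3 b4]];
  split; apply/andP; split; lra.
Qed.

Lemma core_enumeration (M0 : nat) : exists n (iota : 'I_n.+1 -> index),
  injective iota /\ forall p, in_core iota p <-> Omega_i M0 p.1.
Proof.
pose side := (M0 + M0).+1.
pose T : finType := ('I_side * 'I_side * 'I_4)%type.
pose f (t : T) : index := ((t.1.1%:Z - M0%:Z, t.1.2%:Z - M0%:Z), t.2).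
have finj : injective f.
  move=> [[a b] j] [[a' b'] j'] [] /addIr /eqP h1 /addIr /eqP h2 /= ->.
  congr (_, _, _); apply: val_inj; apply/eqP; by [move: h1|move: h2].
have cT : #|T| = (#|T|.-1).+1.
  by rewrite prednK//; apply/card_gt0P; exists ((ord0, ord0), ord0).
exists #|T|.-1, (fun i => f (enum_val (cast_ord (esym cT) i))); split.
  by move=> i i' /finj /enum_val_inj /cast_ord_inj.
move=> [[x y] j]; rewrite /Omega_i /= !ler_norml; split.
  case=> i; case: (enum_val _) => [[a b] j'] [<- <- _].
  have ha : (a%:Z <= M0%:Z + M0%:Z) by rewrite -PoszD lez_nat -ltnS ltn_ord.
  have hb : (b%:Z <= M0%:Z + M0%:Z) by rewrite -PoszD lez_nat -ltnS ltn_ord.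
  have a0 : (0 <= a%:Z) by []. have b0 : (0 <= b%:Z) by [].
  by split; apply/andP; split; lra.
move=> [/andP[x1 x2] /andP[y1 y2]].
have hx : (`|(x + M0%:Z)%R|%N < side)%N.
  rewrite ltnS -lez_nat PoszD gez0_abs; lra.
have hy : (`|(y + M0%:Z)%R|%N < side)%N.
  rewrite ltnS -lez_nat PoszD gez0_abs; lra.
pose t : T := (Ordinal hx, Ordinal hy, j).
exists (cast_ord cT (enum_rank t)); rewrite cast_ordK enum_rankK /f /=.
by rewrite !gez0_abs ?addrK//; lra.
Qed.

End Hopping.

(** * Compression of a walk to the box *)

Section CoreOfWalk.
Variables (R : realType) (M0 : nat) (n : nat).
Notation index := (site * 'I_4)%type.
Variable iota : 'I_n.+1 -> index.
Hypothesis iota_inj : injective iota.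
Hypothesis iota_core : forall p, in_core iota p <-> Omega_i M0 p.1.

Implicit Types (u : wavefn R) (c : R[i]) (G : site -> 'M[R[i]]_4) (p : index).

(** Columns of the perturbation [A - c S] of the free walk, for the operator
    that applies [G] and then the shift [c S]. *)
Definition walk_perturbation c G (i : 'I_n.+1) p : R[i] :=
  if (iota i).1 == (backward p).1
  then c * (G (backward p).1 p.2 (iota i).2 - (p.2 == (iota i).2)%:R) else 0.

Lemma walk_perturbation_supp c G i p :
  walk_perturbation c G i p != 0 -> in_core iota (backward p).
Proof.
rewrite /walk_perturbation; case: ifP => [/eqP h _|_ /eqP //].
by apply/iota_core; rewrite -h; apply/iota_core; exists i.
Qed.

Lemma no_reentry_box p : downstream backward iota p -> ~ in_core iota p ->
  ~ in_core iota (forward p).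
Proof.
move=> [k /iota_core hk] np /iota_core hf; apply: np; apply/iota_core.
by move: hk; rewrite iter_backward /= => hk; exact: box_convex hk hf.
Qed.

Lemma sum_core_family (h : 'I_4 -> index) (F : index -> R[i]) : injective h ->
  (forall p, F p != 0 -> exists k, h k = p) ->
  \sum_i F (iota i) = \sum_(k < 4) if `[< in_core iota (h k) >] then F (h k) else 0.
Proof.
move=> hi hF.
transitivity (\sum_i \sum_(k < 4) (if iota i == h k then F (h k) else 0)).
  apply: eq_bigr => i _; have [F0|/hF [k hk]] := eqVneq (F (iota i)) 0.
    rewrite F0 big1// => k _; case: eqP => [e|//]; by rewrite -e.
  rewrite -hk (bigD1 k)//= eqxx big1 ?addr0// => l lk.
  by rewrite (inj_eq hi) eq_sym (negbTE lk).
rewrite exchange_big; apply: eq_bigr => k _ /=.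
case: asboolP => [[i hi']|hn].
  rewrite (bigD1 i)//= hi' eqxx big1 ?addr0// => i' ii'.
  by rewrite -hi' (inj_eq iota_inj) (negbTE ii').
by apply: big1 => i _; case: eqP => // e; case: hn; exists i.
Qed.

Lemma sum_core_site (x : site) (F : index -> R[i]) :
  \sum_i (if (iota i).1 == x then F (iota i) else 0) =
  if `[< Omega_i M0 x >] then \sum_(k < 4) F (x, k) else 0.
Proof.
rewrite (@sum_core_family (fun k => (x, k)) (fun p => if p.1 == x then F p else 0)).
- have e k : `[< in_core iota (x, k) >] = `[< Omega_i M0 x >].
    by apply/asboolP/asboolP; [exact: (iota_core (x, k)).1|exact: (iota_core (x, k)).2].
  under eq_bigr do rewrite e eqxx.
  by case: asboolP => // _; rewrite big1.
- by move=> k l [].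
- move=> [y k] /=; case: ifP => [/eqP -> _|_ /eqP //].
  by exists k.
Qed.

Lemma perturbed_shift_walk c G (f : index -> R[i]) p :
  (forall x, ~ Omega_i M0 x -> G x = 1%:M) ->
  perturbed_shift backward iota c (walk_perturbation c G) f p =
  c * \sum_(k < 4) G (backward p).1 p.2 k * f ((backward p).1, k).
Proof.
move=> G1; rewrite /perturbed_shift /spread /walk_perturbation.
set x := (backward p).1.
pose F (q : index) := f q * (c * (G x p.2 q.2 - (p.2 == q.2)%:R)).
rewrite (eq_bigr (fun i => if (iota i).1 == x then F (iota i) else 0)); last first.
  by move=> i _; rewrite mxE; case: ifP => //; rewrite mulr0.
rewrite sum_core_site /F /=.
have fx : f (backward p) = \sum_(k < 4) (p.2 == k)%:R * f (x, k).
  rewrite (bigD1 p.2)//= eqxx mul1r big1 ?addr0// => k kp.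
  by rewrite eq_sym (negbTE kp) mul0r.
case: asboolP => [_|/G1 ->].
  rewrite fx !mulr_sumr -big_split; apply: eq_bigr => k _ /=; ring.
rewrite fx addr0; congr (_ * _); apply: eq_bigr => k _; by rewrite mxE.
Qed.

Definition walk_core_mx c G := core_mx backward iota c (walk_perturbation c G).

Lemma walk_core_mxE c G i j : walk_core_mx c G i j =
  if (iota i).1 == (backward (iota j)).1
  then c * G (iota i).1 (iota j).2 (iota i).2 else 0.
Proof.
rewrite mxE /walk_perturbation.
have [e|ne] := eqVneq (iota i).1 (backward (iota j)).1.
  rewrite e (_ : (_ == iota i) = ((iota j).2 == (iota i).2)); first by ring.
  by apply/eqP/eqP => [<-//|h]; rewrite [iota i]surjective_pairing e -h.
rewrite addr0 (_ : (_ == iota i) = false) ?mulr0//.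
by apply: contra_neqF ne => /eqP ->.
Qed.

Lemma amplitude_shift u p : amplitude (walk_shift u) p = amplitude u (backward p).
Proof.
case: p => x j; rewrite /amplitude /walk_shift /backward /=.
by elim/dir_case : j; rewrite mxE /= /hop /= ?opprK.
Qed.

Lemma amplitude_mult G u p :
  amplitude (mult_op G u) p = \sum_(k < 4) G p.1 p.2 k * amplitude u (p.1, k).
Proof. by rewrite /amplitude /mult_op mxE. Qed.

Lemma amplitude_walk G u p : amplitude (walk G u) p =
  \sum_(k < 4) G (backward p).1 p.2 k * amplitude u ((backward p).1, k).
Proof. by rewrite /walk amplitude_shift amplitude_mult. Qed.

Lemma amplitude_walk_core G u : (forall x, ~ Omega_i M0 x -> G x = 1%:M) ->
  amplitude (walk G u) =
  perturbed_shift backward iota 1 (walk_perturbation 1 G) (amplitude u).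
Proof.
move=> G1; apply/funext => p.
by rewrite amplitude_walk perturbed_shift_walk// mul1r.
Qed.

(** * Complex translation *)

Section Translation.
Variable theta : R[i].

Definition phase p : R[i] :=
  nth 0 [:: cexp ('i * theta * p.1.1%:~R); cexp (- ('i * theta * p.1.1%:~R));
            cexp ('i * theta * p.1.2%:~R); cexp (- ('i * theta * p.1.2%:~R))] p.2.

Lemma phase_neq0 p : phase p != 0.
Proof. by case: p => x j; rewrite /phase; elim/dir_case : j => /=; exact: cexp_neq0. Qed.

Lemma phase_backward p : phase p = cexp (- ('i * theta)) * phase (backward p).
Proof.
case: p => [[x y] j]; rewrite /phase /backward.
elim/dir_case : j; rewrite /hop /= -cexpD; congr cexp;
  rewrite ?rmorphD ?rmorphN ?rmorph0 ?rmorph1 /=; ring.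
Qed.

Lemma translation_mxE x : translation_mx theta x = diag_mx (\row_k phase (x, k)).
Proof.
rewrite /translation_mx; congr diag_mx; apply/rowP => k; rewrite !mxE.
by rewrite /phase; elim/dir_case : k.
Qed.

Lemma inv_translation_mxE x :
  invmx (translation_mx theta x) = diag_mx (\row_k (phase (x, k))^-1).
Proof.
have h : translation_mx theta x *m diag_mx (\row_k (phase (x, k))^-1) = 1%:M.
  rewrite translation_mxE mulmx_diag -diag_const_mx; congr diag_mx.
  by apply/rowP => k; rewrite !mxE divff// phase_neq0.
have u := mulmx1_unit h.
by rewrite -[RHS]mul1mx -(mulVmx u.1) -mulmxA h mulmx1.
Qed.

(** The translated walk is the walk with this coin, multiplied by
    [e^(-i theta)]: the phases on both sides of the shift differ by this factor. *)
Definition conjugated_coin (C : site -> 'M[R[i]]_4) x : 'M[R[i]]_4 :=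
  \matrix_(j, k) (phase (x, j) * C x j k / phase (x, k)).

Lemma conjugated_coin1 C x : C x = 1%:M -> conjugated_coin C x = 1%:M.
Proof.
move=> C1; apply/matrixP => j k; rewrite !mxE C1 mxE.
case: eqP => [->|_]; last by rewrite mulr0 mul0r.
by rewrite mulr1 divff// phase_neq0.
Qed.

Lemma amplitude_translated_walk C u p : amplitude (translated_walk C theta u) p =
  cexp (- ('i * theta)) * \sum_(k < 4) conjugated_coin C (backward p).1 p.2 k *
    amplitude u ((backward p).1, k).
Proof.
rewrite /translated_walk amplitudeD amplitudeZ amplitude_shift amplitude_mult.
have tE (F : 'I_4 -> R[i]) :
    \sum_(k < 4) translation_mx theta p.1 p.2 k * F k = phase p * F p.2.
  rewrite translation_mxE (bigD1 p.2)//= !mxE eqxx mulr1n -surjective_pairing.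
  by rewrite big1 ?addr0// => k kp; rewrite !mxE eq_sym (negbTE kp) mulr0n mul0r.
rewrite tE amplitudeB amplitude_walk amplitude_shift -surjective_pairing.
set v := translation_inv theta u.
have vE q : amplitude v q = (phase q)^-1 * amplitude u q.
  rewrite /v /translation_inv amplitude_mult inv_translation_mxE (bigD1 q.2)//= !mxE eqxx mulr1n.
  rewrite -surjective_pairing big1 ?addr0// => k kp.
  by rewrite !mxE eq_sym (negbTE kp) mulr0n mul0r.
rewrite phase_backward mulrBr !vE.
have p0 := phase_neq0 (backward p).
have -> : cexp (- ('i * theta)) * phase (backward p) *
    ((phase (backward p))^-1 * amplitude u (backward p)) =
    cexp (- ('i * theta)) * amplitude u (backward p) by field.
rewrite addrCA subrr addr0 -mulrA; congr (_ * _).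
rewrite mulr_sumr; apply: eq_bigr => k _.
by rewrite vE mxE /backward /=; ring.
Qed.

Lemma amplitude_translated_walk_core C u : (forall x, ~ Omega_i M0 x -> C x = 1%:M) ->
  amplitude (translated_walk C theta u) =
  let c := cexp (- ('i * theta)) in
  perturbed_shift backward iota c (walk_perturbation c (conjugated_coin C)) (amplitude u).
Proof.
move=> C1; apply/funext => p.
by rewrite amplitude_translated_walk /= perturbed_shift_walk// => x /C1 /conjugated_coin1.
Qed.

Let Q : 'M[R[i]]_n.+1 := diag_mx (\row_i phase (iota i)).

Lemma phase_mx_unit : Q \in unitmx.
Proof.
rewrite unitmxE det_diag unitfE; apply/prodf_neq0 => i _; by rewrite mxE phase_neq0.
Qed.

(** By [phase_backward], the factor [e^(-i theta)] and the phases at the site where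
    the coin acts combine into the phases at the two ends of a step. *)
Lemma walk_core_mx_translated C :
  walk_core_mx (cexp (- ('i * theta))) (conjugated_coin C) =
  invmx Q *m walk_core_mx 1 C *m Q.
Proof.
apply: (can_inj (mulKmx phase_mx_unit)); rewrite !mulmxA mulmxV ?mul1mx ?phase_mx_unit//.
apply/matrixP => i j; rewrite mul_diag_mx mul_mx_diag [LHS]mxE [RHS]mxE !walk_core_mxE.
case: eqP => [e|_]; last by rewrite mulr0 mul0r.
rewrite !mxE [phase (iota j)]phase_backward.
have -> : phase (backward (iota j)) = phase ((iota i).1, (iota j).2).
  by rewrite e -surjective_pairing.
have -> : phase (iota i) = phase ((iota i).1, (iota i).2) by rewrite -surjective_pairing.
have p0 := phase_neq0 ((iota i).1, (iota i).2).
by field.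
Qed.

End Translation.

(** * The non-penetrable walk *)

Section Barrier.
Variable C : site -> 'M[R[i]]_4.
Hypotheses (C_coin : coin M0 C) (C_np : nonpenetrable M0 C).

Let C1 : forall x, ~ Omega_i M0 x -> C x = 1%:M := C_coin.2.

Lemma ell2_finite_support u (s : seq index) :
  (forall p, amplitude u p != 0 -> p \in s) -> ell2 u.
Proof. by move=> h; apply/ell2P; exact: sq_summable_finite h. Qed.

Lemma hop_out (x : site) (k : 'I_4) : Omega_i M0 x -> ~ Omega_i M0 (x + hop k) ->
  forall u, ell2 u -> amplitude (walk C u) (x + hop k, k) = amplitude u (x, opposite k).
Proof.
move=> ox; elim/dir_case : k; rewrite /hop => nx u su;
  have [h1 h2 h3 h4] := C_np su; rewrite /amplitude /=;
  case: x ox nx => x y; rewrite /Omega_i /= => ox nx.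
- by apply: h2; split=> //=; lia.
- by apply: h1; split=> //=; lia.
- by apply: h4; split=> //=; lia.
- by apply: h3; split=> //=; lia.
Qed.

(** Tested on point masses, the reflection condition determines every row of the
    coin that belongs to a direction leaving the box. *)
Lemma coin_outgoing (x : site) (k j : 'I_4) : Omega_i M0 x -> ~ Omega_i M0 (x + hop k) ->
  C x k j = (j == opposite k)%:R.
Proof.
move=> ox nx.
pose u : wavefn R := of_amplitude (fun p => (p == (x, j))%:R).
have su : ell2 u.
  apply: (@ell2_finite_support _ [:: (x, j)]) => p; rewrite of_amplitudeK inE.
  by case: (p == _) => // /eqP.
have := hop_out ox nx su; rewrite amplitude_walk of_amplitudeK /backward /= addrK.
rewrite (bigD1 j)//= eqxx mulr1 big1 ?addr0; last first.
  move=> i ij; rewrite (_ : (x, i) == (x, j) = false) ?mulr0//.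
  by apply: contra_neqF ij => /eqP[->].
by move=> ->; rewrite xpair_eqE eqxx eq_sym.
Qed.

Let M := walk_core_mx 1 C.

Lemma conj_bool (b : bool) : Num.conj (b%:R : R[i]) = b%:R.
Proof. by case: b; rewrite ?rmorph1 ?rmorph0. Qed.

Lemma coin_rows (x : site) (j j' : 'I_4) :
  \sum_k C x j k * Num.conj (C x j' k) = (j == j')%:R.
Proof.
have /unitarymxP /matrixP /(_ j j') := C_coin.1 x; rewrite !mxE => <-.
by apply: eq_bigr => k _; rewrite !mxE.
Qed.

Lemma coin_columns (x : site) (j j' : 'I_4) :
  \sum_k C x k j * Num.conj (C x k j') = (j == j')%:R.
Proof.
have /unitarymxP /mulmx1C /matrixP /(_ j' j) := C_coin.1 x; rewrite !mxE eq_sym => <-.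
by apply: eq_bigr => k _; rewrite !mxE mulrC.
Qed.

(** Without the box restriction the sum would be an entry of the identity; the
    directions leaving the box are missing, and for them the row of the coin is
    that of the reflection. *)
Lemma core_rows i i' : \sum_j M i j * Num.conj (M i' j) =
  ((i == i') && `[< in_core iota (backward (iota i)) >])%:R.
Proof.
have [e|ne] := eqVneq (iota i).1 (iota i').1; last first.
  rewrite big1 => [|j _].
    by rewrite (_ : i == i' = false)//; apply: contra_neqF ne => /eqP ->.
  rewrite !walk_core_mxE; case: eqP => [ei|_]; last by rewrite mul0r.
  by case: eqP => [ei'|_]; [case/eqP: ne; rewrite ei ei'|rewrite rmorph0 mulr0].
set x := (iota i).1 in e.
have ox : Omega_i M0 x by apply: (iota_core (iota i)).1; exists i.
pose t k := C x k (iota i).2 * Num.conj (C x k (iota i').2).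
pose F (q : index) := if (backward q).1 == x then t q.2 else 0.
rewrite (eq_bigr (fun j => F (iota j))); last first.
  move=> j _; rewrite !walk_core_mxE -e /F eq_sym; case: eqP => // _.
    by rewrite !mul1r.
  by rewrite mul0r.
rewrite (@sum_core_family (fun k => (x + hop k, k)) F); last 2 first.
- by move=> k l [].
- move=> [y k]; rewrite /F /backward /=; case: ifP => [/eqP <- _|_ /eqP //].
  by exists k; rewrite subrK.
have i2 : (i == i') = ((iota i).2 == (iota i').2).
  apply/eqP/eqP => [->//|h]; apply: iota_inj.
  by rewrite [iota i]surjective_pairing [iota i']surjective_pairing -e h.
pose r k := if `[< in_core iota (x + hop k, k) >] then 0 else
   ((iota i).2 == opposite k)%:R * ((iota i').2 == opposite k)%:R : R[i].
rewrite (eq_bigr (fun k => t k - r k)); last first.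
  move=> k _; rewrite /r /F /backward /= addrK eqxx.
  case: asboolP => [_|nk]; first by rewrite subr0.
  have nk' : ~ Omega_i M0 (x + hop k) by move=> /(iota_core (x + hop k, k)).2.
  by rewrite /t !(coin_outgoing _ ox nk') conj_bool subrr.
rewrite sumrB coin_columns -i2.
rewrite (bigD1 (opposite (iota i).2))//= big1 ?addr0; last first.
  move=> k; rewrite /r => ki; case: asboolP => // _.
  rewrite (_ : _ == opposite k = false) ?mul0r//.
  by apply: contra_neqF ki => /eqP ->; rewrite oppositeK.
rewrite /r oppositeK eqxx mul1r hop_opposite [_ == (iota i).2]eq_sym -i2.
have -> : `[< in_core iota (x - hop (iota i).2, opposite (iota i).2) >] =
    `[< in_core iota (backward (iota i)) >].
  by apply/asboolP/asboolP => /iota_core h; apply/iota_core.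
by case: asboolP => _; rewrite ?andbT ?andbF ?subr0 ?subrr.
Qed.

Lemma core_columns j j' : \sum_i Num.conj (M i j) * M i j' =
  ((j == j') && `[< in_core iota (backward (iota j)) >])%:R.
Proof.
have [e|ne] := eqVneq (backward (iota j)).1 (backward (iota j')).1; last first.
  rewrite big1 => [|i _].
    by rewrite (_ : j == j' = false)//; apply: contra_neqF ne => /eqP ->.
  rewrite !walk_core_mxE; case: eqP => [ei|_]; last by rewrite rmorph0 mul0r.
  by case: eqP => [ei'|_]; [case/eqP: ne; rewrite -ei -ei'|rewrite mulr0].
set x := (backward (iota j)).1 in e.
pose F (q : index) := C x (iota j').2 q.2 * Num.conj (C x (iota j).2 q.2).
rewrite (eq_bigr (fun i => if (iota i).1 == x then F (iota i) else 0)); last first.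
  move=> i _; rewrite !walk_core_mxE -e -/x /F; case: eqP => [->|_].
    by rewrite !mul1r mulrC.
  by rewrite mulr0.
rewrite sum_core_site /F /= coin_rows.
have -> : (j == j') = ((iota j').2 == (iota j).2).
  apply/eqP/eqP => [->//|h]; apply: iota_inj; apply: (can_inj backwardK).
  by rewrite [LHS]surjective_pairing [RHS]surjective_pairing -e /= h.
have -> : `[< Omega_i M0 x >] = `[< in_core iota (backward (iota j)) >].
  by apply/asboolP/asboolP => /iota_core.
by case: asboolP => _; rewrite ?andbT ?andbF.
Qed.

(** Both products of the core matrix with its adjoint are the projection onto
    the amplitudes that do not enter the box from outside: the barrier turns
    the compression into a unitary matrix on that subspace, and zero on its
    complement. *)
Lemma walk_core_mx_normal : M \is normalmx.
Proof.
apply/normalmxP; apply/matrixP => i i'; rewrite [LHS]mxE [RHS]mxE.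
rewrite (eq_bigr (fun j => M i j * Num.conj (M i' j))); last first.
  by move=> j _; congr (_ * _); rewrite !mxE.
rewrite [RHS](eq_bigr (fun j => Num.conj (M j i) * M j i')); last first.
  by move=> j _; congr (_ * _); rewrite !mxE.
by rewrite core_rows core_columns.
Qed.

(** A constant modulus along infinitely many indices contradicts summability. *)
Lemma orbit_zero (f : index -> R[i]) (g : index -> index) p : sq_summable f ->
  injective (fun k => iter k g p) ->
  (forall k, cmod (f (iter k g p)) = cmod (f p)) -> f p = 0.
Proof.
move=> [K hK] ginj hg; apply/eqP; rewrite -cmod_eq0 eq_le cmod_ge0 andbT leNgt.
apply/negP => fp; pose x := K / cmod (f p) ^+ 2.
have x0 : 0 <= x by rewrite divr_ge0 ?(sqsum_ge0 hK)// exprn_ge0// cmod_ge0.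
have := archi_boundP x0; set m := Num.bound x.
rewrite ltr_pdivrMr ?exprn_gt0//; apply/negP; rewrite -leNgt.
have := hK [seq iter k g p | k <- seq.iota 0 m]; rewrite map_inj_uniq// iota_uniq => /(_ isT).
apply: le_trans; rewrite big_map (eq_bigr (fun=> cmod (f p) ^+ 2)); last first.
  by move=> k _; rewrite hg.
by rewrite big_const_seq count_predT size_iota iter_addr addr0 mulr_natl.
Qed.

Let L := minus_scalar backward iota 1 (walk_perturbation 1 C).

Lemma eigenspaceE lam u : ell2_eigenspace (walk C) lam u <->
  sq_summable (amplitude u) /\ forall p, L lam (amplitude u) p = 0.
Proof.
split=> [[/ell2P su hu]|[su hu]].
  split=> // p; rewrite /L /minus_scalar -amplitude_walk_core//.
  by rewrite hu amplitudeZ subrr.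
split; first exact/ell2P.
apply: amplitude_inj; rewrite amplitudeZ; apply/funext => p; apply/eqP.
by rewrite -subr_eq0 amplitude_walk_core//; apply/eqP; exact: hu.
Qed.

Lemma walk_perturbation_out G c i p : ~ in_core iota (backward p) ->
  walk_perturbation c G i p = 0.
Proof.
by move=> h; apply/eqP/negPn/negP => /walk_perturbation_supp.
Qed.

Lemma minus_scalar_out lam f p : ~ in_core iota (backward p) ->
  L lam f p = f (backward p) - lam * f p.
Proof.
move=> h; rewrite /L /minus_scalar /perturbed_shift /spread mul1r.
by rewrite big1 ?addr0// => i _; rewrite walk_perturbation_out// mulr0.
Qed.

(** An eigenfunction to a unimodular eigenvalue has constant modulus along the
    orbits of the free motion outside the box, hence vanishes there. *)
Lemma eigenfunction_support lam f : cmod lam = 1 -> sq_summable f ->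
  (forall p, L lam f p = 0) -> forall p, ~ in_core iota p -> f p = 0.
Proof.
move=> l1 sf hf p np.
have step q : ~ in_core iota (backward q) -> cmod (f (backward q)) = cmod (f q).
  move=> h; have /eqP := hf q; rewrite minus_scalar_out// subr_eq0 => /eqP ->.
  by rewrite cmodM l1 mul1r.
have [dp|ndp] := pselect (downstream backward iota p).
  have out k : downstream backward iota (iter k forward p) /\
      ~ in_core iota (iter k forward p).
    elim: k => [//|k [h1 h2]]; rewrite iterS; split; last exact: no_reentry_box.
    by apply: downstream_tau; rewrite forwardK.
  apply: (orbit_zero sf (g:=forward)).
    by move=> k l; rewrite !iter_forward => /(congr1 fst) /= /addrI; exact: hop_mulrn_inj.
  elim=> [//|k ih]; rewrite iterS -step forwardK//; exact: (out k).2.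
have out k : ~ in_core iota (iter k backward p).
  by move=> h; apply: ndp; exists k.
apply: (orbit_zero sf (g:=backward)).
  by move=> k l; rewrite !iter_backward => /(congr1 fst) /= /addrI /oppr_inj;
    exact: hop_mulrn_inj.
by elim=> [//|k ih]; rewrite iterS step//; exact: (out k.+1).
Qed.

Lemma eigenspace_core lam f : cmod lam = 1 -> sq_summable f ->
  (forall p, L lam f p = 0) ->
  (restrict_core iota f <= kermx (M - lam%:M))%MS.
Proof.
move=> l1 sf hf; apply/sub_kermxP.
have df : supp_downstream backward iota f.
  by move=> p np; apply: (eigenfunction_support l1 sf hf) => /downstream_core.
rewrite -(restrict_minus_scalar backwardK iota_inj 1
  (walk_perturbation 1 C) no_reentry_box lam df).
by apply/rowP => i; rewrite !mxE; exact: hf.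
Qed.

Definition extend_core (w : 'rV[R[i]]_n.+1) : index -> R[i] :=
  fun p => \sum_i w 0 i * (p == iota i)%:R.

Lemma extend_coreE w i : extend_core w (iota i) = w 0 i.
Proof. by rewrite /extend_core (sum_core iota_inj (fun i => w 0 i) (erefl (iota i))). Qed.

Lemma extend_core_out w p : ~ in_core iota p -> extend_core w p = 0.
Proof.
move=> np; rewrite /extend_core big1// => i _; case: eqP => [e|_]; last by rewrite mulr0.
by case: np; exists i.
Qed.

(** An eigenvector of the core matrix vanishes on the amplitudes fed from
    outside, so that nothing leaves the box. *)
Lemma extend_core_eigen lam w : lam != 0 -> (w <= kermx (M - lam%:M))%MS ->
  forall p, L lam (extend_core w) p = 0.
Proof.
move=> l0 /sub_kermxP hw p.
have df : supp_downstream backward iota (extend_core w).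
  by move=> q nq; apply: extend_core_out => /downstream_core.
have rw : restrict_core iota (extend_core w) = w.
  by apply/rowP => i; rewrite mxE extend_coreE.
have [[i <-]|np] := pselect (in_core iota p).
  have := restrict_minus_scalar backwardK iota_inj 1
    (walk_perturbation 1 C) no_reentry_box lam df.
  by rewrite rw hw => /rowP /(_ i); rewrite !mxE.
have [ib|nb] := pselect (in_core iota (backward p)); last first.
  by rewrite minus_scalar_out// !extend_core_out// mulr0 subrr.
rewrite /L /minus_scalar perturbed_shift_walk// [extend_core w p]extend_core_out//.
rewrite mulr0 subr0 mul1r.
case: p np ib => x k np /iota_core; rewrite /backward /=; set y := x - hop k => oy.
have ny : ~ Omega_i M0 (y + hop k).
  by rewrite /y subrK => h; apply: np; apply/iota_core.
rewrite (eq_bigr (fun j => (j == opposite k)%:R * extend_core w (y, j))); last first.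
  by move=> j _; rewrite (coin_outgoing _ oy ny).
rewrite (bigD1 (opposite k))//= eqxx mul1r big1 ?addr0; last first.
  by move=> j /negbTE ->; rewrite mul0r.
have /iota_core [i hi] : Omega_i M0 (y, opposite k).1 by [].
rewrite -hi extend_coreE; apply: (mulfI l0); rewrite mulr0.
have /rowP/(_ i) := hw; rewrite mulmxBr mul_mx_scalar !mxE => /eqP.
rewrite subr_eq0 => /eqP <-; rewrite big1// => j _.
rewrite walk_core_mxE hi; case: eqP => [e|_]; last by rewrite mulr0.
case: ny; have : Omega_i M0 (iota j).1 by apply: (iota_core (iota j)).1; exists j.
by rewrite e /backward /= hop_opposite opprK.
Qed.

Lemma has_dim_eigenspace lam : cmod lam = 1 ->
  has_dim (ell2_eigenspace (walk C) lam) (\rank (kermx (M - lam%:M))).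
Proof.
move=> l1; have l0 : lam != 0 by rewrite -cmod_eq0 l1 oner_eq0.
apply: (@has_dim_row_space _ _ _ _ (fun u => restrict_core iota (amplitude u))).
- apply/eigenspaceE; rewrite amplitude0; split; first exact: sq_summable0.
  by move=> p; rewrite /L minus_scalar0.
- move=> a u v /eigenspaceE[su hu] /eigenspaceE[sv hv]; apply/eigenspaceE.
  rewrite amplitudeD amplitudeZ; split.
    by apply: sq_summableD => //; exact: sq_summableZ.
  by move=> p; rewrite /L minus_scalarD minus_scalarZ -/L hu hv mulr0 addr0.
- by move=> a u v; apply/rowP => i; rewrite !mxE amplitudeD amplitudeZ.
- move=> u /eigenspaceE[su hu] r0; apply: amplitude_inj; rewrite amplitude0.
  apply/funext => p; have [[i <-]|np] := pselect (in_core iota p).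
    by have /rowP/(_ i) := r0; rewrite !mxE.
  exact: (eigenfunction_support l1 su hu).
- by move=> u /eigenspaceE[su hu]; exact: eigenspace_core.
move=> w hw; exists (of_amplitude (extend_core w)).
  apply/eigenspaceE; rewrite of_amplitudeK; split; last exact: extend_core_eigen.
  apply: (@sq_summable_finite _ _ _ [seq iota i | i <- enum 'I_n.+1]) => p hp.
  have [[i <-]|np] := pselect (in_core iota p).
    by apply/mapP; exists i; rewrite ?mem_enum.
  by rewrite extend_core_out// eqxx in hp.
by rewrite of_amplitudeK; apply/rowP => i; rewrite mxE extend_coreE.
Qed.

Lemma point_spectrum_unimodular lam : cmod lam = 1 ->
  point_spectrum (walk C) lam -> eigenvalue M lam.
Proof.
move=> l1 [u /eigenspaceE[su hu] u0].
apply/eigenvalueP; exists (restrict_core iota (amplitude u)).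
  have /sub_kermxP := eigenspace_core l1 su hu.
  by rewrite mulmxBr mul_mx_scalar => /eqP; rewrite subr_eq0 => /eqP.
apply/eqP => r0; apply: u0; apply: amplitude_inj; rewrite amplitude0.
apply/funext => p; have [[i <-]|np] := pselect (in_core iota p).
  by have /rowP/(_ i) := r0; rewrite !mxE.
exact: (eigenfunction_support l1 su hu).
Qed.

Lemma coin_norm x (v : 'cV[R[i]]_4) :
  \sum_j cmod ((C x *m v) j 0) ^+ 2 = \sum_j cmod (v j 0) ^+ 2.
Proof.
have sqE (w : 'cV[R[i]]_4) : (\sum_j cmod (w j 0) ^+ 2)%:C =
    ((map_mx Num.conj w)^T *m w) 0 0.
  rewrite mxE rmorph_sum; apply: eq_bigr => j _ /=.
  by rewrite !mxE rmorphXn /= -cmodE normCK mulrC.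
apply: complexI; rewrite !sqE map_mxM trmx_mul -!mulmxA; congr ((_ *m _) 0 0).
rewrite mulmxA -[RHS]mul1mx; congr (_ *m _).
apply/matrixP => j k; rewrite !mxE eq_sym -(coin_columns x k j).
by apply: eq_bigr => l _; rewrite !mxE mulrC.
Qed.

Lemma norm2_components u :
  norm2 u = (\sum_(j < 4) \esum_(x in [set: site]) (cmod (u x j 0) ^+ 2)%:E)%E.
Proof.
have c0 x j : (0 <= (cmod (u x j 0) ^+ 2)%:E)%E by rewrite lee_fin exprn_ge0 ?cmod_ge0.
rewrite /norm2 (eq_esum (b:=fun x => \sum_(j < 4) (cmod (u x j 0) ^+ 2)%:E)%E); last first.
  by move=> x _; rewrite sumEFin.
rewrite !big_ord_recl big_ord0 adde0.
under eq_esum do rewrite !big_ord_recl big_ord0 adde0.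
by rewrite !esumD// => x _; rewrite ?adde_ge0.
Qed.

Lemma walk_isometry u : norm2 (walk C u) = norm2 u.
Proof.
transitivity (norm2 (mult_op C u)); last first.
  by apply: eq_esum => x _; rewrite coin_norm.
rewrite !norm2_components; apply: eq_bigr => j _.
rewrite [RHS](reindex_esum [set: site] [set: site] (fun x => x - hop j)).
  apply: eq_esum => x _; congr (cmod _ ^+ 2)%:E.
  exact: (amplitude_shift (mult_op C u) (x, j)).
split=> // [x y _ _ /addIr//|x _].
by exists (x + hop j) => //; rewrite addrK.
Qed.

(** The walk is isometric, so the norm of an eigenfunction fixes the modulus. *)
Lemma point_spectrum_modulus lam : point_spectrum (walk C) lam -> cmod lam = 1.
Proof.
move=> [u [su hu] u0].
have [K hK K0] := norm2_fin su.
have Kp : 0 < K.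
  rewrite lt_def K0 andbT; apply/eqP => Kz; apply: u0; apply: amplitude_inj.
  rewrite amplitude0; apply/funext => p; apply/eqP; rewrite -cmod_eq0 eq_le cmod_ge0 andbT.
  have /norm2_le/sqsum_bounded/(_ p) : (norm2 u <= K%:E)%E by rewrite hK.
  by rewrite Kz sqrtr0.
have uK : sqsum_le (amplitude u) K by apply/norm2_le; rewrite hK.
have luK : norm2 (lam *: u) = K%:E by rewrite -hu walk_isometry.
have ge1 : 1 <= cmod lam ^+ 2.
  rewrite -(ler_pM2r Kp) mul1r -lee_fin -luK; apply/norm2_le.
  by rewrite amplitudeZ; exact: sqsumZ.
have l0 : lam != 0.
  by apply: contraTneq ge1 => ->; rewrite cmod0 expr0n /= ler10.
have le1 : 1 <= (cmod lam ^+ 2)^-1.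
  rewrite -(ler_pM2r Kp) mul1r -lee_fin -{1}hK; apply/norm2_le.
  have e : amplitude u = fun p => lam^-1 * amplitude (lam *: u) p.
    by apply/funext => p; rewrite amplitudeZ mulKf.
  by rewrite e -exprVn -cmodV; apply: sqsumZ; apply/norm2_le; rewrite luK.
have l2 : cmod lam ^+ 2 = 1.
  apply/eqP; rewrite eq_le ge1 andbT.
  by rewrite -[leLHS]invrK invf_le1// invr_gt0 exprn_gt0// cmod_gt0.
by apply/eqP; rewrite -(@eqrXn2 _ 2)// ?cmod_ge0// expr1n l2.
Qed.

End Barrier.

End CoreOfWalk.

(** * Geometry of the loops *)

Section ExponentialLoop.
Variable R : realType.
Implicit Types (r e : R) (kappa x : R[i]).

Definition for_small (P : R -> Prop) :=
  exists2 e0 : R, 0 < e0 & forall eps, 0 < eps <= e0 -> P eps.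

Lemma for_small_and (P Q : R -> Prop) : for_small P -> for_small Q ->
  for_small (fun eps => P eps /\ Q eps).
Proof.
move=> [d d0 hP] [e e0 hQ]; exists (Num.min d e); first by rewrite lt_min d0.
move=> eps /andP[ep]; rewrite le_min => /andP[ed ee].
by split; [apply: hP; rewrite ep|apply: hQ; rewrite ep].
Qed.

Lemma for_small_le (d : R) : 0 < d -> for_small (fun eps => eps <= d).
Proof. by move=> d0; exists d => // eps /andP[]. Qed.

Lemma powR_small (s d r : R) : 0 < s -> 0 < d -> 0 < r ->
  for_small (fun eps => d * eps `^ s < r).
Proof.
move=> s0 d0 r0; set q := r / 2 / d.
have q0 : 0 < q by rewrite !divr_gt0.
exists (q `^ s^-1); first exact: powR_gt0.
move=> eps /andP[e0 ee].
have : eps `^ s <= (q `^ s^-1) `^ s.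
  by apply: ge0_ler_powR => //; rewrite ?nnegrE ?powR_ge0 ?ltW.
rewrite -powRrM mulVf ?gt_eqF// (powRr1 (ltW q0)) /q ler_pdivlMr// mulrC => h.
by apply: le_lt_trans h _; rewrite ltr_pdivrMr// mulr_natr mulr2n ltrDl.
Qed.

(** Since [s < 1], the size [eps^s] of the loop dominates the size [O(eps)] of the
    displacement of the eigenvalues. *)
Lemma linear_lt_powR (s C d : R) : 0 < s <= 2^-1 -> 0 <= C -> 0 < d ->
  for_small (fun eps => C * eps < d * eps `^ s).
Proof.
move=> /andP[s0 s1] C0 d0.
have s1' : 0 < 1 - s.
  by rewrite subr_gt0 (le_lt_trans s1)// invf_lt1// ltr1n.
have C1 : 0 < C + 1 by rewrite ltr_wpDl.
have [e0 e00 he] := powR_small s1' C1 d0; exists e0 => // eps h.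
have /andP[ep _] := h.
have -> : C * eps = C * eps `^ (1 - s) * eps `^ s.
  rewrite -mulrA -powRD; last by rewrite subrK oner_eq0.
  by rewrite subrK powRr1// ltW.
rewrite ltr_pM2r ?powR_gt0// (le_lt_trans _ (he _ h))//.
by rewrite ler_wpM2r ?powR_ge0// lerDl.
Qed.

Lemma continuous_at0 (f : R -> R) : continuous f -> forall e, 0 < e ->
  exists2 rho, 0 < rho & forall y, `|y| < rho -> `|f 0 - f y| < e.
Proof.
move=> cf e e0; have /cvgrPdist_lt/(_ e e0) := cf 0.
rewrite near_simpl => /nbhs_ballP[rho rho0 h]; exists rho => // y yr.
by apply: h; rewrite /ball /= sub0r normrN.
Qed.

Lemma cexp_near (mu0 eta : R) : 0 < eta -> exists2 rho, 0 < rho &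
  forall kappa, `|complex.Re kappa - mu0| < rho -> `|complex.Im kappa| < rho ->
    cmod (cexp (- ('i * kappa)) - cexp (- ('i * mu0%:C))) < eta.
Proof.
move=> eta0; have e3 : 0 < eta / 3 by rewrite divr_gt0.
have [r1 r10 h1] := continuous_at0 (@continuous_expR R) e3.
have [r2 r20 h2] := continuous_at0 (@continuous_cos R) e3.
have [r3 r30 h3] := continuous_at0 (@continuous_sin R) e3.
exists (Num.min r1 (Num.min r2 r3)); first by rewrite !lt_min r10 r20.
case=> x y /=; rewrite !lt_min => /and3P[_ x2 x3] /and3P[y1 _ _].
set t := x - mu0 in x2 x3.
have -> : cexp (- ('i * (x +i* y))) =
    cexp (- ('i * mu0%:C)) * (expR y)%:C * (cos t -i* sin t).
  have -> : - ('i * (x +i* y)) = - ('i * mu0%:C) + (y -i* t).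
    by apply: complex_ext => /=; rewrite /t; ring.
  by rewrite cexpD -mulrA {2}/cexp /= cosN sinN.
rewrite -mulrA -[X in _ - X]mulr1 -mulrBr cmodM cmod_cexpNi /= expR0 mul1r.
have -> : (expR y)%:C * (cos t -i* sin t) - 1 =
   (expR y - 1)%:C * (cos t -i* sin t) + ((cos t - 1)%:C + (- sin t)%:C * 'i).
  by apply: complex_ext => /=; ring.
rewrite (le_lt_trans (cmodD _ _))//.
have -> : eta = eta / 3 + (eta / 3 + eta / 3) by field.
apply: ltrD; last first.
  rewrite (le_lt_trans (cmodD _ _))// cmodM cmodi mulr1 !cmod_real normrN ltrD//.
    by have := h2 _ x2; rewrite cos0 distrC.
  by have := h3 _ x3; rewrite sin0 sub0r normrN.
rewrite cmodM cmod_real.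
have -> : cmod (cos t -i* sin t) = 1.
  by rewrite /cmod normc_def /= sqrrN cos2Dsin2 sqrtr1.
by rewrite mulr1; have := h1 _ y1; rewrite expR0 distrC.
Qed.

Lemma atan_le (t : R) : 0 <= t -> 0 <= atan t <= t.
Proof.
move=> t0.
have [c _ h] := @MVT_segment R atan (fun y => (1 + y ^+ 2)^-1) 0 t t0
  (fun y _ => is_derive1_atan y)
  (continuous_subspaceT (@continuous_atan R)).
move: h; rewrite atan0 !subr0 => ->.
have c1 : 1 <= 1 + c ^+ 2 by rewrite lerDl sqr_ge0.
have c0 : 0 < 1 + c ^+ 2 by exact: lt_le_trans c1.
rewrite mulr_ge0 ?invr_ge0 ?(ltW c0)//=.
by rewrite ler_piMl// invf_le1.
Qed.

Lemma normr_atan_le (t : R) : `|atan t| <= `|t|.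
Proof.
have [t0|t0] := leP 0 t.
  by have /andP[h1 h2] := atan_le t0; rewrite !ger0_norm.
have nt : 0 <= - t by rewrite oppr_ge0 ltW.
have /andP[h1 h2] := atan_le nt.
by rewrite -[`|t|]normrN -[`|atan t|]normrN -atanN !ger0_norm.
Qed.

(** The logarithm is built from [ln] of the modulus and [atan] of the slope, which
    are Lipschitz near one; the factor [2] comes from a modulus and a real part
    that are at least one half. *)
Lemma polar_near_one (y : R[i]) r : 0 <= r <= 2^-1 -> cmod (y - 1) <= r ->
  exists kappa, [/\ cexp (- ('i * kappa)) = y, `|complex.Re kappa| <= 2 * r &
    `|complex.Im kappa| <= 2 * r].
Proof.
case: y => u v /andP[r0 r1] h.
have hu : `|u - 1| <= r by apply: le_trans h; have := cmodRe (u +i* v - 1).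
have hv : `|v| <= r.
  by apply: le_trans h; have := cmodIm (u +i* v - 1); rewrite /= subr0.
have half : 2 * 2^-1 = 1 :> R by rewrite mulfV.
have u2 : 2^-1 <= u.
  by move: hu; rewrite ler_norml => /andP[a1 a2]; lra.
have u0 : 0 < u by apply: lt_le_trans u2; rewrite invr_gt0.
set rho := cmod (u +i* v).
have rho1 : `|rho - 1| <= r.
  have a1 := cmod_sub_le (u +i* v) 1; have a2 := cmod_sub_le 1 (u +i* v).
  rewrite cmodBC in a2; rewrite cmod1 -/rho in a1 a2.
  by rewrite ler_norml; apply/andP; split; lra.
have rho2 : 2^-1 <= rho by move: rho1; rewrite ler_norml => /andP[a1 a2]; lra.
have rho0 : 0 < rho by apply: lt_le_trans rho2; rewrite invr_gt0.
set t := v / u; set phi := atan t.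
have rhoE : rho * cos phi = u.
  rewrite /phi cos_atan /rho /cmod normc_def /=.
  have -> : u ^+ 2 + v ^+ 2 = u ^+ 2 * (1 + t ^+ 2).
    by rewrite /t; field; rewrite gt_eqF.
  have t1 : 0 < 1 + t ^+ 2 by rewrite ltr_wpDr ?sqr_ge0.
  rewrite sqrtrM ?sqr_ge0// sqrtr_sqr gtr0_norm// mulfK// gt_eqF// sqrtr_gt0//.
have sinE : rho * sin phi = v.
  have cp : cos phi != 0.
    by apply: contraTneq u0 => e; rewrite -rhoE e mulr0 ltxx.
  have : tan phi = t by rewrite /phi atanK.
  rewrite /tan => /(congr1 (fun z => z * cos phi)); rewrite divfK// => ->.
  by rewrite mulrCA rhoE /t divfK// gt_eqF.
exists ((- phi) +i* ln rho); split=> /=.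
- have -> : - ('i * (- phi +i* ln rho)) = ln rho +i* phi.
    by apply: complex_ext => /=; ring.
  rewrite /cexp /= lnK ?posrE//.
  by apply: complex_ext => /=; rewrite -?rhoE -?sinE; ring.
- rewrite normrN (le_trans (normr_atan_le _))// /t normrM normfV (gtr0_norm u0).
  rewrite ler_pdivrMr// (le_trans hv)//.
  by rewrite mulrAC ler_peMl//; lra.
have l1 : ln rho <= r.
  have := @le_ln1Dx R (rho - 1); rewrite addrCA subrr addr0 => h1.
  apply: (le_trans (h1 _)); first by lra.
  by apply: le_trans rho1; exact: ler_norm.
have l2 : - ln rho <= 2 * r.
  rewrite -lnV ?posrE//.
  have := @le_ln1Dx R (rho^-1 - 1); rewrite addrCA subrr addr0 => h1.
  have ri : 0 < rho^-1 by rewrite invr_gt0.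
  apply: (le_trans (h1 _)); first by lra.
  have -> : rho^-1 - 1 = (1 - rho) / rho by field; rewrite gt_eqF.
  rewrite ler_pdivrMr// (@le_trans _ _ r)//.
    by apply: le_trans rho1; rewrite distrC; exact: ler_norm.
  by rewrite mulrAC ler_peMl//; lra.
by rewrite ler_norml; apply/andP; split; lra.
Qed.

Lemma cexp_local_surj (mu0 : R) x r : 0 <= r <= 2^-1 ->
  cmod (x - cexp (- ('i * mu0%:C))) <= r ->
  exists kappa, [/\ cexp (- ('i * kappa)) = x,
    `|complex.Re kappa - mu0| <= 2 * r & `|complex.Im kappa| <= 2 * r].
Proof.
move=> r0 h; set l0 := cexp _ in h.
have l1 : cmod l0 = 1 by rewrite /l0 cmod_cexpNi /= expR0.
have l0n : l0 != 0 by rewrite -cmod_eq0 l1 oner_eq0.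
have [|[p q] [h1 h2 h3]] := @polar_near_one (x / l0) r r0.
  have -> : x / l0 - 1 = (x - l0) / l0 by field.
  by rewrite cmodM cmodV l1 invr1 mulr1.
exists ((mu0 + p) +i* q); split=> //=; last by rewrite addrAC subrr add0r.
have -> : - ('i * ((mu0 + p) +i* q)) = - ('i * mu0%:C) + - ('i * (p +i* q)).
  by apply: complex_ext => /=; ring.
by rewrite cexpD h1 -/l0 mulrC divfK.
Qed.

Lemma cexp_local_inj (mu0 : R) kappa : `|complex.Re kappa - mu0| < pi ->
  cexp (- ('i * kappa)) = cexp (- ('i * mu0%:C)) -> kappa = mu0%:C.
Proof.
case: kappa => x y /= xp h.
have y0 : y = 0.
  have := congr1 (@cmod R) h; rewrite !cmod_cexpNi /= => /expR_inj; exact.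
rewrite y0 in h *.
have e (w : R) : cexp (- ('i * (w +i* 0))) = cos w -i* sin w.
  rewrite /cexp /=; apply: complex_ext => /=.
    have -> : - (0 * w - 1 * 0) = 0 :> R by ring.
    have -> : - (0 * 0 + 1 * w) = - w :> R by ring.
    by rewrite expR0 cosN sinN; ring.
  have -> : - (0 * w - 1 * 0) = 0 :> R by ring.
  have -> : - (0 * 0 + 1 * w) = - w :> R by ring.
  by rewrite expR0 cosN sinN; ring.
move: h; rewrite !e => -[hc /oppr_inj hs].
have c1 : cos `|x - mu0| = 1.
  have -> : cos `|x - mu0| = cos (x - mu0) by case: ger0P => // _; rewrite cosN.
  by rewrite cosB hc hs -!expr2 cos2Dsin2.
have : `|x - mu0| = 0.
  apply: cos_inj; rewrite ?cos0 ?c1//.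
    by rewrite in_itv /= normr_ge0 ltW.
  by rewrite in_itv /= lexx pi_ge0.
by move=> /eqP; rewrite normr_eq0 subr_eq0 => /eqP ->.
Qed.

End ExponentialLoop.

(** * Stability of the eigenvalue count *)

Unset Implicit Arguments.

Theorem corollary5p4 (R : realType) (M0 : nat) (hM0 : (0 < M0)%N)
    (Cnp : site -> 'M[R[i]]_4)
    (hCnp : coin M0 Cnp) (hnp : nonpenetrable M0 Cnp)
    (Ceps : R -> site -> 'M[R[i]]_4)
    (hCeps : forall eps, 0 < eps <= 1 -> forall x, Ceps eps x \is unitarymx)
    (hoff : forall eps, 0 < eps <= 1 ->
       forall x, ~ barrier M0 x -> Ceps eps x = Cnp x)
    (hK : forall eps, 0 < eps <= 1 -> forall x, barrier M0 x ->
       forall j k, cmod (Ceps eps x j k - Cnp x j k) < eps)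
    (a b : R) (ha : 0 < a) (hb : 0 < b)
    (mu0 : R)
    (hmu0 : point_spectrum (walk Cnp) (cexp (- ('i * mu0%:C))))
    (s : R) (hs : 0 < s <= 2^-1)
    (theta : R[i]) (htheta : complex.Im theta < 0) :
  exists eps0 : R, 0 < eps0 <= 1 /\
    forall eps : R, 0 < eps <= eps0 ->
      admissible_loop (walk Cnp) a b s eps mu0 /\
      exists m : nat,
        has_dim (ell2_eigenspace (walk Cnp) (cexp (- ('i * mu0%:C)))) m /\
        eigenvalue_count (translated_walk (Ceps eps) theta)
          (exp_loop_inside a b s eps mu0) m.
Proof.
have [n [iota [iota_inj iota_core]]] := core_enumeration M0.
set lam := cexp (- ('i * mu0%:C)).
have lam1 : cmod lam = 1 by rewrite /lam cmod_cexpNi /= expR0.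
pose core C := @walk_core_mx R n iota 1 C.
have Mnormal : core Cnp \is normalmx.
  exact: walk_core_mx_normal iota_inj iota_core Cnp hCnp hnp.
have [eta [e1 [C [eta0 e10 C0 pert]]]] := normal_perturbation lam Mnormal.
have [rho rho0 near_lam] := cexp_near mu0 eta0.
have s0 : 0 < s by case/andP: hs.
have ht : 0 < - complex.Im theta by rewrite oppr_gt0.
have C20 : 0 <= 2 * C by rewrite mulr_ge0// ltW.
have e80 : 0 < (2 * C)^-1 by rewrite invr_gt0 mulr_gt0.
(* The thresholds make the perturbation small, keep the loop inside the region
   where eigenvalues are localized and above the modulus of [c], and make it
   larger than the displacement of the eigenvalues. *)
have [eps0 eps00 small] := for_small_and (for_small_le ltr01) (for_small_and
  (for_small_le e10) (for_small_and (for_small_le e80)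
  (for_small_and (powR_small s0 ha rho0) (for_small_and (powR_small s0 hb rho0)
  (for_small_and (powR_small s0 hb ht) (for_small_and (powR_small s0 ha (pi_gt0 R))
  (for_small_and (linear_lt_powR hs C20 ha) (linear_lt_powR hs C20 hb)))))))).
exists eps0; split.
  by rewrite eps00 (small eps0 _).1// eps00 lexx.
move=> eps heps.
have [eps1 [eps_e1 [eps_C [a_rho [b_rho [b_theta [a_pi [C_a C_b]]]]]]]] := small eps heps.
have /andP[eps_gt0 _] := heps.
have eps01 : 0 < eps <= 1 by rewrite eps_gt0.
have inside_near kappa : rect_inside a b s eps mu0 kappa ->
    cmod (cexp (- ('i * kappa)) - lam) < eta.
  by move=> [h1 h2]; apply: near_lam; [exact: lt_trans a_rho|exact: lt_trans b_rho].
split.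
  split=> // mu hmu spec.
  have mod1 := point_spectrum_modulus hCnp spec.
  have ev : eigenvalue (core Cnp) (cexp (- ('i * mu))).
    exact: (point_spectrum_unimodular iota_inj iota_core hCnp mod1 spec).
  (* Localization with perturbation size zero isolates [lam] in the spectrum. *)
  have he : entries_le (core Cnp - core Cnp) 0.
    by move=> i j; rewrite subrr mxE cmod0.
  have [|h _] := pert 0 (core Cnp) _ he; first by rewrite lexx ltW.
  apply: cexp_local_inj; first by case: hmu => h1 _; exact: lt_trans a_pi.
  apply/eqP; rewrite -subr_eq0 -cmod_eq0 eq_le cmod_ge0 andbT.
  by have := h _ ev (inside_near _ hmu); rewrite mulr0.
exists (\rank (kermx (core Cnp - lam%:M))); split.
  exact: (has_dim_eigenspace iota_inj iota_core hCnp hnp lam1).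
set c := cexp (- ('i * theta)).
set A := translated_walk (Ceps eps) theta.
pose G := conjugated_coin theta (Ceps eps).
have Ceps_out x : ~ Omega_i M0 x -> Ceps eps x = 1%:M.
  move=> nx; rewrite hoff//; first exact: hCnp.2.
  by move=> [[[[]|[]]|[]]|[]].
have A_amp (u : wavefn R) : amplitude (A u) =
    perturbed_shift backward iota c (walk_perturbation iota c G) (amplitude u).
  exact: (amplitude_translated_walk_core iota_inj iota_core theta u Ceps_out).
set D := exp_loop_inside a b s eps mu0.
have D_gt x : D x -> cmod c < cmod x.
  move=> [kappa [_ hi] <-]; rewrite !cmod_cexpNi ltr_expR.
  have := lt_trans hi b_theta; rewrite ltr_norml => /andP[+ _].
  by rewrite opprK.
have supp := walk_perturbation_supp iota_core (G:=G) (c:=c).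
have box := no_reentry_box iota_core.
have Q_unit := phase_mx_unit iota theta.
have coreE := walk_core_mx_translated iota theta (Ceps eps).
pose B := walk_core_mx iota c G.
have rankE x : \rank (kermx ((B - x%:M) ^+ n.+1)) =
    \rank (kermx ((core (Ceps eps) - x%:M) ^+ n.+1)).
  by rewrite /B coreE; exact: rank_kermx_similar.
have eigE x : eigenvalue B x = eigenvalue (core (Ceps eps)) x.
  by rewrite /B coreE; exact: eigenvalue_similar.
have specE x : D x -> point_spectrum A x <-> eigenvalue (core (Ceps eps)) x.
  move=> /D_gt cx; rewrite -eigE.
  exact: (point_spectrum_core backwardK iota_inj supp box A_amp cx).
have close : entries_le (core (Ceps eps) - core Cnp) eps.
  move=> i j.
  have subE (X Y : 'M[R[i]]_n.+1) : (X - Y) i j = X i j - Y i j by rewrite !mxE.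
  rewrite subE /core !walk_core_mxE.
  case: eqP => _; last by rewrite subrr cmod0 ltW.
  rewrite !mul1r; have [bx|nb] := pselect (barrier M0 (iota i).1).
    by apply/ltW; exact: hK.
  by rewrite hoff// subrr cmod0 ltW.
have [|near_eig count_eig] := pert eps (core (Ceps eps)) _ close.
  by rewrite eps_e1 ltW.
have D_eig x : eigenvalue (core (Ceps eps)) x -> (D x <-> cmod (x - lam) < eta).
  move=> ev; split; first by move=> [kappa hk <-]; exact: inside_near.
  move=> /(near_eig _ ev) h.
  have [|kappa [hk h1 h2]] := cexp_local_surj _ h.
    apply/andP; split; first by rewrite mulr_ge0// ltW.
    by move: eps_C; rewrite invfM ler_pdivlMr// mulrC.
  exists kappa => //; split; rewrite mulrA in h1 h2.
    exact: le_lt_trans h1 C_a.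
  exact: le_lt_trans h2 C_b.
have [t [ut _ ht']] := spectrum_seq (core (Ceps eps)).
exists [seq x <- t | `[< D x >]], (fun x => \rank (kermx ((B - x%:M) ^+ n.+1))).
split.
- exact: filter_uniq.
- move=> x; rewrite mem_filter; split.
    by move=> /andP[/asboolP Dx /ht' ev]; split=> //; exact/specE.
  by move=> [Dx /(specE _ Dx) ev]; apply/andP; split; [exact/asboolP|exact/ht'].
- move=> x; rewrite mem_filter => /andP[/asboolP Dx /ht' ev].
  rewrite -eigE in ev.
  exact: (algebraic_multiplicity_core backwardK iota_inj supp box A_amp (D_gt _ Dx) ev).
apply/esym; apply: (etrans (eq_bigr _ (fun x _ => rankE x))).
apply: count_eig; first exact: filter_uniq.
move=> x; rewrite mem_filter; split.
  by move=> /andP[/asboolP Dx /ht' ev]; split=> //; exact/(D_eig _ ev).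
by move=> [ev /(D_eig _ ev) Dx]; apply/andP; split; [exact/asboolP|exact/ht'].
Qed.
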